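(* Let $G_\alpha(t)$, $t\in[0,1]$, be the continuous centered Gaussian process with covariance function \[ \operatorname{Cov}\bigl(G_\alpha(s),G_\alpha(t)\bigr)=\frac{2}{2\alpha-1}\,s^\alpha\bigl(t^{1-\alpha}-t^\alpha\bigr),\qquad 0\le s\le t\le 1 \] (equivalently, $G_\alpha(t)=(\alpha-1/2)^{-1/2}t^{1-\alpha}\mathrm{Br}(t^{2\alpha-1})$ for a standard Brownian bridge $\mathrm{Br}$, with $G_\alpha(0)=0$). Then, as $n\to\infty$, conditionally on the event $BINGO(n,n)$ (i.e. $\Delta_{2n}=0$), \[ n^{-1/2}\Delta_{\lfloor 2nt\rfloor}\ \xrightarrow{d}\ G_\alpha(t),\qquad t\in[0,1], \] in the space $D[0,1]$ with the Skorohod topology.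
   Context: Fix $\alpha>1$. Let $(X_k,Y_k)_{k\ge2}$ be the Markov chain on $\mathbb N\times\mathbb N$ with $(X_2,Y_2)=(1,1)$ and, from state $(i,j)$, moving to $(i+1,j)$ with probability $i^\alpha/(i^\alpha+j^\alpha)$ and to $(i,j+1)$ with probability $j^\alpha/(i^\alpha+j^\alpha)$ (so $X_k+Y_k=k$; this is a two-urn model where each new ball goes to an urn with probability proportional to the $\alpha$-th power of its current content). $BINGO(i,j)$ is the event that the chain visits $(i,j)$, i.e. $(X_{i+j},Y_{i+j})=(i,j)$. Set $\Delta_k=X_k-Y_k$ for $k\ge2$ and $\Delta_0=\Delta_1=0$. *)

(* Defs.v *)
From HB Require Import structures.
From mathcomp Require Import all_boot all_order all_algebra.
From mathcomp Require Import all_classical all_reals all_analysis.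
Set Implicit Arguments. Unset Strict Implicit. Unset Printing Implicit Defensive.
Import Order.TTheory GRing.Theory Num.Theory.
Import numFieldNormedType.Exports.
Local Open Scope classical_set_scope.
Local Open Scope ring_scope.

Section Defs.
Variable R : realType.

(* The generalized Polya urn chain (X_k, Y_k)_{k >= 2}, (X_2,Y_2)=(1,1). *)
(* A trajectory up to time 2 + size s is encoded by s : seq bool, where   *)
(* the k-th entry (k = 0,1,..) is true iff at step from time k+2 to k+3   *)
(* the ball goes to the first urn (X increases).                          *)

(* X_k and Y_k along the trajectory s, for 2 <= k <= 2 + size s *)
Definition Xpos (s : seq bool) (k : nat) : nat := (1 + count id (take (k - 2) s))%N.
Definition Ypos (s : seq bool) (k : nat) : nat := (1 + count negb (take (k - 2) s))%N.

Definition step_prob (alpha : R) (i j : nat) (b : bool) : R :=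
  let a := (i%:R `^ alpha) in let c := (j%:R `^ alpha) in
  (if b then a else c) / (a + c).

Definition path_weight (alpha : R) (s : seq bool) : R :=
  \prod_(k < size s) step_prob alpha (Xpos s (k + 2)) (Ypos s (k + 2)) (nth false s k).

Definition Delta (s : seq bool) (k : nat) : R :=
  if (k < 2)%N then 0 else (Xpos s k)%:R - (Ypos s k)%:R.

Definition bingo (s : seq bool) (i j : nat) : bool :=
  (Xpos s (i + j) == i) && (Ypos s (i + j) == j).

Definition scaled_path (n : nat) (s : seq bool) : R -> R :=
  fun t => (Num.sqrt (n%:R))^-1 * Delta s (Num.truncn (n.*2%:R * t)).

(* E[ f(n^{-1/2} Delta_{floor(2n .)}) | BINGO(n,n) ]: the trajectories up to
   time 2n are the (2n-2)-tuples of booleans *)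
Definition cond_expect_bingo (alpha : R) (n : nat) (f : (R -> R) -> R) : R :=
  (\sum_(s : (n.*2 - 2).-tuple bool | bingo s n n) path_weight alpha s * f (scaled_path n s))
  / (\sum_(s : (n.*2 - 2).-tuple bool | bingo s n n) path_weight alpha s).

(* The Skorohod space D[0,1] (functions R -> R, only values on [0,1]   *)
(* matter) with the Skorohod J1 metric of Billingsley.                 *)

Definition cadlag01 (x : R -> R) : Prop :=
  (forall t, 0 <= t -> t < 1 -> x @ t^'+ --> x t) /\
  (forall t, 0 < t -> t <= 1 -> cvg (x @ t^'-)).

Definition time_change (l : R -> R) : Prop :=
  [/\ {within `[0, 1], continuous l}, l 0 = 0, l 1 = 1 &
      forall s t, 0 <= s -> s < t -> t <= 1 -> l s < l t].

Definition skorohod_dist (x y : R -> R) : R :=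
  inf [set e : R | exists l, time_change l /\
        forall t, 0 <= t -> t <= 1 -> `|l t - t| <= e /\ `|x t - y (l t)| <= e].

Definition skorohod_bounded_continuous (f : (R -> R) -> R) : Prop :=
  (exists M : R, forall x, cadlag01 x -> `|f x| <= M) /\
  (forall x, cadlag01 x -> forall e : R, 0 < e ->
     exists2 d : R, 0 < d & forall y, cadlag01 y -> skorohod_dist x y < d ->
                                      `|f y - f x| < e).

Definition G_cov (alpha : R) (s t : R) : R :=
  let a := Num.min s t in let b := Num.max s t in
  2 / (2 * alpha - 1) * (a `^ alpha) * (b `^ (1 - alpha) - b `^ alpha).

Definition centered_normal {d} {T : measurableType d} (P : probability T R)
    (X : T -> R) (v : R) : Prop :=
  forall B : set R, measurable B ->
    P (X @^-1` B) = if v == 0 then \d_(0 : R) B else normal_prob 0 (Num.sqrt v) B.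

Definition continuous_centered_gaussian_process {d} {T : measurableType d}
    (P : probability T R) (cov : R -> R -> R) (G : R -> T -> R) : Prop :=
  [/\ (forall t, 0 <= t -> t <= 1 -> measurable_fun setT (G t)),
      (forall w, {within `[0, 1], continuous (fun t => G t w)}) &
      (forall (k : nat) (ts cs : 'I_k -> R), (forall i, 0 <= ts i <= 1) ->
         centered_normal P (fun w => \sum_(i < k) cs i * G (ts i) w)
                           (\sum_(i < k) \sum_(j < k) cs i * cs j * cov (ts i) (ts j)))].

End Defs.

(* Main.v *)
Require Import Defs.
From HB Require Import structures.
From mathcomp Require Import all_boot all_order all_algebra.
From mathcomp Require Import all_classical all_reals all_analysis.
From mathcomp Require Import measurable_realfun ring lra zify.
Set Implicit Arguments. Unset Strict Implicit. Unset Printing Implicit Defensive.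
Import Order.TTheory GRing.Theory Num.Theory.
Import numFieldNormedType.Exports.
Local Open Scope classical_set_scope.
Local Open Scope ring_scope.

(* Reversing time, the urn conditioned on BINGO(n, n) is the chain that starts
   from (n, n), removes a ball from an urn with content i rather than from the
   other one with content j with probability i^alpha / (i^alpha + j^alpha), and
   is conditioned to reach (1, 1).  The probability of reaching (1, 1) is
   bounded below and, because the sum of l^(-alpha) converges, nearly constant
   away from the axes, so the conditioning does not affect macroscopic times.
   The difference D of the two contents is attracted to 0: at level k its drift
   is close to -alpha D / k.  Telescoping
   exp(-V_l / 2) E cos(b + sum_(l' > l) th_l' D_l' + lam_l D_l), where the
   multiplier lam absorbs the linear drift and V its accumulated variance, gives
   the characteristic functions of the finite-dimensional marginals, and the
   limit of V is the quadratic form of G_cov.  Fourth moments of stopped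
   martingale parts over the blocks of a grid give tightness.  A functional that
   is Lipschitz for the sup norm is then replaced by a function of finitely many
   coordinates, and this one by a trigonometric polynomial (Bernstein
   polynomials in sines); functionals continuous for the Skorohod distance are
   sandwiched between Lipschitz envelopes. *)

(** The reversal is exact by detailed balance: with c(i, j) = i^-alpha + j^-alpha, the forward
    probability of a step times c at its lower end equals the backward probability times c at its
    upper end, so all BINGO paths have forward and backward weights in the same ratio. Time 0 of the
    limit is where the backward chain ends, and there the estimates degenerate: at level k the
    linearised drift carries a mean error of order 1/k. Marginals are therefore computed at times at
    least tau > 0, with constants that blow up as tau tends to 0, and tightness treats the block
    that reaches level 2 apart, with a weaker first-moment bound. The conditioning is removed in two
    ways: at the cost of a constant factor where only an upper bound is wanted, and with a vanishing
    error where a limit is wanted. Measurability of the functional is a conclusion, and the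
    processes are unbounded. Hence every approximant is bounded on the whole space, and
    measurability travels with convergence from each class of functionals to the next. *)

(** * Elementary inequalities for sine, cosine, exponential and powers *)

Section ElementaryBounds.
Variable R : realType.
Implicit Types x y u : R.

(** Each use raises the order of vanishing at 0 by one, so the Taylor bounds below follow from one
    another; factorials are given up. *)
Lemma MVT_norm_le (F F' : R -> R) (C : R) (k : nat) x :
  (forall t : R, is_derive t (1 : R) F (F' t)) -> F 0 = 0 -> 0 <= C ->
  (forall t, `|F' t| <= C * `|t| ^+ k) -> `|F x| <= C * `|x| ^+ k.+1.
Proof.
move=> dF F0 C0 hF'.
have cF a b : {within `[a, b], continuous F}.
  by apply: derivable_within_continuous => z _; have [] := dF z.
have main (c : R) : `|c| <= `|x| -> `|F' c| * `|x| <= C * `|x| ^+ k.+1.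
  move=> cx; rewrite exprSr mulrA ler_wpM2r// (le_trans (hF' c))//.
  by rewrite ler_wpM2l// lerXn2r ?nnegrE.
have [x0|x0|->] := ltgtP x 0; last by rewrite F0 normr0 mulr_ge0.
- have [c cx E] := @MVT _ F F' _ _ x0 (fun t _ => dF t) (cF _ _).
  rewrite -[F x]opprK normrN -[- F x]add0r -{1}F0 E sub0r normrM normrN.
  apply: main; move: cx; rewrite in_itv/= => /andP[cx c0].
  by rewrite !ler0_norm ?lerN2 ?ltW.
- have [c cx E] := @MVT _ F F' _ _ x0 (fun t _ => dF t) (cF _ _).
  rewrite -[F x]subr0 -{1}F0 E subr0 normrM.
  apply: main; move: cx; rewrite in_itv/= => /andP[c0 cx].
  by rewrite !ger0_norm ?ltW.
Qed.

Lemma norm_sin_le x : `|sin x| <= `|x|.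
Proof.
have := @MVT_norm_le sin cos 1 0 x (@is_derive_sin R) (sin0 R) ler01.
rewrite mul1r expr1; apply => t; rewrite mul1r expr0; exact: cos_max.
Qed.

Lemma norm_cosB1_le x : `|cos x - 1| <= x ^+ 2.
Proof.
rewrite -real_normK ?num_real//.
have := @MVT_norm_le (fun t => cos t - 1) (fun t => - sin t) 1 1 x.
rewrite mul1r; apply => //; last by move=> t; rewrite normrN mul1r norm_sin_le.
- by move=> t; apply: is_derive_eq; rewrite ?subr0.
- by rewrite cos0 subrr.
Qed.

Lemma norm_sinBid_le x : `|sin x - x| <= `|x| ^+ 3.
Proof.
have := @MVT_norm_le (fun t => sin t - t) (fun t => cos t - 1) 1 2 x.
rewrite mul1r; apply => //.
- by rewrite sin0 subrr.
- by move=> t; rewrite mul1r real_normK ?num_real// norm_cosB1_le.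
Qed.

Lemma norm_cosB1D_le x : `|cos x - 1 + x ^+ 2 / 2| <= `|x| ^+ 4.
Proof.
have := @MVT_norm_le (fun t => cos t - 1 + t ^+ 2 / 2) (fun t => t - sin t) 1 3 x.
rewrite mul1r; apply => //.
- move=> t; apply: is_derive_eq.
  by rewrite /GRing.scale/= !mulr0 add0r; field.
- by rewrite cos0; ring.
- by move=> t; rewrite mul1r distrC norm_sinBid_le.
Qed.

Lemma norm_cosB_le x u : `|cos (x - u) - (cos x + u * sin x)| <= 2 * u ^+ 2.
Proof.
have /= := @MVT_norm_le (fun t => cos (x - t) - cos x - t * sin x)
  (fun t => sin (x - t) - sin x) 2 1 u.
rewrite real_normK ?num_real// opprD addrA; apply => //.
- move=> t; apply: is_derive_eq.
  by rewrite /GRing.scale/=; ring.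
- by rewrite subr0; ring.
move=> t; rewrite expr1.
have -> : sin (x - t) - sin x = sin x * (cos t - 1) - cos x * sin t.
  by rewrite sinB; ring.
rewrite (le_trans (ler_normB _ _))// !normrM.
have H1 : `|cos t - 1| <= `|t|.
  have := @MVT_norm_le (fun t => cos t - 1) (fun t => - sin t) 1 0 t.
  rewrite mul1r expr1; apply => //.
  - by move=> s; apply: is_derive_eq; rewrite ?subr0.
  - by rewrite cos0 subrr.
  - by move=> s; rewrite normrN expr0 mul1r sin_max.
rewrite mulrDl mul1r lerD//.
- by rewrite -[leRHS]mul1r ler_pM// sin_max.
- by rewrite -[leRHS]mul1r ler_pM// ?cos_max ?norm_sin_le.
Qed.

Lemma cos_lip x y : `|cos x - cos y| <= `|x - y|.
Proof.
have := @MVT_norm_le (fun t => cos (y + t) - cos y) (fun t => - sin (y + t)) 1 0 (x - y).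
rewrite mul1r expr1 /= (addrC y (x - y)) subrK; apply => //.
- by move=> t; apply: is_derive_eq; rewrite /GRing.scale/=; ring.
- by rewrite addr0 subrr.
- by move=> t; rewrite normrN expr0 mul1r sin_max.
Qed.

Lemma norm_expRN_le u : 0 <= u -> `|expR (- u) - 1 + u| <= u ^+ 2.
Proof.
move=> u0; have h1 : 1 - u <= expR (- u) by exact: expR_ge1Dx.
have h2 : expR (- u) <= (1 + u)^-1.
  by rewrite expRN lef_pV2 ?posrE ?expR_gt0 ?expR_ge1Dx//; lra.
have h3 : (1 + u)^-1 <= 1 - u + u ^+ 2.
  rewrite -[leLHS]mul1r ler_pdivrMr; last lra.
  have : 0 <= u ^+ 3 by rewrite exprn_ge0.
  by nra.
rewrite ger0_norm; lra.
Qed.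

(** Both sides expand as 1 - x^2/2 up to fourth order. As cos is the characteristic function of a
    fair step of size 1, this is the price of replacing one step by a Gaussian. *)
Lemma norm_expR_cos_le x : `|expR (- (x ^+ 2 / 2)) - cos x| <= 2 * x ^+ 4.
Proof.
have h1 := norm_cosB1D_le x.
have h2 : `|expR (- (x ^+ 2 / 2)) - 1 + x ^+ 2 / 2| <= (x ^+ 2 / 2) ^+ 2.
  by apply: norm_expRN_le; rewrite divr_ge0// sqr_ge0.
have E4 : `|x| ^+ 4 = x ^+ 4 by rewrite -[4%N]/(2 * 2)%N !exprM real_normK ?num_real.
rewrite E4 in h1.
have -> : expR (- (x ^+ 2 / 2)) - cos x =
  (expR (- (x ^+ 2 / 2)) - 1 + x ^+ 2 / 2) - (cos x - 1 + x ^+ 2 / 2) by ring.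
rewrite (le_trans (ler_normB _ _))// (le_trans (lerD h2 h1))//.
have : 0 <= x ^+ 4 by rewrite (exprM _ 2 2) sqr_ge0.
have -> : (x ^+ 2 / 2) ^+ 2 = x ^+ 4 / 4 by field.
by lra.
Qed.

(** Young's inequality with exponents p and p / (p - 1), applied to the product of 1 + y and 1. *)
Lemma bernoulli_powR (p y : R) : 1 <= p -> - 1 <= y -> 1 + p * y <= (1 + y) `^ p.
Proof.
move=> p1 y1; have p0 : 0 < p by lra.
have [->|yN] := eqVneq y (- 1).
  by rewrite subrr powR0; [lra|rewrite gt_eqF].
have y0 : 0 < 1 + y by rewrite lt_neqAle eq_sym; apply/andP; split; [apply: contra_neq yN|]; lra.
have [h|h] := lerP (1 + p * y) 0; first by rewrite (le_trans h)// powR_ge0.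
rewrite /powR gt_eqF//.
have [->|pn1] := eqVneq p 1; first by rewrite !mul1r lnK.
have q0 : 0 < (p - 1) by rewrite subr_gt0 lt_neqAle eq_sym pn1.
pose q := p / (p - 1).
have pq : p^-1 + q^-1 = 1 by rewrite /q invf_div; field; lra.
have := @conjugate_powR R ((1 + y) `^ 1) 1 p q (powR_ge0 _ _) ler01 p0.
rewrite mulr1 powR1 /= powRr1 ?(ltW y0)// mul1r divr_gt0// => /(_ isT pq).
have -> : q^-1 = 1 - p^-1 by rewrite -pq; ring.
rewrite /powR gt_eqF// => H.
have := ler_wpM2l (ltW p0) H.
set X := expR _.
have -> : p * (X / p + (1 - p^-1)) = X + p - 1 by field; lra.
lra.
Qed.

(** The lower bound is Bernoulli's inequality at y. The upper bound is the same inequality at 1/(1 +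
    y) - 1, inverted; smallness of y keeps the denominator 1 + y - p y above 1/2. *)
Lemma powR_taylor2 (p y : R) : 1 <= p -> `|y| <= (2 * p)^-1 ->
  `|(1 + y) `^ p - 1 - p * y| <= 2 * p ^+ 2 * y ^+ 2.
Proof.
move=> p1 hy; have p0 : 0 < p by lra.
have hy' : `|y| <= 2^-1.
  by rewrite (le_trans hy)// lef_pV2 ?posrE; lra.
have py : `|p * y| <= 2^-1.
  rewrite normrM (ger0_norm (ltW p0)) mulrC -ler_pdivlMr// -invfM//.
move: hy' py; rewrite !ler_norml => /andP[y1 y2] /andP[py1 py2].
have h1 : 1 + p * y <= (1 + y) `^ p by apply: bernoulli_powR; lra.
have z0 : 0 < 1 + y by lra.
have h2 : 1 + p * ((1 + y)^-1 - 1) <= ((1 + y) `^ p)^-1.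
  have := @bernoulli_powR p ((1 + y)^-1 - 1) p1.
  rewrite addrCA subrr addr0 -!powR_inv1 ?powR_ge0 ?(ltW z0)// -!powRrM mulN1r mulrN1; apply.
  by have := powR_ge0 (1 + y) (-1); lra.
have D2 : 0 <= y - p * y + 2^-1.
  have [yy|yy] := lerP 0 y; first lra.
  have : 0 <= (1 - p) * y by nra.
  by lra.
have D0 : 0 < 1 + y - p * y by lra.
have h3 : (1 + y) `^ p <= (1 + y) / (1 + y - p * y).
  rewrite -[leLHS]invrK -[leRHS]invrK lef_pV2 ?posrE ?invr_gt0 ?powR_gt0 ?divr_gt0//.
  apply: le_trans h2; rewrite le_eqVlt; apply/orP; left; apply/eqP; field.
  by apply/andP; split; apply/eqP; lra.
have h4 : (1 + y) / (1 + y - p * y) <= 1 + p * y + 2 * p ^+ 2 * y ^+ 2.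
  rewrite ler_pdivrMr//.
  have : 0 <= p * y ^+ 2 by rewrite mulr_ge0 ?sqr_ge0// ltW.
  have Hp : 0 <= p ^+ 2 * y ^+ 2 by rewrite mulr_ge0 ?sqr_ge0.
  by nra.
apply/andP; split; lra.
Qed.

Lemma powRN_ge (g z : R) : 0 < g -> 0 < z -> 1 - g * (z - 1) <= z `^ (- g).
Proof.
move=> g0 z0; rewrite /powR gt_eqF//.
apply: le_trans (expR_ge1Dx _); rewrite mulNr lerD2l lerN2 ler_pM2l//.
by have := @le_ln1Dx R (z - 1); rewrite addrCA subrr addr0; apply; lra.
Qed.

(** With the next lemma, a substitute for comparing sums of powers with integrals: each term is
    compared with a difference, and the differences telescope. *)
Lemma powRN_telescope_ub (g x : R) : 0 < g -> 1 < x ->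
  g * x `^ (- g - 1) <= (x - 1) `^ (- g) - x `^ (- g).
Proof.
move=> g0 x1; have x0 : 0 < x by lra.
have := @powRN_ge g ((x - 1) / x) g0; rewrite divr_gt0 ?subr_gt0// => /(_ isT).
have -> : (x - 1) / x - 1 = - x^-1 by field; lra.
rewrite mulrN opprK => h.
have := ler_wpM2r (powR_ge0 x (- g)) h.
rewrite -powRM//; [|by rewrite divr_ge0; lra|exact: ltW].
rewrite divfK ?gt_eqF// mulrDl mul1r -lerBrDl => /(le_trans _); apply.
rewrite powRD; last by apply/implyP => _; rewrite gt_eqF.
by rewrite powR_inv1 ?(ltW x0)// -mulrA (mulrC x^-1).
Qed.

Lemma powRN_telescope_lb (g x : R) : 0 < g -> 0 < x ->
  x `^ (- g) - (x + 1) `^ (- g) <= g * x `^ (- g - 1).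
Proof.
move=> g0 x0.
have := @powRN_ge g ((x + 1) / x) g0; rewrite divr_gt0 ?addr_gt0// => /(_ isT).
have -> : (x + 1) / x - 1 = x^-1 by field; lra.
move=> h.
have := ler_wpM2r (powR_ge0 x (- g)) h.
rewrite -powRM//; [|by rewrite divr_ge0; lra|exact: ltW].
rewrite divfK ?gt_eqF// mulrBl mul1r => H.
rewrite powRD; last by apply/implyP => _; rewrite gt_eqF.
rewrite powR_inv1 ?(ltW x0)// (mulrC _ x^-1) mulrA; lra.
Qed.

End ElementaryBounds.

(** * Transition probabilities and drift of one backward step *)

Section StepProbability.
Variables (R : realType) (alpha : R).
Hypothesis alpha_gt1 : 1 < alpha.

Let alpha_gt0 : 0 < alpha. Proof. by move: alpha_gt1; lra. Qed.

Definition rate (i : nat) : R := i%:R `^ alpha.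

Lemma rate_ge0 i : 0 <= rate i. Proof. exact: powR_ge0. Qed.

Lemma rate0 : rate 0 = 0. Proof. by rewrite /rate powR0// gt_eqF. Qed.

Lemma rate1 : rate 1 = 1. Proof. by rewrite /rate powR1. Qed.

Lemma rate_gt0 i : (0 < i)%N -> 0 < rate i.
Proof. by move=> i0; rewrite powR_gt0// ltr0n. Qed.

Lemma rateD_gt0 i j : (0 < i + j)%N -> 0 < rate i + rate j.
Proof.
rewrite addn_gt0 => /orP[i0|j0].
- by rewrite ltr_wpDr ?rate_ge0 ?rate_gt0.
- by rewrite ltr_wpDl ?rate_ge0 ?rate_gt0.
Qed.

Lemma step_prob_ge0 i j b : 0 <= step_prob alpha i j b.
Proof. by rewrite /step_prob divr_ge0 ?addr_ge0 ?powR_ge0//; case: b; exact: powR_ge0. Qed.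

Lemma step_prob_sum i j : (0 < i + j)%N ->
  step_prob alpha i j true + step_prob alpha i j false = 1.
Proof. by move=> ij; rewrite /step_prob -mulrDl divff// gt_eqF// rateD_gt0. Qed.

Lemma step_prob_true0 j : step_prob alpha 0 j true = 0.
Proof. by rewrite /step_prob -/(rate 0) rate0 mul0r. Qed.

Lemma step_prob_false0 i : step_prob alpha i 0 false = 0.
Proof. by rewrite /step_prob -/(rate 0) rate0 mul0r. Qed.

(** Minus the mean change of i - j in one backward step from (i, j). *)
Definition bias (i j : nat) : R := (rate i - rate j) / (rate i + rate j).

Lemma biasN i j : bias j i = - bias i j.
Proof. by rewrite /bias (addrC (rate j) (rate i)) -mulNr opprB. Qed.

Lemma step_prob_bias i j b : (0 < i + j)%N ->
  step_prob alpha i j b = (if b then 1 + bias i j else 1 - bias i j) / 2.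
Proof.
move=> ij; have := rateD_gt0 ij; rewrite /step_prob /bias -!/(rate _) => S0.
by case: b; field; lra.
Qed.

Lemma norm_bias_le1 i j : `|bias i j| <= 1.
Proof.
have [ij0|] := leqP (i + j) 0.
  have /eqP[-> ->] : (i, j) == (0%N, 0%N) by apply/eqP; congr pair; lia.
  by rewrite /bias subrr mul0r normr0.
move=> /rateD_gt0 S0.
rewrite /bias normrM normfV (gtr0_norm S0) ler_pdivrMr// mul1r ler_norml.
by have := rate_ge0 i; have := rate_ge0 j; lra.
Qed.

Let bias_ge i j : (0 < i + j)%N -> (j <= i)%N ->
  (i%:R - j%:R) / (i + j)%:R <= bias i j.
Proof.
move=> ij ji; have := rateD_gt0 ij => S0.
rewrite /bias ler_pdivrMr ?ltr0n// mulrAC ler_pdivlMr// natrD.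
have rE k : rate k = k%:R * k%:R `^ (alpha - 1) by rewrite mulr_powRB1.
have h : j%:R `^ (alpha - 1) <= i%:R `^ (alpha - 1) :> R.
  by apply: ge0_ler_powR; rewrite ?nnegrE ?ler_nat// subr_ge0 ltW.
have : 0 <= i%:R * j%:R * (i%:R `^ (alpha - 1) - j%:R `^ (alpha - 1)) :> R.
  by rewrite mulr_ge0 ?mulr_ge0 ?subr_ge0.
rewrite !rE; nra.
Qed.

(** The pull towards 0 is at least that of the case alpha = 1, because k^(alpha - 1) is
    nondecreasing in k. The moment bounds for the difference rest on this inequality alone. *)
Lemma bias_mul_ge i j : (0 < i + j)%N ->
  (i%:R - j%:R) ^+ 2 / (i + j)%:R <= bias i j * (i%:R - j%:R).
Proof.
move=> ij; have [ji|ji] := leqP j i.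
  rewrite expr2 -mulrA mulrC ler_wpM2r// ?bias_ge// subr_ge0 ler_nat//.
rewrite -[leRHS]mulrNN -biasN opprB -sqrrN opprB expr2 -mulrA mulrC addnC.
by rewrite ler_wpM2r// ?bias_ge ?(ltnW ji)//; [rewrite subr_ge0 ler_nat ltnW|rewrite addnC].
Qed.

(** With y = (i - j)/(i + j) the bias is the quotient of difference and sum of (1 + y)^alpha and (1
    - y)^alpha, both expanded to second order. If |y| > 1/(2 alpha), the right-hand side already
    exceeds the trivial bound 1 + alpha. *)
Lemma bias_linear i j : (0 < i + j)%N ->
  `|bias i j - alpha * (i%:R - j%:R) / (i + j)%:R| <=
  4 * alpha ^+ 2 * (1 + alpha) * ((i%:R - j%:R) / (i + j)%:R) ^+ 2.
Proof.
move=> ij; pose k : R := (i + j)%:R; pose y : R := (i%:R - j%:R) / k.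
have k0 : 0 < k by rewrite ltr0n.
have y1 : `|y| <= 1.
  rewrite /y normrM normfV (gtr0_norm k0) ler_pdivrMr// mul1r /k natrD ler_norml.
  by have : 0 <= i%:R :> R by []; have : 0 <= j%:R :> R by []; lra.
rewrite -/k -mulrA -/y.
have a0 := alpha_gt0; have a1 := alpha_gt1.
have y20 : 0 <= y ^+ 2 by exact: sqr_ge0.
have [hy|hy] := lerP `|y| (2 * alpha)^-1; last first.
  have b1 := norm_bias_le1 i j.
  have hh : 1 <= 4 * alpha ^+ 2 * y ^+ 2.
    have : 1 <= 2 * alpha * `|y|.
      by rewrite -ler_pdivrMl ?mulr1 ?(ltW hy)//; lra.
    rewrite -(real_normK (num_real y)) => h.
    have -> : 4 * alpha ^+ 2 * `|y| ^+ 2 = (2 * alpha * `|y|) ^+ 2 by ring.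
    by rewrite expr_ge1//; nra.
  apply: (@le_trans _ _ (1 + alpha)); last first.
    have -> : 4 * alpha ^+ 2 * (1 + alpha) * y ^+ 2 =
      (1 + alpha) * (4 * alpha ^+ 2 * y ^+ 2) by ring.
    by rewrite -[leLHS]mulr1 ler_wpM2l//; lra.
  rewrite (le_trans (ler_normB _ _))// lerD// normrM (gtr0_norm a0).
  by rewrite -[leRHS]mulr1 ler_wpM2l// ltW.
have iE : i%:R = (k / 2) * (1 + y) by rewrite /y /k natrD; field; rewrite -natrD gt_eqF.
have jE : j%:R = (k / 2) * (1 - y) by rewrite /y /k natrD; field; rewrite -natrD gt_eqF.
move: (y1); rewrite ler_norml => /andP[yl yr].
have h1 := powR_taylor2 (ltW a1) hy.
have h2 := @powR_taylor2 R alpha (- y) (ltW a1); rewrite normrN sqrrN in h2; have {h2} := h2 hy => h2.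
have b1 : 1 + alpha * y <= (1 + y) `^ alpha by apply: bernoulli_powR; lra.
have b2 : 1 + alpha * - y <= (1 - y) `^ alpha by apply: bernoulli_powR; lra.
have K0 : 0 < (k / 2) `^ alpha by rewrite powR_gt0 ?divr_gt0.
have E : bias i j = ((1 + y) `^ alpha - (1 - y) `^ alpha) / ((1 + y) `^ alpha + (1 - y) `^ alpha).
  rewrite /bias /rate iE jE.
  rewrite (@powRM _ _ (1 + y)); [|by rewrite divr_ge0// ltW|lra].
  rewrite (@powRM _ _ (1 - y)); [|by rewrite divr_ge0// ltW|lra].
  by rewrite -mulrBr -mulrDr invfM mulrACA divff ?gt_eqF// mul1r.
rewrite E.
set P := (1 + y) `^ alpha in h1 b1 *; set Q := (1 - y) `^ alpha in h2 b2 *.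
have S2 : 2 <= P + Q by lra.
have -> : (P - Q) / (P + Q) - alpha * y =
  ((P - 1 - alpha * y) - (Q - 1 - alpha * - y) -
   alpha * y * ((P - 1 - alpha * y) + (Q - 1 - alpha * - y))) / (P + Q) by field; lra.
rewrite normrM normfV (@ger0_norm _ (P + Q)); last lra.
rewrite ler_pdivrMr; last lra.
set A := P - 1 - _ in h1 *; set B := Q - 1 - _ in h2 *.
have ay : `|alpha * y| <= 2^-1.
  by rewrite normrM (gtr0_norm a0) mulrC -ler_pdivlMr// -invfM.
apply: (@le_trans _ _ (`|A| + `|B| + 2^-1 * (`|A| + `|B|))).
  rewrite (le_trans (ler_normB _ _))// lerD ?ler_normB// normrM.
  by rewrite ler_pM// ler_normD.
set C := 2 * alpha ^+ 2 * y ^+ 2 in h1 h2.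
have C0 : 0 <= C by rewrite /C mulr_ge0// mulr_ge0// sqr_ge0.
have -> : 4 * alpha ^+ 2 * (1 + alpha) * y ^+ 2 = C * (2 * (1 + alpha)) by rewrite /C; ring.
apply: (@le_trans _ _ (C * 3)); first lra.
have : 3 <= 2 * (1 + alpha) * (P + Q) by nra.
by move=> H3; rewrite -[leRHS]mulrA; exact: ler_wpM2l.
Qed.

(** Linear coefficient plus the constant of the quadratic error: |i - j| <= i + j turns the square
    into a first power. *)
Definition bias_const : R := alpha + 4 * alpha ^+ 2 * (1 + alpha).

Lemma bias_const_gt0 : 0 < bias_const.
Proof.
have a0 := alpha_gt0; have : 0 < alpha ^+ 2 by rewrite exprn_gt0.
by rewrite /bias_const; nra.
Qed.

Lemma norm_bias_le i j : (0 < i + j)%N ->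
  `|bias i j| <= bias_const * (`|i%:R - j%:R| / (i + j)%:R).
Proof.
move=> ij; have := bias_linear ij; have a0 := alpha_gt0.
set k : R := (i + j)%:R; have k0 : 0 < k by rewrite ltr0n.
set y : R := i%:R - j%:R.
have y1 : `|y| / k <= 1.
  rewrite ler_pdivrMr// mul1r /k natrD ler_norml.
  by have : 0 <= i%:R :> R by []; have : 0 <= j%:R :> R by []; rewrite /y; lra.
rewrite /bias_const; set C := 4 * _ * _ => H.
have C0 : 0 <= C.
  by rewrite /C; have := sqr_ge0 alpha; nra.
rewrite -[bias i j](subrK (alpha * y / k)) (le_trans (ler_normD _ _))//.
rewrite [in leRHS]mulrDl [leRHS]addrC lerD//.
  apply: (le_trans H); rewrite -(real_normK (num_real (y / k))).
  rewrite normrM normfV (gtr0_norm k0) expr2 ler_wpM2l// -[leRHS]mul1r ler_wpM2r//.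
  by rewrite divr_ge0// ltW.
by rewrite -mulrA !normrM normfV (gtr0_norm k0) (gtr0_norm a0).
Qed.

End StepProbability.

(** * The backward chain and the moments of its difference *)

Section BackwardChain.
Variables (R : realType) (alpha : R).
Hypothesis alpha_gt1 : 1 < alpha.
Variable n : nat.

(* A path of the backward chain started from (n, n) is stored in the order of
   the forward chain: a new backward step is put in front, and the state
   reached by the path s is (bX s, bY s). *)
Definition bX (s : seq bool) : nat := (n - count id s)%N.
Definition bY (s : seq bool) : nat := (n - count negb s)%N.
Definition bD (s : seq bool) : R := (bX s)%:R - (bY s)%:R.

(** Expectation over L backward steps, integrating out the latest step first. [F] sees the whole
    path, so path functionals and functions of the final state are treated alike, by induction on
    L. *)
Fixpoint bE (L : nat) (F : seq bool -> R) : R :=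
  if L is L'.+1 then
    bE L' (fun s => step_prob alpha (bX s) (bY s) true * F (true :: s) +
                    step_prob alpha (bX s) (bY s) false * F (false :: s))
  else F [::].

(** Subtraction in [bX] and [bY] is truncated, but a step out of an empty urn has weight 0 since
    0^alpha = 0. Estimates under [bE] are thus needed only on paths that never take such a step. *)
Definition bvalid (s : seq bool) : bool :=
  (count id s <= n)%N && (count negb s <= n)%N.

Lemma count_id_negb (s : seq bool) : (count id s + count negb s)%N = size s.
Proof. exact: (count_predC id s). Qed.

Lemma bvalid_level s : bvalid s -> (bX s + bY s = n.*2 - size s)%N.
Proof. by clear alpha_gt1; move=> /andP[h1 h2]; rewrite /bX /bY -(count_id_negb s); lia. Qed.

Lemma bE_le L F F' :
  (forall s, size s = L -> bvalid s -> F s <= F' s) -> bE L F <= bE L F'.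
Proof.
elim: L F F' => [|L IH] F F' H /=; first by apply: H.
apply: IH => s sL /andP[v1 v2]; apply: lerD.
- have [lt|ge] := ltnP (count id s) n.
    by rewrite ler_wpM2l ?step_prob_ge0// H//= ?sL// /bvalid/= add0n v2 andbT.
  have -> : bX s = 0%N by rewrite /bX; lia.
  by rewrite step_prob_true0// !mul0r.
- have [lt|ge] := ltnP (count negb s) n.
    by rewrite ler_wpM2l ?step_prob_ge0// H//= ?sL// /bvalid/= add0n v1.
  have -> : bY s = 0%N by rewrite /bY; lia.
  by rewrite step_prob_false0// !mul0r.
Qed.

Lemma bE_eq L F F' :
  (forall s, size s = L -> bvalid s -> F s = F' s) -> bE L F = bE L F'.
Proof. by move=> H; apply/eqP; rewrite eq_le !bE_le// => s sL vs; rewrite H. Qed.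

Lemma bED L F F' : bE L (fun s => F s + F' s) = bE L F + bE L F'.
Proof.
elim: L F F' => [//|L IH] F F' /=; rewrite -IH; apply: bE_eq => s _ _; ring.
Qed.

Lemma bEZ L c F : bE L (fun s => c * F s) = c * bE L F.
Proof. elim: L F => [//|L IH] F /=; rewrite -IH; apply: bE_eq => s _ _; ring. Qed.

Lemma bEN L F : bE L (fun s => - F s) = - bE L F.
Proof. by rewrite -mulN1r -bEZ; apply: bE_eq => s _ _; rewrite mulN1r. Qed.

Lemma bEB L F F' : bE L (fun s => F s - F' s) = bE L F - bE L F'.
Proof. by rewrite bED bEN. Qed.

Lemma bE_sum L (I : Type) (r : seq I) (P : pred I) (F : I -> seq bool -> R) :
  bE L (fun s => \sum_(i <- r | P i) F i s) = \sum_(i <- r | P i) bE L (F i).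
Proof.
elim: r => [|i r IH].
  rewrite big_nil -[RHS](mul0r (bE L (fun=> 1))) -bEZ; apply: bE_eq => s _ _.
  by rewrite big_nil mul0r.
rewrite big_cons -IH; case: ifP => Pi.
  by rewrite -bED; apply: bE_eq => s _ _; rewrite big_cons Pi.
by apply: bE_eq => s _ _; rewrite big_cons Pi.
Qed.

(** After n.*2 steps both urns are empty and both step weights are 0 by division by zero, so total
    mass 1 is kept only up to there. *)
Lemma bE_cst L c : (L <= n.*2)%N -> bE L (fun=> c) = c.
Proof.
elim: L => [//|L IH] Ln /=; rewrite -[RHS]IH 1?ltnW//; apply: bE_eq => s sL vs.
rewrite -mulrDl step_prob_sum// ?mul1r// bvalid_level// sL; lia.
Qed.

Lemma bE_ge0 L F : (forall s, size s = L -> bvalid s -> 0 <= F s) -> 0 <= bE L F.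
Proof.
move=> H; rewrite -(mul0r (bE L (fun=> 1))) -bEZ; apply: bE_le => s sL vs.
by rewrite mul0r H.
Qed.

Lemma ler_norm_bE L F : `|bE L F| <= bE L (fun s => `|F s|).
Proof.
rewrite ler_norml -bEN; apply/andP; split; apply: bE_le => s _ _.
- by rewrite lerNnormlW.
- by rewrite ler_norm.
Qed.

Definition bbias (s : seq bool) : R := bias alpha (bX s) (bY s).

(** The form in which a step enters every recursion below: [F] receives the earlier path, the latest
    step and the new difference. At an empty urn the new difference would be wrong, but its
    coefficient vanishes. *)
Lemma bE_step L (F : seq bool -> bool -> R -> R) : (L < n.*2)%N ->
  bE L.+1 (fun s => F (behead s) (head false s) (bD s)) =
  bE L (fun s => (1 + bbias s) / 2 * F s true (bD s - 1) +
                 (1 - bbias s) / 2 * F s false (bD s + 1)).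
Proof.
move=> Ln /=; apply: bE_eq => s sL vs.
have k0 : (0 < bX s + bY s)%N by rewrite bvalid_level// sL; lia.
have pE b := step_prob_bias alpha b k0; rewrite -(pE true) -(pE false) {pE}; move/andP: vs => [v1 v2]; congr (_ + _).
- have [lt|ge] := ltnP (count id s) n.
    congr (_ * F s true _); rewrite /bD /bX /bY /= add0n.
    by rewrite !natrB//; lra.
  have -> : bX s = 0%N by rewrite /bX; lia.
  by rewrite step_prob_true0// !mul0r.
- have [lt|ge] := ltnP (count negb s) n.
    congr (_ * F s false _); rewrite /bD /bX /bY /= add0n.
    by rewrite !natrB//; lra.
  have -> : bY s = 0%N by rewrite /bY; lia.
  by rewrite step_prob_false0// !mul0r.
Qed.

Lemma bE_behead L F : (L < n.*2)%N -> bE L.+1 (fun s => F (behead s)) = bE L F.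
Proof.
move=> Ln; rewrite (@bE_step L (fun s _ _ => F s))//; apply: bE_eq => s _ _.
by field.
Qed.

Lemma bE_drop L q F : (L + q <= n.*2)%N -> bE (L + q) (fun s => F (drop q s)) = bE L F.
Proof.
elim: q F => [|q IH] F Lq.
  by rewrite addn0; apply: bE_eq => s _ _; rewrite drop0.
rewrite addnS -IH; last lia.
rewrite -[RHS]bE_behead; last lia.
by apply: bE_eq => -[|b s].
Qed.

Lemma norm_bD_le s : bvalid s -> `|bD s| <= (n.*2 - size s)%:R.
Proof.
move=> /bvalid_level <-; rewrite /bD natrD ler_norml.
by have : 0 <= (bX s)%:R :> R by []; have : 0 <= (bY s)%:R :> R by []; lra.
Qed.

(** A step from level k maps the second moment m to at most (1 - 2/k) m + 1, and m = k gives exactly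
    k - 1. The factor is nonnegative only for k >= 2; below that the difference vanishes after the
    step. *)
Lemma bE_bD_sqr L : (L <= n.*2)%N -> bE L (fun s => bD s ^+ 2) <= (n.*2 - L)%:R.
Proof.
elim: L => [_|L IH Ln].
  by rewrite /= /bD /bX /bY subrr expr0n.
have [k2|k2] := leqP (n.*2 - L) 1.
  apply: (@le_trans _ _ (bE L.+1 (fun=> 0))); last by rewrite bE_cst.
  apply: bE_le => s sL /norm_bD_le.
  have -> : (n.*2 - size s = 0)%N by lia.
  by rewrite normr_le0 => /eqP ->; rewrite expr0n.
rewrite (@bE_step L (fun _ _ x => x ^+ 2))//.
set k : R := (n.*2 - L)%:R.
have k1 : 2 <= k by rewrite /k ler_nat.
have -> : (n.*2 - L.+1)%:R = k - 1 by rewrite /k subnS -subn1 natrB//; lia.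
have {IH} IH := IH (ltnW Ln).
apply: (@le_trans _ _ (bE L (fun s => (1 - 2 / k) * bD s ^+ 2 + 1))).
  apply: bE_le => s sL vs.
  have kE : (bX s + bY s)%:R = k by rewrite bvalid_level// sL.
  have k0 : (0 < bX s + bY s)%N by rewrite bvalid_level// sL; lia.
  have H := bias_mul_ge alpha_gt1 k0; rewrite kE -/(bD s) -/(bbias s) in H.
  have -> : (1 - 2 / k) * bD s ^+ 2 = bD s ^+ 2 - 2 * (bD s ^+ 2 / k) by field; lra.
  lra.
rewrite bED bEZ bE_cst 1?ltnW//.
have h : 0 <= 1 - 2 / k by rewrite subr_ge0 ler_pdivrMr; lra.
have := ler_wpM2l h IH.
have -> : (1 - 2 / k) * k = k - 2 by field; lra.
lra.
Qed.

(** The same recursion, with 6 m + 1 added for the second moment m <= k: (1 - 4/k) 4 k^2 + 6 k + 1 =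
    4 k^2 - 10 k + 1 <= 4 (k - 1)^2. Levels k <= 3 use that the new difference is at most k - 1 <=
    2. *)
Lemma bE_bD_pow4 L : (L <= n.*2)%N ->
  bE L (fun s => bD s ^+ 4) <= 4 * (n.*2 - L)%:R ^+ 2.
Proof.
elim: L => [_|L IH Ln].
  by rewrite /= /bD /bX /bY subrr expr0n mulr_ge0// sqr_ge0.
have [k2|k2] := leqP (n.*2 - L) 3.
  rewrite -[leRHS](bE_cst _ Ln).
  apply: bE_le => s sL /norm_bD_le; rewrite sL; set k : R := (n.*2 - L.+1)%:R => h.
  have k0 : 0 <= k by [].
  have k2' : k <= 2 by rewrite /k ler_nat; lia.
  have h2 : bD s ^+ 2 <= k ^+ 2.
    by rewrite -(real_normK (num_real _)) lerXn2r ?nnegrE.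
  have k4 : k ^+ 2 <= 4 by nra.
  have -> : bD s ^+ 4 = bD s ^+ 2 * bD s ^+ 2 by rewrite -exprD.
  by rewrite ler_pM ?sqr_ge0// (le_trans h2).
rewrite (@bE_step L (fun _ _ x => x ^+ 4))//.
set k : R := (n.*2 - L)%:R.
have k1 : 4 <= k by rewrite /k ler_nat.
have -> : (n.*2 - L.+1)%:R = k - 1 by rewrite /k subnS -subn1 natrB//; lia.
have {IH} IH := IH (ltnW Ln).
apply: (@le_trans _ _ (bE L (fun s => (1 - 4 / k) * bD s ^+ 4 + 6 * bD s ^+ 2 + 1))).
  apply: bE_le => s sL vs.
  have kE : (bX s + bY s)%:R = k by rewrite bvalid_level// sL.
  have k0 : (0 < bX s + bY s)%N by rewrite bvalid_level// sL; lia.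
  have H := bias_mul_ge alpha_gt1 k0; rewrite kE -/(bD s) -/(bbias s) in H.
  have d0 := sqr_ge0 (bD s).
  have q0 : 0 <= bD s ^+ 2 / k by rewrite divr_ge0//; lra.
  have -> : (1 - 4 / k) * bD s ^+ 4 = bD s ^+ 4 - 4 * (bD s ^+ 2 / k) * bD s ^+ 2 by field; lra.
  have H2 : bD s ^+ 2 / k * bD s ^+ 2 <= bbias s * bD s * bD s ^+ 2 by rewrite ler_wpM2r.
  have -> : (1 + bbias s) / 2 * (bD s - 1) ^+ 4 + (1 - bbias s) / 2 * (bD s + 1) ^+ 4 =
     bD s ^+ 4 - 4 * (bbias s * bD s * bD s ^+ 2) + 6 * bD s ^+ 2 - 4 * (bbias s * bD s) + 1.
    by field.
  lra.
rewrite !bED !bEZ bE_cst 1?ltnW//.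
have h : 0 <= 1 - 4 / k by rewrite subr_ge0 ler_pdivrMr; lra.
have := ler_wpM2l h IH; have := bE_bD_sqr (ltnW Ln); rewrite -/k.
have -> : (1 - 4 / k) * (4 * k ^+ 2) = 4 * k ^+ 2 - 16 * k by field; lra.
nra.
Qed.

Lemma bbias_sqr_le s : bvalid s -> (size s < n.*2)%N ->
  bbias s ^+ 2 <= bias_const alpha ^+ 2 * (bD s ^+ 2 / (n.*2 - size s)%:R ^+ 2).
Proof.
move=> vs sn.
have k0 : (0 < bX s + bY s)%N by rewrite bvalid_level//; lia.
have := norm_bias_le alpha_gt1 k0; rewrite bvalid_level// -/(bbias s) -/(bD s).
set k : R := (n.*2 - size s)%:R => h.
have kp : 0 < k by rewrite ltr0n; lia.
have -> : bias_const alpha ^+ 2 * (bD s ^+ 2 / k ^+ 2) = (bias_const alpha * (`|bD s| / k)) ^+ 2.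
  by rewrite !exprMn exprVn real_normK ?num_real.
rewrite -(real_normK (num_real (bbias s))) lerXn2r ?nnegrE//.
by rewrite mulr_ge0 ?divr_ge0 ?(ltW kp)// ltW// bias_const_gt0.
Qed.

Lemma bE_bbias_sqr L : (L < n.*2)%N ->
  bE L (fun s => bbias s ^+ 2) <= bias_const alpha ^+ 2 / (n.*2 - L)%:R.
Proof.
move=> Ln; set k : R := (n.*2 - L)%:R; have k0 : 0 < k by rewrite ltr0n; lia.
apply: (@le_trans _ _ (bE L (fun s => bias_const alpha ^+ 2 / k ^+ 2 * bD s ^+ 2))).
  apply: bE_le => s sL vs; have := bbias_sqr_le vs; rewrite sL => /(_ Ln)/le_trans; apply.
  by rewrite -/k (mulrC (bD s ^+ 2)) mulrA.
rewrite bEZ; have := bE_bD_sqr (ltnW Ln); rewrite -/k => h.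
have c0 : 0 <= bias_const alpha ^+ 2 / k ^+ 2 by rewrite divr_ge0 ?sqr_ge0.
apply: (le_trans (ler_wpM2l c0 h)); rewrite le_eqVlt; apply/orP; left; apply/eqP.
by field; lra.
Qed.

Lemma bE_bbias_pow4 L : (L < n.*2)%N ->
  bE L (fun s => bbias s ^+ 4) <= 4 * bias_const alpha ^+ 4 / (n.*2 - L)%:R ^+ 2.
Proof.
move=> Ln; set k : R := (n.*2 - L)%:R; have k0 : 0 < k by rewrite ltr0n; lia.
apply: (@le_trans _ _ (bE L (fun s => bias_const alpha ^+ 4 / k ^+ 4 * bD s ^+ 4))).
  apply: bE_le => s sL vs; have := bbias_sqr_le vs; rewrite sL -/k => /(_ Ln) h.
  have -> : bias_const alpha ^+ 4 / k ^+ 4 * bD s ^+ 4 =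
     (bias_const alpha ^+ 2 * (bD s ^+ 2 / k ^+ 2)) ^+ 2 by field; lra.
  rewrite -[4%N]/(2 * 2)%N exprM lerXn2r ?nnegrE ?sqr_ge0//.
  exact: le_trans (sqr_ge0 _) h.
rewrite bEZ; have := bE_bD_pow4 (ltnW Ln); rewrite -/k => h.
have c0 : 0 <= bias_const alpha ^+ 4 / k ^+ 4.
  by rewrite divr_ge0// exprn_ge0 ?ltW// bias_const_gt0.
apply: (le_trans (ler_wpM2l c0 h)); rewrite le_eqVlt; apply/orP; left; apply/eqP.
by field; lra.
Qed.

Lemma bE_bias_linear L : (L < n.*2)%N ->
  bE L (fun s => `|bbias s - alpha * bD s / (n.*2 - L)%:R|) <=
  4 * alpha ^+ 2 * (1 + alpha) / (n.*2 - L)%:R.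
Proof.
move=> Ln; set k : R := (n.*2 - L)%:R; have k0 : 0 < k by rewrite ltr0n; lia.
set C := 4 * _ * _; have C0 : 0 <= C.
  by rewrite /C !mulr_ge0 ?sqr_ge0//; move: alpha_gt1; lra.
apply: (@le_trans _ _ (bE L (fun s => C / k ^+ 2 * bD s ^+ 2))).
  apply: bE_le => s sL vs.
  have kp : (0 < bX s + bY s)%N by rewrite bvalid_level//; lia.
  have := bias_linear alpha_gt1 kp; rewrite bvalid_level// sL -/k.
  rewrite expr_div_n (mulrC (_ ^+ 2) (_ ^-1)) mulrA; exact.
rewrite bEZ; have := bE_bD_sqr (ltnW Ln); rewrite -/k => h.
have c0 : 0 <= C / k ^+ 2 by rewrite divr_ge0 ?sqr_ge0.
apply: (le_trans (ler_wpM2l c0 h)); rewrite le_eqVlt; apply/orP; left; apply/eqP.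
by field; lra.
Qed.

End BackwardChain.

(** * The probability of reaching (1, 1) *)

Section HittingProbability.
Variables (R : realType) (alpha : R).
Hypothesis alpha_gt1 : 1 < alpha.
Local Notation rate := (rate alpha).

Definition step_op (psi : nat -> nat -> R) (i j : nat) : R :=
  step_prob alpha i j true * psi i.-1 j + step_prob alpha i j false * psi i j.-1.

Definition at11 (i j : nat) : R := ((i == 1%N) && (j == 1%N))%:R.

(* Probability that the backward chain started from (i, j) visits (1, 1). *)
Definition hit (i j : nat) : R := iter (i + j - 2) step_op at11 i j.

Lemma iter_step_op0l L j : iter L step_op at11 0 j = 0.
Proof.
elim: L j => [|L IH] j //=.
by rewrite /step_op step_prob_true0// mul0r add0r IH mulr0.
Qed.

Lemma iter_step_op0r L i : iter L step_op at11 i 0 = 0.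
Proof.
elim: L i => [|L IH] i /=; first by rewrite /at11 andbF.
by rewrite /step_op step_prob_false0// mul0r addr0 IH mulr0.
Qed.

Lemma hit0l j : hit 0 j = 0. Proof. exact: iter_step_op0l. Qed.
Lemma hit0r i : hit i 0 = 0. Proof. exact: iter_step_op0r. Qed.
Lemma hit11 : hit 1 1 = 1. Proof. by []. Qed.

Lemma hitE i j : (0 < i + j)%N ->
  hit i.+1 j.+1 = step_prob alpha i.+1 j.+1 true * hit i j.+1 +
                  step_prob alpha i.+1 j.+1 false * hit i.+1 j.
Proof.
move=> ij; rewrite {1}/hit.
have -> : (i.+1 + j.+1 - 2 = (i + j - 1).+1)%N by lia.
rewrite /= /step_op /hit /=; congr (_ * _ + _ * _); congr (iter _ _ _ _ _); lia.
Qed.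

Lemma iter_step_op_01 L i j : 0 <= iter L step_op at11 i j <= 1.
Proof.
elim: L i j => [|L IH] i j.
  by rewrite /= /at11 ler0n lern1 leq_b1.
rewrite /= /step_op.
have /andP[a1 a2] := IH i.-1 j; have /andP[b1 b2] := IH i j.-1.
have p0 := step_prob_ge0 alpha i j true; have q0 := step_prob_ge0 alpha i j false.
rewrite addr_ge0 ?mulr_ge0//=.
have [ij|ij] := posnP (i + j)%N.
  have /eqP[-> ->] : (i, j) == (0%N, 0%N) by apply/eqP; congr pair; lia.
  by rewrite step_prob_true0// step_prob_false0// !mul0r addr0 ler01.
have pq := @step_prob_sum _ alpha i j ij.
by rewrite -pq lerD// -[leRHS]mulr1 ler_wpM2l.
Qed.

Lemma hit_ge0 i j : 0 <= hit i j.
Proof. by case/andP: (iter_step_op_01 (i + j - 2) i j). Qed.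

Lemma hit_le1 i j : hit i j <= 1.
Proof. by case/andP: (iter_step_op_01 (i + j - 2) i j). Qed.

(** [hitE] with the denominator cleared. One weighted difference thus controls the increments of
    [hit] in both coordinates. *)
Lemma hit_flux i j : (0 < i + j)%N ->
  rate i.+1 * (hit i.+1 j.+1 - hit i j.+1) =
  - (rate j.+1 * (hit i.+1 j.+1 - hit i.+1 j)).
Proof.
move=> ij; rewrite hitE// /step_prob -!/(rate _).
have a0 : 0 < rate i.+1 by exact: rate_gt0.
have b0 : 0 < rate j.+1 by exact: rate_gt0.
by field; lra.
Qed.

(* The weighted differences satisfy the same averaging recursion as the
   hitting probability itself, so they obey a maximum principle. *)
Lemma hit_flux_le1 i j : `|rate i.+1 * (hit i.+1 j.+1 - hit i j.+1)| <= 1.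
Proof.
have [m] := ubnP (i + j)%N; elim: m i j => [//|m IH] [|i] [|j] ijm.
- by rewrite hit11 hit0l subr0 rate1// mulr1 normr1.
- by rewrite hit0l subr0 rate1 mul1r ger0_norm ?hit_ge0 ?hit_le1.
- by rewrite hit_flux// hit0r subr0 rate1 mul1r normrN ger0_norm ?hit_ge0 ?hit_le1.
have h1 := IH i.+1 j ltac:(lia); have h2 := IH i j.+1 ltac:(lia).
rewrite hit_flux in h2; last lia.
set u := rate i.+2 * (hit i.+2 j.+1 - hit i.+1 j.+1) in h1.
set v := - _ in h2.
have a0 : 0 < rate i.+2 by exact: rate_gt0.
have b0 : 0 < rate j.+2 by exact: rate_gt0.
have -> : rate i.+2 * (hit i.+2 j.+2 - hit i.+1 j.+2) =
  (rate j.+2 * u + rate i.+2 * v) / (rate i.+2 + rate j.+2).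
  rewrite hitE// /u /v /step_prob -!/(rate _).
  by field; lra.
clearbody u v; rewrite normrM normfV (@gtr0_norm _ (rate i.+2 + rate j.+2)) ?addr_gt0//.
rewrite ler_pdivrMr ?addr_gt0// mul1r (le_trans (ler_normD _ _))//.
rewrite !normrM (gtr0_norm a0) (gtr0_norm b0) addrC lerD//.
- by rewrite -[leRHS]mulr1 ler_wpM2l// ltW.
- by rewrite -[leRHS]mulr1 ler_wpM2l// ltW.
Qed.

Lemma hit_incr_l i j : `|hit i.+1 j.+1 - hit i j.+1| <= (rate i.+1)^-1.
Proof.
have a0 : 0 < rate i.+1 by exact: rate_gt0.
have := hit_flux_le1 i j; rewrite normrM (gtr0_norm a0) mulrC.
by rewrite -ler_pdivlMr// mul1r.
Qed.

Lemma hit_incr_r i j : `|hit i.+1 j.+1 - hit i.+1 j| <= (rate j.+1)^-1.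
Proof.
have b0 : 0 < rate j.+1 by exact: rate_gt0.
have [ij|ij] := posnP (i + j)%N.
  have [-> ->] : i = 0%N /\ j = 0%N by lia.
  by rewrite hit11 hit0r subr0 rate1 invr1 normr1.
have := hit_flux_le1 i j; rewrite hit_flux// normrN normrM (gtr0_norm b0) mulrC.
by rewrite -ler_pdivlMr// mul1r.
Qed.

Let g := alpha - 1.
Let g0 : 0 < g. Proof. by rewrite subr_gt0. Qed.

(** Here alpha > 1 enters as summability of l^-alpha, with an explicit tail. *)
Lemma rateV_le (l : nat) : (0 < l)%N ->
  (rate l.+1)^-1 <= (l%:R `^ (- g) - l.+1%:R `^ (- g)) / g.
Proof.
move=> l0; have := @powRN_telescope_ub R g l.+1%:R g0.
rewrite ltr1n ltnS l0 => /(_ isT).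
have -> : l.+1%:R - 1 = l%:R :> R by rewrite -natr1 addrK.
have -> : - g - 1 = - alpha by rewrite /g; ring.
by rewrite powRN mulrC ler_pdivlMr.
Qed.

Let hit_diff_l m d j : (0 < m)%N ->
  `|hit (m + d) j.+1 - hit m j.+1| <= (m%:R `^ (- g) - (m + d)%:R `^ (- g)) / g.
Proof.
move=> m0; elim: d => [|d IH]; first by rewrite addn0 !subrr mul0r normr0.
rewrite addnS -(subrK (hit (m + d) j.+1) (hit (m + d).+1 j.+1)) -addrA.
rewrite (le_trans (ler_normD _ _))//.
apply: (le_trans (lerD (le_trans (hit_incr_l _ _) (@rateV_le (m + d) _)) IH)); first lia.
by rewrite -mulrDl; apply: ler_wpM2r; [rewrite invr_ge0 ltW|lra].
Qed.

Let hit_diff_r m d i : (0 < m)%N ->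
  `|hit i.+1 (m + d) - hit i.+1 m| <= (m%:R `^ (- g) - (m + d)%:R `^ (- g)) / g.
Proof.
move=> m0; elim: d => [|d IH]; first by rewrite addn0 !subrr mul0r normr0.
rewrite addnS -(subrK (hit i.+1 (m + d)) (hit i.+1 (m + d).+1)) -addrA.
rewrite (le_trans (ler_normD _ _))//.
apply: (le_trans (lerD (le_trans (hit_incr_r _ _) (@rateV_le (m + d) _)) IH)); first lia.
by rewrite -mulrDl; apply: ler_wpM2r; [rewrite invr_ge0 ltW|lra].
Qed.

Let hit_near m i j : (0 < m)%N -> (m <= i)%N -> (m <= j)%N ->
  `|hit i j - hit m m| <= 2 * (m%:R `^ (- g) / g).
Proof.
move=> m0 mi mj.
have h1 : `|hit i j - hit m j| <= m%:R `^ (- g) / g.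
  have := @hit_diff_l m (i - m) j.-1 m0; rewrite subnKC// prednK; last lia.
  move=> /le_trans; apply; rewrite ler_wpM2r ?invr_ge0 ?(ltW g0)//.
  by rewrite gerBl powR_ge0.
have h2 : `|hit m j - hit m m| <= m%:R `^ (- g) / g.
  have := @hit_diff_r m (j - m) m.-1 m0; rewrite subnKC// prednK//.
  move=> /le_trans; apply; rewrite ler_wpM2r ?invr_ge0 ?(ltW g0)//.
  by rewrite gerBl powR_ge0.
by rewrite -(subrK (hit m j) (hit i j)) -addrA (le_trans (ler_normD _ _))//; lra.
Qed.

(** Each of the two states is joined to (m, m) along two coordinate segments; each of the four
    segments costs at most the tail of the sum of l^-alpha beyond m. *)
Lemma hit_close m i j i' j' : (0 < m)%N ->
  (m <= i)%N -> (m <= j)%N -> (m <= i')%N -> (m <= j')%N ->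
  `|hit i j - hit i' j'| <= 4 / (alpha - 1) * m%:R `^ (1 - alpha).
Proof.
move=> m0 h1 h2 h3 h4; have := hit_near m0 h1 h2; have := hit_near m0 h3 h4.
rewrite distrC => a b.
rewrite -(subrK (hit m m) (hit i j)) -addrA (le_trans (ler_normD _ _))//.
have -> : 4 / (alpha - 1) * m%:R `^ (1 - alpha) = 4 * (m%:R `^ (- g) / g).
  by rewrite /g opprB; ring.
lra.
Qed.

(** The product of [hitlb] over the two coordinates is a subsolution of the recursion of [hit]: with
    a and b the rates, one step multiplies it in mean by 1 + 2/(a + b). If one coordinate is 1, the
    loss a/(a + 1) by killing is exactly offset by the factor 1 + 1/a. *)
Let hitlb (i : nat) : R := \prod_(l < i) (1 + (rate l.+2)^-1)^-1.

Let hitlb_gt0 i : 0 < hitlb i.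
Proof. by apply: prodr_gt0 => l _; rewrite invr_gt0 addr_gt0// invr_gt0 rate_gt0. Qed.

Let hitlbS i : hitlb i = hitlb i.+1 * (1 + (rate i.+2)^-1).
Proof.
rewrite /hitlb big_ord_recr/= mulfVK// gt_eqF// addr_gt0// invr_gt0.
by rewrite rate_gt0.
Qed.

Let hit_hitlb i j : hitlb i * hitlb j <= hit i.+1 j.+1.
Proof.
have [m] := ubnP (i + j)%N; elim: m i j => [//|m IH] i j ijm.
have [ij|ij] := posnP (i + j)%N.
  have [-> ->] : i = 0%N /\ j = 0%N by lia.
  by rewrite hit11 /hitlb !big_ord0 mulr1.
rewrite hitE//.
have a0 : 0 < rate i.+1 by exact: rate_gt0.
have b0 : 0 < rate j.+1 by exact: rate_gt0.
have ij1 : (0 < i.+1 + j.+1)%N by [].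
have gt := hitlb_gt0.
case: i j ij ijm a0 b0 ij1 => [|i] [|j]// _ ijm a0 b0 ij1.
- rewrite hit0l mulr0 add0r; have := IH 0%N j ltac:(lia).
  rewrite [hitlb j]hitlbS mulrA => h.
  rewrite /step_prob -!/(rate _) rate1 -mulrA.
  apply: (@le_trans _ _ (rate j.+2 / (1 + rate j.+2) * (hitlb 0 * hitlb j.+1 * (1 + (rate j.+2)^-1)))).
    by rewrite le_eqVlt; apply/orP; left; apply/eqP; field; lra.
  by rewrite -mulrA ler_wpM2l ?(ltW b0)// ler_wpM2l// invr_ge0; lra.
- rewrite hit0r mulr0 addr0; have := IH i 0%N ltac:(lia).
  rewrite [hitlb i]hitlbS => h.
  rewrite /step_prob -!/(rate _) rate1.
  apply: (@le_trans _ _ (rate i.+2 / (rate i.+2 + 1) * (hitlb i.+1 * (1 + (rate i.+2)^-1) * hitlb 0))).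
    by rewrite le_eqVlt; apply/orP; left; apply/eqP; field; lra.
  by rewrite ler_wpM2l// divr_ge0; lra.
have h1 := IH i j.+1 ltac:(lia); have h2 := IH i.+1 j ltac:(lia).
have p0 := step_prob_ge0 alpha i.+2 j.+2 true.
have q0 := step_prob_ge0 alpha i.+2 j.+2 false.
apply: le_trans (lerD (ler_wpM2l p0 h1) (ler_wpM2l q0 h2)).
rewrite (hitlbS i) (hitlbS j) /step_prob -!/(rate _).
set a := rate i.+2 in a0 *; set b := rate j.+2 in b0 *.
have X0 : 0 < hitlb i.+1 * hitlb j.+1 by rewrite mulr_gt0.
set X := hitlb i.+1 in X0 *; set Y := hitlb j.+1 in X0 *.
have -> : a / (a + b) * (X * (1 + a^-1) * Y) + b / (a + b) * (X * (Y * (1 + b^-1))) =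
  X * Y * (1 + 2 / (a + b)) by field; lra.
by rewrite ler_peMr ?(ltW X0)// lerDl divr_ge0//; lra.
Qed.

(** From 1/(1 + u) >= exp(-u) and the sum of l^-alpha over l >= 2 being at most 1/(alpha - 1), once
    for each coordinate. *)
Definition hit_lower : R := expR (- (2 / (alpha - 1))).

Lemma hit_lower_gt0 : 0 < hit_lower. Proof. exact: expR_gt0. Qed.

Lemma hit_ge_lower i j : (0 < i)%N -> (0 < j)%N -> hit_lower <= hit i j.
Proof.
move=> i0 j0; rewrite -(prednK i0) -(prednK j0).
apply: le_trans (hit_hitlb _ _).
have H k : expR (- ((1 - k.+1%:R `^ (- g)) / g)) <= hitlb k.
  elim: k => [|k IH]; first by rewrite powR1 subrr mul0r oppr0 expR0 /hitlb big_ord0.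
  rewrite /hitlb big_ord_recr/= -/(hitlb k).
  have h := @rateV_le k.+1 isT.
  have h2 : expR (- (rate k.+2)^-1) <= (1 + (rate k.+2)^-1)^-1.
    rewrite expRN lef_pV2 ?posrE ?expR_gt0 ?expR_ge1Dx//.
    by rewrite addr_gt0// invr_gt0 rate_gt0.
  apply: le_trans (ler_pM (expR_ge0 _) (expR_ge0 _) IH h2).
  by rewrite -expRD ler_expR -opprD lerN2 (le_trans (lerD (lexx _) h))// -mulrDl addrA subrK.
have H' k : expR (- g^-1) <= hitlb k.
  apply: le_trans (H k); rewrite ler_expR lerN2 ler_pdivrMr// mulVf ?gt_eqF//.
have -> : hit_lower = expR (- g^-1) * expR (- g^-1).
  by rewrite -expRD /hit_lower /g; congr expR; lra.
by rewrite ler_pM ?expR_ge0.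
Qed.

(** The Markov property. With [psi] equal to [at11] it turns conditioning on the end point into the
    weight [hit] at an intermediate time. *)
Lemma bE_hit n L q (F : seq bool -> R) (psi : nat -> nat -> R) :
  (L + q <= n.*2)%N ->
  bE alpha n (L + q) (fun s => F (drop q s) * psi (bX n s) (bY n s)) =
  bE alpha n L (fun s => F s * iter q step_op psi (bX n s) (bY n s)).
Proof.
elim: q psi => [|q IH] psi Lq.
  by rewrite addn0; apply: bE_eq => // s _ _; rewrite drop0.
rewrite addnS /= -iterS iterSr -IH; last lia.
by apply: bE_eq => // s _ _; rewrite /step_op /bX /bY/= !add0n !add1n !subnS; ring.
Qed.

End HittingProbability.

(** * Reversal of the conditioned urn and its conditional expectations *)

Section Bridge.
Variables (R : realType) (alpha : R).
Hypothesis alpha_gt1 : 1 < alpha.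

Fixpoint fweight (i j : nat) (s : seq bool) : R :=
  if s is b :: s' then
    step_prob alpha i j b * (if b then fweight i.+1 j s' else fweight i j.+1 s')
  else 1.

Lemma path_weightE s : path_weight alpha s = fweight 1 1 s.
Proof.
rewrite /path_weight.
transitivity (\prod_(k < size s) step_prob alpha (1 + count id (take k s))
   (1 + count negb (take k s)) (nth false s k)).
  by apply: eq_bigr => k _; rewrite /Xpos /Ypos addnK.
suff H i j : \prod_(k < size s) step_prob alpha (i + count id (take k s))
   (j + count negb (take k s)) (nth false s k) = fweight i j s by exact: H.
elim: s i j => [|b s IH] i j; first by rewrite big_ord0.
rewrite big_ord_recl/= !addn0; congr (_ * _).
case: b; rewrite -IH; apply: eq_bigr => k _ /=; rewrite ?add0n ?add1n ?addnS ?addSn//.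
Qed.

Fixpoint bweight (n : nat) (s : seq bool) : R :=
  if s is b :: s' then bweight n s' * step_prob alpha (bX n s') (bY n s') b else 1.

Lemma bE_bweight n L F :
  bE alpha n L F = \sum_(s : L.-tuple bool) bweight n s * F s.
Proof.
elim: L F => [|L IH] F /=.
  rewrite (bigD1 [tuple])//= big1 ?addr0 ?mul1r// => s.
  by have -> : s = [tuple] by apply: val_inj; apply: size0nil; rewrite size_tuple.
rewrite IH.
rewrite (reindex (fun p : bool * L.-tuple bool => cons_tuple p.1 p.2)); last first.
  exists (fun t : L.+1.-tuple bool => (thead t, behead_tuple t)) => [[b t] _|t _] /=.
    by congr pair; apply: val_inj.
  by rewrite [RHS]tuple_eta; apply: val_inj.
rewrite -(pair_bigA _ (fun b (t : L.-tuple bool) => bweight n (cons_tuple b t) * F (cons_tuple b t)))/=.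
rewrite big_bool/= -big_split/=; apply: eq_bigr => s _; ring.
Qed.

(** The reversing weight: the forward step from (i, j) to (i + 1, j) weighted by c(i, j) and the
    backward step weighted by c(i + 1, j) both equal j^-alpha, and symmetrically. *)
Let c (i j : nat) : R := (rate alpha i)^-1 + (rate alpha j)^-1.

Lemma fweight_bweight n i j s : (0 < i)%N -> (0 < j)%N ->
  (i + count id s)%N = n -> (j + count negb s)%N = n ->
  fweight i j s * c i j = bweight n s * c n n.
Proof.
elim: s i j => [|b s IH] i j i0 j0 /=.
  by rewrite !addn0 => -> ->.
move=> hi hj.
have ai : 0 < rate alpha i by exact: rate_gt0.
have aj : 0 < rate alpha j by exact: rate_gt0.
have ai' : 0 < rate alpha i.+1 by exact: rate_gt0.
have aj' : 0 < rate alpha j.+1 by exact: rate_gt0.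
case: b hi hj; rewrite /= ?add0n => hi hj.
- have h : fweight i.+1 j s * c i.+1 j = bweight n s * c n n by apply: IH => //; lia.
  have -> : bX n s = i.+1 by rewrite /bX; lia.
  have -> : bY n s = j by rewrite /bY; lia.
  rewrite [RHS]mulrAC -h /c /step_prob -!/(rate alpha _).
  by field; lra.
- have h : fweight i j.+1 s * c i j.+1 = bweight n s * c n n by apply: IH => //; lia.
  have -> : bX n s = i by rewrite /bX; lia.
  have -> : bY n s = j.+1 by rewrite /bY; lia.
  rewrite [RHS]mulrAC -h /c /step_prob -!/(rate alpha _).
  by field; lra.
Qed.

Definition end11 (n : nat) (s : seq bool) : R := at11 R (bX n s) (bY n s).

Lemma bingo_end11 n (s : seq bool) : (0 < n)%N -> size s = (n.*2 - 2)%N ->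
  (bingo s n n)%:R = end11 n s.
Proof.
move=> n0 sn; rewrite /end11 /at11 /bingo /Xpos /Ypos addnn -sn take_size.
by congr (_%:R); congr nat_of_bool; rewrite /bX /bY; congr andb; apply/eqP/eqP; lia.
Qed.

Lemma bE_dropB n L M (F : seq bool -> R) : (L <= M)%N -> (M <= n.*2)%N ->
  bE alpha n M (fun s => F (drop (M - L) s)) = bE alpha n L F.
Proof.
move=> LM Mn; rewrite -[RHS](@bE_drop _ _ alpha_gt1 n L (M - L)) ?subnKC//.
Qed.

Lemma bE_end11 n : bE alpha n (n.*2 - 2) (end11 n) = hit alpha n n.
Proof.
have /= := @bE_hit R alpha alpha_gt1 n 0 (n.*2 - 2) (fun=> 1) (at11 R).
rewrite add0n mul1r /bX /bY /= subn0 /hit addnn => <-; last lia.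
by apply: (bE_eq alpha_gt1) => s _ _; rewrite mul1r.
Qed.

Definition cE (n : nat) (F : seq bool -> R) : R :=
  bE alpha n (n.*2 - 2) (fun s => F s * end11 n s) / hit alpha n n.

(** Every BINGO path has forward weight equal to its backward weight times the constant c(n, n)/c(1,
    1), which cancels in the quotient. *)
Lemma cond_expect_bingoE n f : (0 < n)%N ->
  cond_expect_bingo alpha n f = cE n (fun s => f (scaled_path n s)).
Proof.
move=> n0.
have cn : 0 < c n n by rewrite /c addr_gt0// invr_gt0 rate_gt0.
have key (F : seq bool -> R) :
    \sum_(s : (n.*2 - 2).-tuple bool | bingo s n n) path_weight alpha s * F s =
    (c n n / c 1 1) * bE alpha n (n.*2 - 2) (fun s => F s * end11 n s).
  rewrite bE_bweight big_distrr/= [LHS]big_mkcond; apply: eq_bigr => s _.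
  rewrite -bingo_end11 ?size_tuple//; case: ifPn => [sb|_]; last by rewrite !mulr0.
  rewrite mulr1 path_weightE.
  move: sb; rewrite /bingo /Xpos /Ypos addnn take_oversize ?size_tuple// => /andP[/eqP h1 /eqP h2].
  have := @fweight_bweight n 1 1 s isT isT.
  move=> /(_ h1 h2) h.
  have c1 : 0 < c 1 1 by rewrite /c addr_gt0// invr_gt0 rate_gt0.
  rewrite mulrA; congr (_ * _); apply: (mulIf (x := c 1 1)); first by rewrite gt_eqF.
  by rewrite h mulrAC mulrC mulfVK ?gt_eqF// mulrC.
have c1 : 0 < c 1 1 by rewrite /c addr_gt0// invr_gt0 rate_gt0.
rewrite /cond_expect_bingo (key (fun s => f (scaled_path n s))) /cE -bE_end11.
have := key (fun=> 1); under eq_bigr do rewrite mulr1; move=> ->.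
rewrite invfM mulrACA divff ?gt_eqF ?divr_gt0// mul1r; congr (_ / _).
by apply: (bE_eq alpha_gt1) => s _ _; rewrite mul1r.
Qed.

(** Counting up from (1, 1) and down from (n, n) agree because the path joins the two. [maxn 2 k]
    covers the convention that [Delta] is 0 before time 2, which is also its value at time 2. *)
Lemma Delta_bD n (s : seq bool) k : (0 < n)%N -> size s = (n.*2 - 2)%N ->
  end11 n s != 0 -> (k <= n.*2)%N ->
  Delta R s k = bD R n (drop (maxn 2 k - 2) s).
Proof.
move=> n0 sn; rewrite -bingo_end11//.
have [/andP[h1 h2] _|] := boolP (bingo s n n); last by rewrite eqxx.
move: h1 h2; rewrite /Xpos /Ypos addnn -sn take_size => /eqP h1 /eqP h2 kn.
rewrite /Delta; case: ltnP => k2.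
  rewrite subnn drop0 /bD /bX /bY.
  have -> : count id s = count negb s by lia.
  by rewrite subrr.
rewrite /bD /bX /bY /Xpos /Ypos.
have e1 : (count id (take (k - 2) s) + count id (drop (k - 2) s))%N = count id s.
  by rewrite -count_cat cat_take_drop.
have e2 : (count negb (take (k - 2) s) + count negb (drop (k - 2) s))%N = count negb s.
  by rewrite -count_cat cat_take_drop.
by congr (_%:R - _%:R); lia.
Qed.

Section ConditionalExpectation.
Variable n : nat.
Hypothesis n0 : (0 < n)%N.
Local Notation cE := (cE n).

Let hn0 : 0 < hit alpha n n.
Proof. exact: lt_le_trans (hit_lower_gt0 alpha) (hit_ge_lower alpha_gt1 n0 n0). Qed.

Lemma end11_01 s : 0 <= end11 n s <= 1.
Proof. by rewrite /end11 /at11 ler0n lern1 leq_b1. Qed.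

Lemma cE_le F F' : (forall s, size s = (n.*2 - 2)%N -> end11 n s != 0 -> F s <= F' s) ->
  cE F <= cE F'.
Proof.
move=> H; rewrite /cE ler_wpM2r ?invr_ge0 ?(ltW hn0)//; apply: bE_le => // s sL _.
have [->|e0] := eqVneq (end11 n s) 0; first by rewrite !mulr0.
by rewrite ler_wpM2r ?H//; case/andP: (end11_01 s).
Qed.

Lemma cE_eq F F' : (forall s, size s = (n.*2 - 2)%N -> end11 n s != 0 -> F s = F' s) ->
  cE F = cE F'.
Proof. by move=> H; apply/eqP; rewrite eq_le !cE_le// => s s1 s2; rewrite H. Qed.

Lemma cED F F' : cE (fun s => F s + F' s) = cE F + cE F'.
Proof.
rewrite /cE -mulrDl -bED//; congr (_ / _); apply: bE_eq => // s _ _; exact: mulrDl.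
Qed.

Lemma cEZ x F : cE (fun s => x * F s) = x * cE F.
Proof.
rewrite /cE mulrA -bEZ//; congr (_ / _); apply: bE_eq => // s _ _.
by rewrite mulrA.
Qed.

Lemma cE_cst x : cE (fun=> x) = x.
Proof. by rewrite /cE bEZ// bE_end11 mulfK// gt_eqF. Qed.

Lemma cEB F F' : cE (fun s => F s - F' s) = cE F - cE F'.
Proof.
rewrite cED; congr (_ + _); rewrite -mulN1r -cEZ.
by apply: cE_eq => s _ _; rewrite mulN1r.
Qed.

Lemma ler_norm_cE F : `|cE F| <= cE (fun s => `|F s|).
Proof.
rewrite ler_norml; apply/andP; split; last by apply: cE_le => s _ _; rewrite ler_norm.
rewrite -mulN1r -cEZ; apply: cE_le => s _ _; rewrite mulN1r lerNnormlW//.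
Qed.

(** The crude way to drop the conditioning: the event has probability at least [hit_lower]. It
    serves for bounds, [cE_drop_close] for limits. *)
Lemma cE_le_bE F : (forall s, size s = (n.*2 - 2)%N -> 0 <= F s) ->
  cE F <= bE alpha n (n.*2 - 2) F / hit_lower alpha.
Proof.
move=> F0; rewrite /cE.
have h0 : 0 <= bE alpha n (n.*2 - 2) F by apply: bE_ge0 => // s sL _; rewrite F0.
apply: ler_pM.
- by apply: bE_ge0 => // s sL _; rewrite mulr_ge0 ?F0//; case/andP: (end11_01 s).
- by rewrite invr_ge0 ltW.
- apply: bE_le => // s sL _; rewrite ler_piMr ?F0//; case/andP: (end11_01 s) => //.
- by rewrite lef_pV2 ?posrE ?hit_lower_gt0// hit_ge_lower.
Qed.

Lemma cE_drop_le (F : seq bool -> R) L : (L <= n.*2 - 2)%N ->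
  (forall s, size s = L -> 0 <= F s) ->
  cE (fun s => F (drop (n.*2 - 2 - L) s)) <= bE alpha n L F / hit_lower alpha.
Proof.
move=> Ln F0; have := @cE_le_bE (fun s => F (drop (n.*2 - 2 - L) s)).
have -> : bE alpha n L F =
    bE alpha n (n.*2 - 2) (fun s => F (drop (n.*2 - 2 - L) s)).
  by rewrite bE_dropB// leq_subr.
by apply => s sL; rewrite F0// size_drop sL; lia.
Qed.

(* Whether the chain reaches (1, 1) is asymptotically independent of its
   behaviour at macroscopic times. *)
Lemma cE_drop_close (F : seq bool -> R) L m : (L <= n.*2 - 2)%N ->
  (0 < m)%N -> (4 * m <= n.*2 - L)%N ->
  (forall s, size s = L -> `|F s| <= 1) ->
  `|cE (fun s => F (drop (n.*2 - 2 - L) s)) - bE alpha n L F| <=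
  (4 / (alpha - 1) * m%:R `^ (1 - alpha) + m%:R^-1) / hit_lower alpha.
Proof.
move=> Ln m0 mL F1.
set e := 4 / _ * _.
have e0 : 0 <= e.
  by rewrite /e mulr_ge0 ?powR_ge0// divr_ge0// subr_ge0 ltW.
have -> : cE (fun s => F (drop (n.*2 - 2 - L) s)) - bE alpha n L F =
   bE alpha n L (fun s => F s * (hit alpha (bX n s) (bY n s) - hit alpha n n)) / hit alpha n n.
  have := @bE_hit R alpha alpha_gt1 n L (n.*2 - 2 - L) F (at11 R).
  rewrite subnKC// => /(_ (leq_subr _ _)) h.
  rewrite /cE h.
  have -> : bE alpha n L F = bE alpha n L (fun s => hit alpha n n * F s) / hit alpha n n.
    by rewrite bEZ// mulrC mulKf// gt_eqF.
  rewrite -mulrBl -bEB//; congr (_ / _); apply: bE_eq => // s sL vs.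
  rewrite mulrBr (mulrC (hit alpha n n)); congr (_ * _ - _).
  by rewrite /hit bvalid_level// sL; congr (iter _ _ _ _ _); lia.
rewrite normrM normfV (gtr0_norm hn0).
apply: ler_pM => //; first by rewrite invr_ge0 ltW.
  rewrite (le_trans (ler_norm_bE _ _ _ _))//.
  set K : R := (n.*2 - L)%:R.
  have K0 : 0 < K by rewrite ltr0n; lia.
  (* If both contents are at least m, [hit_close] gives e. Otherwise one of them is below m <= K/4,
     so |D| >= K/2 and the second term exceeds 1; its mean is at most 4/K <= 1/m. *)
  apply: (@le_trans _ _ (bE alpha n L (fun s => e + 4 / K ^+ 2 * bD R n s ^+ 2))).
    apply: bE_le => // s sL vs.
    rewrite normrM -[leRHS]mul1r ler_pM ?F1//.
    have [mX|mX] := leqP m (bX n s); [have [mY|mY] := leqP m (bY n s)|].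
    - rewrite (le_trans (@hit_close _ _ alpha_gt1 m _ _ _ _ m0 _ _ _ _))//; try lia.
      by rewrite lerDl mulr_ge0 ?sqr_ge0// divr_ge0// sqr_ge0.
    - have := bvalid_level vs; rewrite sL => lev.
      have D2 : K / 2 <= `|bD R n s|.
        rewrite ler_normr; apply/orP; left; rewrite /bD /K -lev natrD.
        have : (3 * bY n s <= bX n s)%N by lia.
        by rewrite -(ler_nat R) natrM; lra.
      have h1 : 1 <= 4 / K ^+ 2 * bD R n s ^+ 2.
        rewrite -(real_normK (num_real (bD R n s))).
        rewrite mulrAC ler_pdivlMr ?exprn_gt0// mul1r.
        have -> : 4 * `|bD R n s| ^+ 2 = (2 * `|bD R n s|) ^+ 2 by ring.
        by rewrite lerXn2r ?nnegrE ?(ltW K0)//; lra.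
      have := hit_ge0 alpha_gt1 (bX n s) (bY n s); have := hit_le1 alpha_gt1 (bX n s) (bY n s).
      have := hit_ge0 alpha_gt1 n n; have := hit_le1 alpha_gt1 n n.
      by rewrite ler_norml; lra.
    - have := bvalid_level vs; rewrite sL => lev.
      have D2 : K / 2 <= `|bD R n s|.
        rewrite ler_normr; apply/orP; right; rewrite /bD /K -lev natrD.
        have : (3 * bX n s <= bY n s)%N by lia.
        by rewrite -(ler_nat R) natrM; lra.
      have h1 : 1 <= 4 / K ^+ 2 * bD R n s ^+ 2.
        rewrite -(real_normK (num_real (bD R n s))).
        rewrite mulrAC ler_pdivlMr ?exprn_gt0// mul1r.
        have -> : 4 * `|bD R n s| ^+ 2 = (2 * `|bD R n s|) ^+ 2 by ring.
        by rewrite lerXn2r ?nnegrE ?(ltW K0)//; lra.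
      have := hit_ge0 alpha_gt1 (bX n s) (bY n s); have := hit_le1 alpha_gt1 (bX n s) (bY n s).
      have := hit_ge0 alpha_gt1 n n; have := hit_le1 alpha_gt1 n n.
      by rewrite ler_norml; lra.
  rewrite bED// bE_cst//; last lia.
  rewrite lerD2l bEZ//.
  have L2 : (L <= n.*2)%N by lia.
  have := bE_bD_sqr alpha_gt1 L2; rewrite -/K => h.
  have c0 : 0 <= 4 / K ^+ 2 by rewrite divr_ge0// sqr_ge0.
  apply: (le_trans (ler_wpM2l c0 h)).
  have -> : 4 / K ^+ 2 * K = 4 / K by field; lra.
  rewrite ler_pdivrMr// mulrC ler_pdivlMr ?ltr0n//.
  by rewrite -natrM ler_nat.
by rewrite lef_pV2 ?posrE ?hit_lower_gt0// hit_ge_lower.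
Qed.

End ConditionalExpectation.

End Bridge.

(** * Characteristic functions of weighted sums along the backward chain *)

Section ChainCharacteristic.
Variables (R : realType) (alpha : R).
Hypothesis alpha_gt1 : 1 < alpha.

(** With x = c + lam D the mean after one step is cos lam cos x + be sin lam sin x. This is close to
    exp(-lam^2/2) cos(x - lam be), and then be is replaced by the linear drift (1 - rho) D. The
    three error terms come from these replacements. *)
Lemma cos_step_le (c lam D rho be : R) : `|be| <= 1 -> `|lam| <= 1 ->
  `|(1 + be) / 2 * cos (c + lam * (D - 1)) + (1 - be) / 2 * cos (c + lam * (D + 1)) -
    expR (- (lam ^+ 2 / 2)) * cos (c + lam * rho * D)| <=
  4 * `|lam| ^+ 3 + 2 * lam ^+ 2 * be ^+ 2 + `|lam| * `|be - (1 - rho) * D|.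
Proof.
move=> be1 lam1; set x := c + lam * D; set e := expR _.
have e0 : 0 <= e by exact: expR_ge0.
have l2 : 0 <= lam ^+ 2 / 2 by rewrite divr_ge0// sqr_ge0.
have e1 : e <= 1 by rewrite -expR0 ler_expR oppr_le0.
have h1 := norm_expR_cos_le lam; rewrite -/e distrC in h1.
have h2 := norm_sinBid_le lam.
have h3 := norm_cosB_le x (lam * be); rewrite distrC in h3.
have h4 := cos_lip (x - lam * be) (c + lam * rho * D).
have he : `|1 - e| <= lam ^+ 2 / 2.
  by rewrite ger0_norm ?subr_ge0//; have := expR_ge1Dx (- (lam ^+ 2 / 2)); rewrite -/e; lra.
have -> : (1 + be) / 2 * cos (c + lam * (D - 1)) + (1 - be) / 2 * cos (c + lam * (D + 1)) -
    e * cos (c + lam * rho * D) =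
  ((cos lam - e) * cos x + be * sin x * (sin lam - lam) + be * sin x * (lam * (1 - e)))
  + e * ((cos x + lam * be * sin x) - cos (x - lam * be))
  + e * (cos (x - lam * be) - cos (c + lam * rho * D)).
  have -> : c + lam * (D - 1) = x - lam by rewrite /x; ring.
  have -> : c + lam * (D + 1) = x + lam by rewrite /x; ring.
  by rewrite (cosB x lam) (cosD x lam); field.
have l3 : `|lam| ^+ 3 = `|lam| * lam ^+ 2 by rewrite exprS real_normK ?num_real.
have L4 : lam ^+ 4 <= `|lam| ^+ 3.
  have -> : lam ^+ 4 = `|lam| * `|lam| ^+ 3.
    by rewrite -exprS -[4%N]/(2 * 2)%N !exprM real_normK ?num_real.
  by rewrite -[leRHS]mul1r ler_wpM2r// exprn_ge0.
have L3 : 0 <= `|lam| ^+ 3 by rewrite exprn_ge0.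
have bs : `|be * sin x| <= 1 by rewrite normrM -[leRHS]mulr1 ler_pM// sin_max.
apply: (le_trans (ler_normD _ _)); apply: lerD; last first.
  rewrite normrM (ger0_norm e0) -[leRHS]mul1r ler_pM// (le_trans h4)// -normrM.
  by rewrite le_eqVlt; apply/orP; left; apply/eqP; rewrite -[LHS]normrN; congr (`|_|); rewrite /x; ring.
apply: (le_trans (ler_normD _ _)); apply: lerD; last first.
  rewrite normrM (ger0_norm e0) -[leRHS]mul1r ler_pM// (le_trans h3)//.
  by rewrite exprMn mulrA.
rewrite (le_trans (ler_normD _ _))//.
have a3 : `|be * sin x * (lam * (1 - e))| <= 2^-1 * `|lam| ^+ 3.
  rewrite normrM -[leRHS]mul1r ler_pM// normrM l3 mulrCA ler_wpM2l//; lra.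
have a2 : `|be * sin x * (sin lam - lam)| <= `|lam| ^+ 3.
  by rewrite normrM -[leRHS]mul1r ler_pM.
have a1 : `|(cos lam - e) * cos x| <= 2 * `|lam| ^+ 3.
  rewrite normrM -[leRHS]mulr1 ler_pM ?cos_max//; lra.
have := ler_normD ((cos lam - e) * cos x) (be * sin x * (sin lam - lam)).
lra.
Qed.

Variable n : nat.
Variables (th lam : nat -> R) (K : nat).
Local Notation bE := (bE alpha n).
Local Notation bD := (bD R n).

(** Paths are stored latest step first, so [drop (size s - q) s] consists of the first q steps,
    which lead to level n.*2 - q. *)
Definition wsum (s : seq bool) : R :=
  \sum_(q < (size s).+1) th (n.*2 - q) * bD (drop (size s - q) s).

Lemma wsum_cons b s : wsum (b :: s) = wsum s + th (n.*2 - (size s).+1) * bD (b :: s).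
Proof.
rewrite /wsum big_ord_recr/= subnn drop0; congr (_ + _).
by apply: eq_bigr => q _; rewrite subSn// -ltnS.
Qed.

Hypothesis K_ge : 2 * alpha <= K%:R.
Hypothesis Kn : (K <= n.*2)%N.
Hypothesis lamK : lam K = th K.
(** The contraction per step is taken as (l/(l+1))^alpha instead of 1 - alpha/(l+1): products over
    levels telescope, and the difference is of order l^-2. *)
Hypothesis lamS : forall l, (K <= l)%N -> (l < n.*2)%N ->
  lam l.+1 = th l.+1 + lam l * (l%:R / l.+1%:R) `^ alpha.
Variable Lam : R.
Hypothesis Lam0 : 0 <= Lam.
Hypothesis Lam1 : Lam <= 1.
Hypothesis lam_le : forall l, (K <= l)%N -> (l < n.*2)%N -> `|lam l| <= Lam.

(** The summands pay for the square of the bias, for its nonlinearity, and for replacing 1 -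
    alpha/(l+1) by (l/(l+1))^alpha. *)
Definition char_const : R :=
  2 * bias_const alpha ^+ 2 + (4 * alpha ^+ 2 * (1 + alpha) + 2 * alpha ^+ 2).

Lemma char_const_ge0 : 0 <= char_const.
Proof.
have a0 : 0 <= 1 + alpha by move: alpha_gt1; lra.
have h1 := sqr_ge0 (bias_const alpha); have h2 := sqr_ge0 alpha.
have h3 := mulr_ge0 h2 a0; rewrite /char_const; lra.
Qed.

Let V (l : nat) : R := \sum_(K <= l' < l) lam l' ^+ 2.

(** [wsum] already counts [th] at the current level, so the multiplier left for the current
    difference is [lam - th]. For L = 0 all of [V] is collected and the difference is 0; for L =
    n.*2 - K both [V] and [lam - th] vanish. *)
Let Phi (b : R) (L : nat) : R :=
  bE L (fun s => expR (- (V (n.*2 - L) / 2)) *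
    cos (b + wsum s + (lam (n.*2 - L) - th (n.*2 - L)) * bD s)).

Let Phi_step b L : (L < n.*2 - K)%N ->
  `|Phi b L.+1 - Phi b L| <= 4 * Lam ^+ 3 + Lam * (char_const / K%:R).
Proof.
move=> LK; have Ln : (L < n.*2)%N by lia.
have a0 : 0 < alpha by move: alpha_gt1; lra.
pose l := (n.*2 - L).-1; have lE : (n.*2 - L = l.+1)%N by rewrite /l; lia.
have Kl : (K <= l)%N by lia.
have ln : (l < n.*2)%N by lia.
have K0 : 0 < K%:R :> R by move: K_ge; lra.
pose rho := (l%:R / l.+1%:R) `^ alpha.
have ll := lam_le Kl ln.
have mE : lam l.+1 - th l.+1 = lam l * rho by rewrite lamS// addrC addKr.
rewrite /Phi lE subnS lE mE -pred_Sn.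
have -> : V l.+1 = V l + lam l ^+ 2 by rewrite /V big_nat_recr.
set v := V l; have v0 : 0 <= v by apply: sumr_ge0 => i _; exact: sqr_ge0.
have E : bE L.+1 (fun s => expR (- (v / 2)) * cos (b + wsum s + (lam l - th l) * bD s)) =
  bE L (fun s => (1 + bbias alpha n s) / 2 * (expR (- (v / 2)) * cos (b + wsum s + lam l * (bD s - 1))) +
    (1 - bbias alpha n s) / 2 * (expR (- (v / 2)) * cos (b + wsum s + lam l * (bD s + 1)))).
  rewrite -(@bE_step _ _ alpha_gt1 n L (fun s _ x => expR (- (v / 2)) * cos (b + wsum s + lam l * x)))//.
  apply: bE_eq => // -[|c s]// [sL] _ /=; congr (_ * cos _).
  rewrite wsum_cons sL; have -> : (n.*2 - L.+1 = l)%N by rewrite /l; lia.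
  ring.
rewrite E -bEB//.
apply: (le_trans (ler_norm_bE _ _ _ _)) => //.
set ll1 : R := l.+1%:R.
have ll1K : K%:R <= ll1 by rewrite ler_nat; lia.
have ll0 : 0 < ll1 by exact: lt_le_trans K0 ll1K.
have rho_le : `|rho - 1 + alpha / ll1| <= 2 * alpha ^+ 2 / ll1 ^+ 2.
  have := @powR_taylor2 R alpha (- ll1^-1) (ltW alpha_gt1).
  rewrite normrN normfV (gtr0_norm ll0).
  have -> : 1 - ll1^-1 = l%:R / l.+1%:R.
    have lR : l%:R = ll1 - 1 by rewrite /ll1 -natr1 addrK.
    by rewrite -/ll1 lR; field; lra.
  rewrite -/rho mulrN opprK sqrrN exprVn; apply.
  by rewrite lef_pV2 ?posrE ?mulr_gt0// (le_trans K_ge).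
apply: (@le_trans _ _ (bE L (fun s => 4 * Lam ^+ 3 + 2 * Lam * bbias alpha n s ^+ 2 +
   Lam * `|bbias alpha n s - alpha * bD s / ll1| + Lam * (2 * alpha ^+ 2 / ll1)))).
  apply: bE_le => // s sL vs.
  have Dl : `|bD s| <= ll1 by have := norm_bD_le R vs; rewrite sL lE.
  set be := bbias alpha n s.
  have -> : - ((v + lam l ^+ 2) / 2) = - (v / 2) + - (lam l ^+ 2 / 2) by ring.
  rewrite expRD.
  have := @cos_step_le (b + wsum s) (lam l) (bD s) rho be (norm_bias_le1 alpha_gt1 _ _) (le_trans ll Lam1).
  have w1 : expR (- (v / 2)) <= 1 by rewrite -expR0 ler_expR oppr_le0 divr_ge0.
  have w0 := expR_ge0 (- (v / 2)).
  set w := expR (- (v / 2)) in w0 w1 *.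
  set A := cos _; set B := cos _; set C := cos _; set e := expR _ => H.
  have -> : (1 + be) / 2 * (w * A) + (1 - be) / 2 * (w * B) - w * e * C =
    w * ((1 + be) / 2 * A + (1 - be) / 2 * B - e * C) by ring.
  rewrite normrM (ger0_norm w0).
  apply: (@le_trans _ _ (`|(1 + be) / 2 * A + (1 - be) / 2 * B - e * C|)).
    by rewrite -[leRHS]mul1r ler_wpM2r.
  apply: (le_trans H); rewrite -!addrA lerD//; last rewrite lerD//.
  - by rewrite ler_wpM2l// lerXn2r ?nnegrE.
  - rewrite ler_wpM2r ?sqr_ge0// ler_wpM2l// -(real_normK (num_real (lam l))) expr2.
    by rewrite -[leRHS]mulr1 ler_pM// (le_trans ll).
  rewrite -mulrDr ler_pM//.
  have -> : be - (1 - rho) * bD s = (be - alpha * bD s / ll1) + (rho - 1 + alpha / ll1) * bD s.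
    by field; lra.
  rewrite (le_trans (ler_normD _ _))// lerD2l normrM.
  have -> : 2 * alpha ^+ 2 / ll1 = 2 * alpha ^+ 2 / ll1 ^+ 2 * ll1 by field; lra.
  by rewrite ler_pM.
rewrite (bED alpha_gt1) (bED alpha_gt1) (bED alpha_gt1) (bEZ alpha_gt1 n L (2 * Lam)).
rewrite (bEZ alpha_gt1 n L Lam (fun s => `|bbias alpha n s - alpha * bD s / ll1|)).
rewrite !(bE_cst alpha_gt1) ?(ltnW Ln)//.
rewrite -!addrA lerD2l.
have h1 := bE_bbias_sqr alpha_gt1 Ln; have h2 := bE_bias_linear alpha_gt1 Ln.
rewrite lE -/ll1 in h1 h2.
have hK : ll1^-1 <= K%:R^-1 by rewrite lef_pV2.
set B2 := bE L _ in h1 *; set B1 := bE L _ in h2 *.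
have -> : 2 * Lam * B2 + (Lam * B1 + Lam * (2 * alpha ^+ 2 / ll1)) =
  Lam * (2 * B2 + (B1 + 2 * alpha ^+ 2 / ll1)) by ring.
rewrite ler_wpM2l//.
apply: (@le_trans _ _ (char_const / ll1)).
  have -> : char_const / ll1 = 2 * (bias_const alpha ^+ 2 / ll1) +
      (4 * alpha ^+ 2 * (1 + alpha) / ll1 + 2 * alpha ^+ 2 / ll1).
    by rewrite /char_const; ring.
  by apply: lerD; [rewrite ler_pM2l|apply: lerD].
by rewrite ler_wpM2l// char_const_ge0.
Qed.

Lemma bE_cos_wsum b :
  `|bE (n.*2 - K) (fun s => cos (b + wsum s)) -
    expR (- ((\sum_(K <= l < n.*2) lam l ^+ 2) / 2)) * cos b| <=
  n.*2%:R * (4 * Lam ^+ 3 + Lam * (char_const / K%:R)).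
Proof.
have E0 : Phi b 0 = expR (- ((\sum_(K <= l < n.*2) lam l ^+ 2) / 2)) * cos b.
  rewrite /Phi /= subn0 -/(V _) /wsum /= big_ord1 subn0 /bD /bX /bY /= subrr !mulr0.
  by rewrite !addr0.
have EK : Phi b (n.*2 - K) = bE (n.*2 - K) (fun s => cos (b + wsum s)).
  rewrite /Phi subKn// /V big_geq// mul0r oppr0 expR0 lamK subrr.
  by apply: bE_eq => // s _ _; rewrite mul1r mul0r addr0.
rewrite -EK -E0.
have H L : (L <= n.*2 - K)%N ->
   `|Phi b L - Phi b 0| <= L%:R * (4 * Lam ^+ 3 + Lam * (char_const / K%:R)).
  elim: L => [|L IH] LK; first by rewrite subrr normr0 mul0r.
  rewrite -(subrK (Phi b L) (Phi b L.+1)) -addrA (le_trans (ler_normD _ _))//.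
  rewrite -natr1 mulrDl mul1r [leRHS]addrC; apply: lerD; [exact: Phi_step|apply: IH; lia].
have [Ke|K_lt] := eqVneq K n.*2; last first.
  apply: (le_trans (H _ (leqnn _))); apply: ler_wpM2r; last by rewrite ler_nat leq_subr.
  exact: le_trans (@Phi_step b 0 ltac:(lia)).
rewrite Ke subnn subrr normr0 mulr_ge0// addr_ge0//; last first.
  by rewrite mulr_ge0// divr_ge0// char_const_ge0.
by rewrite mulr_ge0// exprn_ge0.
Qed.

End ChainCharacteristic.

(** * Limits of real sequences *)

Section SequenceLimits.
Variable R : realType.
Implicit Types (u v e : nat -> R).

Lemma cvgn_close u v e (l : R) :
  (\forall n \near \oo, `|u n - v n| <= e n) ->
  e @ \oo --> (0 : R) -> v @ \oo --> l -> u @ \oo --> l.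
Proof.
move=> uve e0 vl.
have d0 : (u n - v n) @[n --> \oo] --> (0 : R).
  apply/norm_cvg0P.
  apply: (@squeeze_cvgr _ _ _ _ (cst 0) e) => //; last exact: cvg_cst.
  by near=> n; rewrite normr_ge0/=; near: n.
have -> : u = (fun n => (u n - v n) + v n) by apply/funext => n; rewrite subrK.
by rewrite -[l]add0r; apply: cvgD.
Unshelve. all: by end_near. Qed.

Lemma cvgn_sum (I : Type) (r : seq I) (f : I -> nat -> R) (l : I -> R) :
  (forall i, f i @ \oo --> l i) ->
  (\sum_(i <- r) f i n) @[n --> \oo] --> \sum_(i <- r) l i.
Proof.
move=> fl; elim: r => [|i r IH].
  by under eq_fun do rewrite big_nil; rewrite big_nil; exact: cvg_cst.
by under eq_fun do rewrite big_cons; rewrite big_cons; apply: cvgD.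
Qed.

Lemma cvgn_inv_ge (c : R) u : 0 < c ->
  (\forall n \near \oo, c * n%:R <= u n) -> (u n)^-1 @[n --> \oo] --> (0 : R).
Proof.
move=> c0 H; apply/cvgrPdist_le => /= eps e0; near=> n.
have un : c * n%:R <= u n by near: n.
have ne : (c * eps)^-1 <= n%:R by near: n; exact: nbhs_infty_ger.
have n0 : 0 < n%:R :> R by apply: lt_le_trans ne; rewrite invr_gt0 mulr_gt0.
have u0 : 0 < u n by apply: lt_le_trans un; rewrite mulr_gt0.
rewrite sub0r normrN ger0_norm ?invr_ge0 ?(ltW u0)//.
rewrite -[leRHS]invrK lef_pV2 ?posrE ?invr_gt0//.
apply: le_trans un; rewrite -ler_pdivrMl// -invfM//.
Unshelve. all: by end_near. Qed.

Lemma cvgn_powR0 (p : R) u : 0 < p -> (forall n, 0 <= u n) ->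
  u @ \oo --> (0 : R) -> (u n `^ p) @[n --> \oo] --> (0 : R).
Proof.
move=> p0 u0 /cvgrPdist_le H; apply/cvgrPdist_le => /= eps e0.
have e0' : 0 < eps `^ p^-1 by exact: powR_gt0.
near=> n; have : `|0 - u n| <= eps `^ p^-1 by near: n; exact: H.
rewrite !sub0r !normrN !ger0_norm ?powR_ge0// => h.
rewrite -[leRHS](powRr1 (ltW e0)) -(mulVf (lt0r_neq0 p0)) powRrM.
by apply: ge0_ler_powR; rewrite ?nnegrE ?powR_ge0 ?(ltW p0).
Unshelve. all: by end_near. Qed.

Lemma cvgn_inv_sqrt : (Num.sqrt n%:R)^-1 @[n --> \oo] --> (0 : R).
Proof.
apply/cvgrPdist_le => /= eps e0; near=> n.
have ne : eps ^- 2 <= n%:R by near: n; exact: nbhs_infty_ger.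
have n0 : 0 < n%:R :> R by apply: lt_le_trans ne; rewrite invr_gt0 exprn_gt0.
rewrite sub0r normrN ger0_norm ?invr_ge0 ?sqrtr_ge0//.
rewrite -[leRHS]invrK lef_pV2 ?posrE ?invr_gt0 ?sqrtr_gt0//.
by rewrite -(ler_pXn2r (n := 2)) ?nnegrE ?sqrtr_ge0 ?invr_ge0 ?(ltW e0)// sqr_sqrtr ?(ltW n0)// exprVn.
Unshelve. all: by end_near. Qed.

Lemma continuous_powR_gt0 (p t : R) : 0 < t -> {for t, continuous (fun x : R => x `^ p)}.
Proof.
move=> t0; apply: differentiable_continuous; apply/derivable1_diffP.
by apply: derivable_powR; rewrite in_itv/= t0.
Qed.

Lemma cvgn_truncn_ratio (t : R) : 0 <= t ->
  ((Num.truncn (n.*2%:R * t))%:R / n.*2%:R : R) @[n --> \oo] --> t.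
Proof.
move=> t0; apply: (@cvgn_close _ (cst t) (fun n => (n%:R)^-1)).
- near=> n; have n0 : (0 < n)%N by near: n; exact: nbhs_infty_gt.
  have n2 : 0 < n.*2%:R :> R by rewrite ltr0n double_gt0.
  have /andP[h1 h2] := @truncn_itv R (n.*2%:R * t) (mulr_ge0 (ltW n2) t0).
  rewrite /cst -[t in `|_ - t|](mulfK (lt0r_neq0 n2)) -mulrBl normrM normfV (gtr0_norm n2).
  rewrite (mulrC t).
  have : `|(Num.truncn (n.*2%:R * t))%:R - n.*2%:R * t| <= 1.
    by rewrite ler_norml; move: h2; rewrite -natr1; lra.
  move=> h; apply: (@le_trans _ _ (1 * n.*2%:R^-1)); first by rewrite ler_wpM2r// invr_ge0.
  rewrite mul1r lef_pV2 ?posrE ?ltr0n ?double_gt0// ler_nat -addnn; exact: leq_addr.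
- by apply: (@cvgn_inv_ge 1) => //; near=> n; rewrite mul1r.
- exact: cvg_cst.
Unshelve. all: by end_near. Qed.

End SequenceLimits.

(** * Convergence of the accumulated variances to the covariance *)

Section CovarianceLimit.
Variables (R : realType) (alpha : R).
Hypothesis alpha_gt1 : 1 < alpha.
Let g : R := 2 * alpha - 1.
Let g0 : 0 < g. Proof. by rewrite /g; move: alpha_gt1; lra. Qed.

Lemma powR_sum_ge (M N : nat) : (0 < M)%N -> (M <= N)%N ->
  (M%:R `^ (- g) - N%:R `^ (- g)) / g <= \sum_(M <= l < N) l%:R `^ (- (2 * alpha)) :> R.
Proof.
have gE : - g - 1 = - (2 * alpha) by rewrite /g; ring.
move=> M0 /subnKC <-; elim: (N - M)%N => [|d IH].
  by rewrite addn0 subrr mul0r big_geq.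
rewrite addnS big_nat_recr/=; last lia.
set N' := (M + d)%N in IH *.
have N0 : 0 < N'%:R :> R by rewrite ltr0n /N'; lia.
have := @powRN_telescope_lb R g N'%:R g0 N0; rewrite natr1 gE => h.
have h' : (N'%:R `^ (- g) - N'.+1%:R `^ (- g)) / g <= N'%:R `^ (- (2 * alpha)).
  by rewrite ler_pdivrMr// mulrC.
have -> : (M%:R `^ (- g) - N'.+1%:R `^ (- g)) / g =
  (M%:R `^ (- g) - N'%:R `^ (- g)) / g + (N'%:R `^ (- g) - N'.+1%:R `^ (- g)) / g by ring.
by rewrite lerD.
Qed.

Lemma powR_sum_le (M N : nat) : (0 < M)%N -> (M <= N)%N ->
  \sum_(M <= l < N) l%:R `^ (- (2 * alpha)) <=
     M%:R `^ (- (2 * alpha)) + (M%:R `^ (- g) - N%:R `^ (- g)) / g :> R.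
Proof.
have gE : - g - 1 = - (2 * alpha) by rewrite /g; ring.
move=> M0; case: N => [|N] MN; first by lia.
have [->|neq] := eqVneq M N.+1.
  by rewrite big_geq// subrr mul0r addr0 powR_ge0.
have {MN neq} : (M <= N)%N by lia.
move=> /subnKC <-.
apply: (@le_trans _ _ (M%:R `^ (- (2 * alpha)) + (M%:R `^ (- g) - (M + (N - M))%:R `^ (- g)) / g)).
  elim: (N - M)%N => [|d IH].
    by rewrite addn0 subrr mul0r addr0 big_nat1.
  rewrite addnS big_nat_recr/=; last lia.
  set N' := (M + d)%N in IH *.
  have N0 : 1 < N'.+1%:R :> R by rewrite ltr1n /N'; lia.
  have := @powRN_telescope_ub R g N'.+1%:R g0 N0; rewrite gE -natr1 addrK natr1 => h.
  have h' : N'.+1%:R `^ (- (2 * alpha)) <= (N'%:R `^ (- g) - N'.+1%:R `^ (- g)) / g.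
    by rewrite ler_pdivlMr// mulrC.
  have -> : M%:R `^ (- (2 * alpha)) + (M%:R `^ (- g) - N'.+1%:R `^ (- g)) / g =
    M%:R `^ (- (2 * alpha)) + (M%:R `^ (- g) - N'%:R `^ (- g)) / g +
    (N'%:R `^ (- g) - N'.+1%:R `^ (- g)) / g by ring.
  by rewrite lerD.
rewrite lerD2l ler_wpM2r ?invr_ge0 ?(ltW g0)// lerD2l lerN2 !powRN.
set N' := (M + (N - M))%N; have N0 : (0 < N')%N by rewrite /N'; lia.
rewrite lef_pV2 ?posrE ?powR_gt0 ?ltr0n//.
by apply: ge0_ler_powR; rewrite ?nnegrE ?ler_nat// ltW.
Qed.

(** Equivalently 2 s^alpha t^alpha times the integral of u^(-2 alpha) from max(s, t) to 1, the
    integral of which [cov_sum] is a Riemann sum. *)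
Lemma G_covE (s t : R) : 0 < s -> 0 < t ->
  G_cov alpha s t = 2 / g * (s `^ alpha * t `^ alpha) * (Num.max s t `^ (- g) - 1).
Proof.
wlog st : s t / s <= t.
  move=> H s0 t0; have [st|] := boolP (s <= t); first exact: H.
  rewrite -ltNge => /ltW ts.
  have := H t s ts t0 s0; rewrite /G_cov minC maxC => ->.
  by rewrite (mulrC (t `^ _)).
move=> s0 t0; rewrite /G_cov (min_idPl st) (max_idPr st) -/g.
have -> : t `^ (1 - alpha) = t `^ alpha * t `^ (- g).
  rewrite -powRD; last by apply/implyP => _; rewrite gt_eqF.
  by congr (_ `^ _); rewrite /g; ring.
ring.
Qed.

Definition level (n : nat) (t : R) : nat := Num.truncn (n.*2%:R * t).

Lemma level_le n t : t <= 1 -> (level n t <= n.*2)%N.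
Proof.
move=> t1; rewrite /level truncn_le_nat -natr1.
apply: (@le_lt_trans _ _ (n.*2%:R * 1)); first by rewrite ler_wpM2l.
by rewrite mulr1 ltrDl.
Qed.

Lemma level_ge n t : 0 <= t -> n.*2%:R * t - 1 <= (level n t)%:R.
Proof. by move=> t0; have := truncnS_gt (n.*2%:R * t); rewrite -natr1 -/(level n t); lra. Qed.

Lemma le_level n s t : s <= t -> (level n s <= level n t)%N.
Proof. by move=> st; apply: le_truncn; rewrite ler_wpM2l. Qed.

Definition cov_sum (n : nat) (s t : R) : R :=
  n%:R^-1 * \sum_(maxn (level n s) (level n t) <= l < n.*2)
    (((level n s)%:R / l%:R) `^ alpha * ((level n t)%:R / l%:R) `^ alpha).

Lemma cvg_cov_sum (s t : R) : 0 < s <= 1 -> 0 < t <= 1 ->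
  cov_sum n s t @[n --> \oo] --> G_cov alpha s t.
Proof.
move=> /andP[s0 s1] /andP[t0 t1].
pose x n : R := (level n s)%:R / n.*2%:R.
pose y n : R := (level n t)%:R / n.*2%:R.
(* The limit formula at the rounded times. It differs from [cov_sum] by at most the first term of
   that sum, hence by at most 1/n. *)
pose v n := 2 / g * (x n `^ alpha * y n `^ alpha) * (Num.max (x n) (y n) `^ (- g) - 1).
apply: (@cvgn_close _ _ v (fun n => (n%:R)^-1)); last first.
- rewrite G_covE//.
  have xs : x @ \oo --> s by apply: cvgn_truncn_ratio; exact: ltW.
  have yt : y @ \oo --> t by apply: cvgn_truncn_ratio; exact: ltW.
  have pw (z : nat -> R) (r p : R) : 0 < r -> z @ \oo --> r -> (z n `^ p) @[n --> \oo] --> r `^ p.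
    by move=> r0 zr; apply: (cvg_comp z (fun w => w `^ p) zr); exact: continuous_powR_gt0.
  have mx : (Num.max (x n) (y n)) @[n --> \oo] --> Num.max s t.
    have mono a b n : a <= b -> (level n a)%:R / n.*2%:R <= (level n b)%:R / n.*2%:R :> R.
      by move=> ab; rewrite ler_wpM2r ?invr_ge0// ler_nat le_level.
    have [st|] := boolP (s <= t); [|rewrite -ltNge => /ltW ts].
      rewrite (max_idPr st) (_ : (fun n => _) = y)//.
      by apply/funext => n; apply/max_idPr; exact: mono.
    rewrite (max_idPl ts) (_ : (fun n => _) = x)//.
    by apply/funext => n; apply/max_idPl; exact: mono.
  apply: cvgM.
    by apply: cvgM; [exact: cvg_cst|apply: cvgM; exact: pw].
  apply: cvgB; last exact: cvg_cst.
  by apply: pw mx; rewrite lt_max s0.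
- by apply: (@cvgn_inv_ge R 1) => //; near=> n; rewrite mul1r.
near=> n.
have n0 : (0 < n)%N by near: n; exact: nbhs_infty_gt.
have n2 : 0 < n.*2%:R :> R by rewrite ltr0n double_gt0.
have pos r : 0 < r -> r^-1 <= n%:R -> (0 < level n r)%N.
  move=> r0 rn; rewrite /level truncn_gt0 -ler_pdivrMr// mul1r (le_trans rn)// ler_nat -addnn.
  exact: leq_addr.
have k0 : (0 < level n s)%N by apply: pos => //; near: n; exact: nbhs_infty_ger.
have j0 : (0 < level n t)%N by apply: pos => //; near: n; exact: nbhs_infty_ger.
set k := level n s in k0 *; set j := level n t in j0 *.
set M := maxn k j.
have M0 : (0 < M)%N by rewrite /M; lia.
have Mn : (M <= n.*2)%N by rewrite /M geq_max !level_le.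
set S := \sum_(M <= l < n.*2) l%:R `^ (- (2 * alpha)) : R.
have E1 : cov_sum n s t = n%:R^-1 * (k%:R `^ alpha * j%:R `^ alpha) * S.
  rewrite /cov_sum -/k -/j -/M -mulrA; congr (_ * _); rewrite /S big_distrr/=.
  apply: eq_big_nat => l /andP[Ml _].
  have l0 : 0 < l%:R :> R by rewrite ltr0n; lia.
  rewrite !powRM ?invr_ge0 ?(ltW l0)// -!powR_inv1 ?(ltW l0)// -!powRrM mulN1r.
  have -> : - (2 * alpha) = - alpha + - alpha by ring.
  by rewrite powRD; [ring|apply/implyP => _; rewrite gt_eqF].
have E2 : v n = n%:R^-1 * (k%:R `^ alpha * j%:R `^ alpha) * ((M%:R `^ (- g) - n.*2%:R `^ (- g)) / g).
  rewrite /v /x /y -/k -/j.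
  have -> : Num.max (k%:R / n.*2%:R) (j%:R / n.*2%:R) = M%:R / n.*2%:R :> R.
    by rewrite -maxr_pMl ?invr_ge0// /M natr_max.
  set N : R := n.*2%:R in n2 *.
  have NV p : N^-1 `^ p = (N `^ p)^-1 by rewrite -powR_inv1 ?ltW// -powRrM mulN1r powRN.
  rewrite !powRM ?invr_ge0 ?(ltW n2)// !NV.
  have Na : 0 < N `^ alpha by exact: powR_gt0.
  have Ng : N `^ (- g) = N / (N `^ alpha * N `^ alpha).
    rewrite -powRD; last by apply/implyP => _; rewrite gt_eqF.
    rewrite -powRN -{2}(powRr1 (ltW n2)) -powRD; last by apply/implyP => _; rewrite gt_eqF.
    by congr (_ `^ _); rewrite /g; ring.
  rewrite Ng; have NE : N = 2 * n%:R by rewrite /N -muln2 natrM mulrC.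
  have nn0 : 0 < n%:R :> R by rewrite ltr0n.
  move: (M%:R `^ _) (k%:R `^ _) (j%:R `^ _) => A B C.
  move: (N `^ alpha) Na => D Na; rewrite NE.
  clear -nn0 Na g0; move: g (n%:R) g0 nn0 => G X G0 X0.
  by field; rewrite !gt_eqF.
have h1 := powR_sum_ge M0 Mn; have h2 := powR_sum_le M0 Mn.
rewrite -/S in h1 h2.
rewrite E1 E2 -mulrBr normrM.
set c := n%:R^-1 * _.
have c0 : 0 <= c by rewrite /c !mulr_ge0 ?invr_ge0 ?powR_ge0.
rewrite (ger0_norm c0).
apply: (@le_trans _ _ (c * M%:R `^ (- (2 * alpha)))).
  by rewrite ler_wpM2l// ler_norml; have := powR_ge0 M%:R (- (2 * alpha)) : (_ <= _ :> R); lra.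
rewrite /c -mulrA ler_piMr ?invr_ge0//.
have -> : - (2 * alpha) = - alpha + - alpha by ring.
rewrite powRD; last by apply/implyP => _; rewrite pnatr_eq0; lia.
rewrite powRN mulrACA -[leRHS]mulr1.
have H q : (q <= M)%N -> q%:R `^ alpha / M%:R `^ alpha <= 1 :> R.
  move=> qM; rewrite ler_pdivrMr ?powR_gt0 ?ltr0n// mul1r.
  by apply: ge0_ler_powR; rewrite ?nnegrE ?ler_nat//; move: alpha_gt1; lra.
by rewrite ler_pM ?divr_ge0 ?powR_ge0// H// /M ?leq_maxl ?leq_maxr.
Unshelve. all: by end_near. Qed.

End CovarianceLimit.

(** * Marginals at times bounded away from 0 *)

Section FiniteDimensional.
Variables (R : realType) (alpha : R).
Hypothesis alpha_gt1 : 1 < alpha.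
Variables (m : nat) (ts cs : 'I_m -> R) (tau : R).
Hypothesis tau01 : 0 < tau <= 1.
Hypothesis tsP : forall i, tau <= ts i <= 1.

Let k n i := level n (ts i).
Let K n := level n tau.
Let c n i : R := cs i / Num.sqrt n%:R.
Let th n l : R := \sum_(i < m) (if k n i == l then c n i else 0).
(** The explicit solution of the recursion [lamS]: a coefficient that enters at level k has shrunk
    by (k/l)^alpha at level l. *)
Let lam n l : R :=
  \sum_(i < m) (if (k n i <= l)%N then c n i * ((k n i)%:R / l%:R) `^ alpha else 0).
Let S : R := \sum_(i < m) `|cs i|.

Let Kk n i : (K n <= k n i)%N.
Proof. by apply: le_level; case/andP: (tsP i). Qed.

Let kn n i : (k n i <= n.*2)%N.
Proof. by apply: level_le; case/andP: (tsP i). Qed.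

Let lamK n : (0 < K n)%N -> lam n (K n) = th n (K n).
Proof.
move=> K0; apply: eq_bigr => i _; have := Kk n i.
case: (ltngtP (k n i) (K n)) => // E _.
by rewrite E divff ?powR1 ?mulr1// pnatr_eq0; lia.
Qed.

Let lamS n l : (0 < l)%N ->
  lam n l.+1 = th n l.+1 + lam n l * (l%:R / l.+1%:R) `^ alpha.
Proof.
move=> l0; rewrite /lam /th big_distrl/= -big_split/=; apply: eq_bigr => i _.
have [E|ne] := eqVneq (k n i) l.+1.
  by rewrite E leqnn ltnn mul0r addr0 divff ?powR1 ?mulr1// pnatr_eq0.
rewrite add0r leq_eqVlt (negbTE ne)/= ltnS; case: ifP => _; last by rewrite mul0r.
rewrite -mulrA -powRM ?divr_ge0//; congr (_ * (_ `^ _)).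
by rewrite mulrA divfK// pnatr_eq0 -lt0n.
Qed.

Let lam_le n l : (0 < l)%N -> `|lam n l| <= S / Num.sqrt n%:R.
Proof.
move=> l0; rewrite (le_trans (ler_norm_sum _ _ _))// /S big_distrl/=.
apply: ler_sum => i _; case: ifP => kl; last by rewrite normr0 divr_ge0 ?sqrtr_ge0.
rewrite /c !normrM normfV (ger0_norm (sqrtr_ge0 _)) (ger0_norm (powR_ge0 _ _)).
apply: ler_piMr; first by rewrite divr_ge0 ?sqrtr_ge0.
apply: (@le_trans _ _ (1 `^ alpha)); last by rewrite powR1.
apply: ge0_ler_powR; rewrite ?nnegrE ?divr_ge0//.
  by move: alpha_gt1; lra.
by rewrite ler_pdivrMr ?ltr0n// mul1r ler_nat.
Qed.

Let V n : R := \sum_(i < m) \sum_(j < m) cs i * cs j * cov_sum alpha n (ts i) (ts j).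

Let VE n : (0 < n)%N -> \sum_(K n <= l < n.*2) lam n l ^+ 2 = V n.
Proof.
move=> n0.
have n0' : 0 < n%:R :> R by rewrite ltr0n.
have sq : (Num.sqrt n%:R)^-1 * (Num.sqrt n%:R)^-1 = n%:R^-1 :> R.
  by rewrite -invfM -expr2 sqr_sqrtr// ltW.
transitivity (\sum_(K n <= l < n.*2) \sum_(i < m) \sum_(j < m)
  (if (maxn (k n i) (k n j) <= l)%N then
    cs i * cs j * (n%:R^-1 * (((k n i)%:R / l%:R) `^ alpha * ((k n j)%:R / l%:R) `^ alpha)) else 0)).
  apply: eq_bigr => l _; rewrite expr2 big_distrlr/=; apply: eq_bigr => i _.
  apply: eq_bigr => j _; rewrite geq_max; case: ifP => h1 /=; last by rewrite mul0r.
  case: ifP => h2; last by rewrite mulr0.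
  by rewrite -sq /c; ring.
rewrite exchange_big/=; apply: eq_bigr => i _.
rewrite exchange_big/=; apply: eq_bigr => j _.
rewrite /cov_sum -/(k n i) -/(k n j) big_distrr/= big_distrr/=.
have KM : (K n <= maxn (k n i) (k n j))%N by rewrite leq_max Kk.
have Mn : (maxn (k n i) (k n j) <= n.*2)%N by rewrite geq_max !kn.
rewrite (big_cat_nat KM Mn)/= big_nat_cond big1 ?add0r; last first.
  by move=> l /andP[/andP[_ lM] _]; rewrite leqNgt lM.
by apply: eq_big_nat => l /andP[Ml _]; rewrite Ml.
Qed.

Let cvgV : V @ \oo --> \sum_(i < m) \sum_(j < m) cs i * cs j * G_cov alpha (ts i) (ts j).
Proof.
apply: cvgn_sum => i; apply: cvgn_sum => j; apply: cvgM; first exact: cvg_cst.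
have t0 i' : 0 < ts i' <= 1.
  by case/andP: (tsP i') => h1 ->; rewrite andbT; case/andP: tau01 => h _; exact: lt_le_trans h1.
exact: cvg_cov_sum.
Qed.

(** A limit of sums of squares. It supplies the nonnegative variance needed to evaluate the Gaussian
    characteristic function. *)
Lemma G_cov_quad_ge0 :
  0 <= \sum_(i < m) \sum_(j < m) cs i * cs j * G_cov alpha (ts i) (ts j).
Proof.
rewrite -(cvg_lim _ cvgV)//; apply: limr_ge; first by apply/cvg_ex; eexists; exact: cvgV.
near=> n; rewrite -VE; last by near: n; exact: nbhs_infty_gt.
by apply: sumr_ge0 => l _; exact: sqr_ge0.
Unshelve. all: by end_near. Qed.

Definition fdd_sum (n : nat) (s : seq bool) : R :=
  \sum_(i < m) cs i * ((Num.sqrt n%:R)^-1 * bD R n (drop (level n (ts i) - 2) s)).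

Let wsumE n s : (2 <= K n)%N -> size s = (n.*2 - 2)%N ->
  wsum n (th n) (drop (n.*2 - 2 - (n.*2 - K n)) s) = fdd_sum n s.
Proof.
move=> K2 sn; have Kn := leq_trans.
have Kn2 : (K n <= n.*2)%N by apply: level_le; case/andP: tau01.
rewrite /wsum size_drop sn.
set L := (n.*2 - K n)%N.
have -> : (n.*2 - 2 - (n.*2 - 2 - L) = L)%N by rewrite /L; lia.
rewrite /th /fdd_sum; under eq_bigr do rewrite big_distrl/=.
rewrite exchange_big/=; apply: eq_bigr => i _.
have ki := Kk n i; have kn' := kn n i.
have qL : (n.*2 - k n i < L.+1)%N by rewrite /L; lia.
rewrite (bigD1 (Ordinal qL))//= big1 ?addr0; last first.
  move=> q; rewrite -val_eqE/= => qne.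
  case: eqP => [E|_]; last by rewrite mul0r.
  by case/negP: qne; apply/eqP; rewrite E subKn// (leq_trans (leq_ord q))// leq_subr.
rewrite subKn// eqxx /c -mulrA drop_drop; congr (_ * (_ * bD _ _ (drop _ _))).
by rewrite -/(k n i) /L; lia.
Qed.

Theorem cvg_fdd_char (b : R) :
  cE alpha n (fun s => cos (b + fdd_sum n s)) @[n --> \oo] -->
  expR (- ((\sum_(i < m) \sum_(j < m) cs i * cs j * G_cov alpha (ts i) (ts j)) / 2)) * cos b.
Proof.
have [tau0 tau1] := andP tau01.
pose v n : R := expR (- (V n / 2)) * cos b.
(* The distance from the axes for [cE_drop_close], which asks that four times it not exceed the
   level K n; it grows linearly in n. *)
pose q n := (K n %/ 4)%N.
pose e1 n : R := (4 / (alpha - 1) * (q n)%:R `^ (1 - alpha) + (q n)%:R^-1) / hit_lower alpha.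
(* The error of [bE_cos_wsum] with Lam = S / sqrt n and K >= n tau, times sqrt n. *)
pose C : R := 8 * S ^+ 3 + 2 * S * char_const alpha / tau.
pose e2 n : R := C * (Num.sqrt n%:R)^-1.
have Kge n : 8 / tau <= n%:R -> n%:R * tau <= (K n)%:R.
  move=> h; have := @level_ge R n tau (ltW tau0); rewrite -/(K n) -muln2 natrM.
  by rewrite ler_pdivrMr// in h; lra.
have qge n : 8 / tau <= n%:R -> tau / 8 * n%:R <= (q n)%:R.
  move=> h; have := Kge n h; have : (K n < 4 * (q n).+1)%N by rewrite /q mulnC ltn_ceil.
  rewrite -(ltr_nat R) natrM -natr1; rewrite ler_pdivrMr// in h; lra.
have cq : (q n)%:R^-1 @[n --> \oo] --> (0 : R).
  apply: (@cvgn_inv_ge R (tau / 8)); first by rewrite divr_gt0.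
  by near=> n; apply: qge; near: n; exact: nbhs_infty_ger.
apply: (@cvgn_close _ _ v (fun n => e1 n + e2 n)); last first.
- apply: cvgM; last exact: cvg_cst.
  apply: (@cvg_comp _ _ _ (fun n => - (V n / 2)) expR); last exact: continuous_expR.
  by apply: cvgN; apply: cvgM; [exact: cvgV|exact: cvg_cst].
- rewrite -[0]addr0; apply: cvgD.
    rewrite -[X in _ --> X](mul0r (hit_lower alpha)^-1); apply: cvgM; last exact: cvg_cst.
    rewrite -[0]addr0; apply: cvgD => //.
    rewrite -[X in _ --> X](mulr0 (4 / (alpha - 1))); apply: cvgM; first exact: cvg_cst.
    have -> : (fun n => (q n)%:R `^ (1 - alpha)) = (fun n => ((q n)%:R^-1 `^ (alpha - 1) : R)).
      by apply/funext => n; rewrite -powR_inv1// -powRrM mulN1r opprB.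
    by apply: cvgn_powR0 => //; rewrite ?subr_gt0.
  rewrite -[X in _ --> X](mulr0 C); apply: cvgM; first exact: cvg_cst.
  exact: cvgn_inv_sqrt.
near=> n.
have n8 : 8 / tau <= n%:R by near: n; exact: nbhs_infty_ger.
have n2a : 2 * alpha / tau <= n%:R by near: n; exact: nbhs_infty_ger.
have nS : S ^+ 2 <= n%:R by near: n; exact: nbhs_infty_ger.
have n0 : (0 < n)%N by near: n; exact: nbhs_infty_gt.
have n0' : 0 < n%:R :> R by rewrite ltr0n.
have sn0 : 0 < Num.sqrt n%:R :> R by rewrite sqrtr_gt0.
have S0 : 0 <= S by apply: sumr_ge0.
have KR := Kge n n8.
have K8 : (8 <= K n)%N.
  by rewrite -(ler_nat R) (le_trans _ KR)// -ler_pdivrMr.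
have Kn : (K n <= n.*2)%N by exact: level_le.
pose Lam := S / Num.sqrt n%:R.
have Lam0 : 0 <= Lam by rewrite /Lam divr_ge0// ltW.
have Lam1 : Lam <= 1.
  rewrite /Lam ler_pdivrMr// mul1r -(ler_pXn2r (n := 2)) ?nnegrE ?sqrtr_ge0//.
  by rewrite sqr_sqrtr ?(ltW n0').
have K2a : 2 * alpha <= (K n)%:R by rewrite (le_trans _ KR)// -ler_pdivrMr.
have K0N : (0 < K n)%N by exact: leq_trans K8.
have K2N : (2 <= K n)%N by exact: leq_trans K8.
have q0 : (0 < q n)%N by rewrite /q divn_gt0// (leq_trans _ K8).
have qK : (4 * q n <= n.*2 - (n.*2 - K n))%N by rewrite subKn// mulnC leq_divM.
have H2 := @bE_cos_wsum R alpha alpha_gt1 n (th n) (lam n) (K n) K2a Kn (lamK K0N)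
  (fun l Kl _ => lamS n (leq_trans K0N Kl)) Lam Lam0 Lam1
  (fun l Kl _ => lam_le n (leq_trans K0N Kl)) b.
rewrite VE// -/(v n) in H2.
have H1 := @cE_drop_close R alpha alpha_gt1 n n0 (fun s => cos (b + wsum n (th n) s))
  (n.*2 - K n) (q n) (leq_sub2l _ K2N) q0 qK
  (fun s _ => cos_max _).
rewrite -/(e1 n) in H1.
have -> : cE alpha n (fun s => cos (b + fdd_sum n s)) =
  cE alpha n (fun s => cos (b + wsum n (th n) (drop (n.*2 - 2 - (n.*2 - K n)) s))).
  by apply: cE_eq => // s sn _; rewrite wsumE.
rewrite -(subrK (bE alpha n (n.*2 - K n) (fun s => cos (b + wsum n (th n) s))) (cE _ _ _)).
rewrite -addrA (le_trans (ler_normD _ _))// lerD// (le_trans H2)//.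
rewrite /e2 /C /Lam.
set r := Num.sqrt n%:R; rewrite -/r in sn0.
have nE : n%:R = r ^+ 2 by rewrite /r sqr_sqrtr// ltW.
have K0 : 0 < (K n)%:R :> R by rewrite ltr0n.
have hK : (K n)%:R^-1 <= (n%:R * tau)^-1 by rewrite lef_pV2 ?posrE ?mulr_gt0.
apply: (@le_trans _ _ (n.*2%:R * (4 * (S / r) ^+ 3 + S / r * (char_const alpha * (n%:R * tau)^-1)))).
  rewrite ler_wpM2l// lerD2l ler_wpM2l ?divr_ge0 ?(ltW sn0)// ler_wpM2l//.
  exact: char_const_ge0.
rewrite le_eqVlt; apply/orP; left; apply/eqP.
rewrite -muln2 natrM nE; field; lra.
Unshelve. all: by end_near. Qed.

End FiniteDimensional.

(** * Oscillation of the chain within a block of levels *)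

Section BlockOscillation.
Variables (R : realType) (alpha : R).
Hypothesis alpha_gt1 : 1 < alpha.
Variables (n q0 : nat) (x : R).
Local Notation bE := (bE alpha n).
Local Notation bD := (bD R n).
Local Notation bbias := (bbias alpha n).

(* Martingale part of the backward walk after the first q0 steps, stopped when
   it leaves (-x, x); stopping it turns a bound on its final fourth moment into
   a maximal inequality. *)
Fixpoint stopped (s : seq bool) : R :=
  if s is _ :: s' then
    if (size s' < q0)%N || (x <= `|stopped s'|) then stopped s'
    else stopped s' + (bD s - bD s' + bbias s')
  else 0.

(** Total variation of the compensator after the first q0 steps. Being nondecreasing along the path,
    its final value bounds all earlier ones without stopping. *)
Fixpoint drift (s : seq bool) : R :=
  if s is _ :: s' then
    if (size s' < q0)%N then drift s' else drift s' + `|bbias s'|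
  else 0.

Lemma drift_ge0 s : 0 <= drift s.
Proof. by elim: s => //= b s IH; case: ifP => // _; rewrite addr_ge0. Qed.

Lemma stopped_early s : (size s <= q0)%N -> stopped s = 0.
Proof. by elim: s => //= b s IH sq; rewrite sq/=; apply: IH; exact: ltnW. Qed.

Lemma drift_early s : (size s <= q0)%N -> drift s = 0.
Proof. by elim: s => //= b s IH sq; rewrite sq/=; apply: IH; exact: ltnW. Qed.

Lemma stopped_repr s : (q0 <= size s)%N -> `|stopped s| < x ->
  `|bD s - bD (drop (size s - q0) s) - stopped s| <= drift s.
Proof.
elim: s => [|b s IH].
  by rewrite leqn0 => /eqP -> _ /=; rewrite subrr subr0 normr0.
rewrite [size _]/= => sq.
have [E|ne] := eqVneq (size s).+1 q0.
  have e : (size (b :: s) <= q0)%N by rewrite /= E.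
  by move=> _; rewrite E subnn drop0 (stopped_early e) (drift_early e) subrr subr0 normr0.
have {}sq : (q0 <= size s)%N by rewrite -ltnS ltn_neqAle eq_sym ne.
rewrite subSn//= ltnNge sq/=; case: ifP => xs.
  by move=> /(le_lt_trans xs); rewrite ltxx.
move=> _; have sx : `|stopped s| < x by rewrite ltNge xs.
have := IH sq sx; set D0 := bD (drop _ _) => h.
have -> : bD (b :: s) - D0 - (stopped s + (bD (b :: s) - bD s + bbias s)) =
  (bD s - D0 - stopped s) - bbias s by ring.
by rewrite (le_trans (ler_normB _ _))// lerD.
Qed.

(** [stopped] freezes once outside (-x, x), so a final value inside means that it never left, and
    [stopped_repr] applies at every intermediate time. *)
Lemma stopped_osc s q : (q0 <= q)%N -> (q <= size s)%N -> `|stopped s| < x ->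
  `|bD (drop (size s - q) s) - bD (drop (size s - q0) s)| <= x + drift s.
Proof.
move=> qq; elim: s => [|b s IH].
  rewrite leqn0 => /eqP q_0; move: qq; rewrite q_0 leqn0 => /eqP -> h.
  by rewrite subrr normr0 addr_ge0 ?drift_ge0// (le_trans _ (ltW h)).
move=> qs h; have sq := leq_trans qq qs.
have [E|ne] := eqVneq (size s).+1 q.
  rewrite -{1}E [size _]/= subnn drop0.
  have := stopped_repr sq h; set D0 := bD (drop _ _) => H.
  rewrite -(subrK (stopped (b :: s)) (bD (b :: s) - D0)) addrC.
  by rewrite (le_trans (ler_normD _ _))// lerD// ltW.
have {}qs : (q <= size s)%N by move: qs; rewrite [size _]/= leq_eqVlt eq_sym (negbTE ne).
have sq' := leq_trans qq qs.
have h' : `|stopped s| < x /\ drift s <= drift (b :: s).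
  move: h => /=; rewrite ltnNge sq'/=; case: ifP => xs; last first.
    by move=> _; rewrite ltNge xs lerDl.
  by move=> /(le_lt_trans xs); rewrite ltxx.
rewrite [size _]/= !subSn//=; case: h' => h1 h2.
by apply: (le_trans (IH qs h1)); rewrite lerD2l.
Qed.

Lemma bE_stopped_step (phi : R -> R) L : (q0 <= L)%N -> (L < n.*2)%N ->
  bE L.+1 (fun s => phi (stopped s)) =
  bE L (fun s => if x <= `|stopped s| then phi (stopped s) else
    (1 + bbias s) / 2 * phi (stopped s + (bbias s - 1)) +
    (1 - bbias s) / 2 * phi (stopped s + (bbias s + 1))).
Proof.
move=> qL Ln.
pose F s (b : bool) (D : R) := phi (if x <= `|stopped s| then stopped s
   else stopped s + (D - bD s + bbias s)).
transitivity (bE L.+1 (fun s => F (behead s) (head false s) (bD s))).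
  apply: bE_eq => // -[|b s]//= [sL] _; rewrite /F sL ltnNge qL/=.
  by case: ifP.
rewrite bE_step//; apply: bE_eq => // s sL _; rewrite /F; case: ifP => _.
  by field.
by congr (_ * phi _ + _ * phi _); ring.
Qed.

Lemma bE_stopped_sqr d : (q0 + d <= n.*2)%N ->
  bE (q0 + d) (fun s => stopped s ^+ 2) <= d%:R.
Proof.
elim: d => [|d IH] dn.
  rewrite addn0 -[leRHS](@bE_cst _ _ alpha_gt1 n q0); last by rewrite -[q0]addn0.
  by apply: bE_le => // s sq _; rewrite stopped_early ?sq// expr0n.
rewrite addnS (@bE_stopped_step (fun y => y ^+ 2)); [|exact: leq_addr|by rewrite -addnS].
have {}dn : (q0 + d <= n.*2)%N by apply: leq_trans dn; rewrite leq_add2l.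
have {}IH := IH dn.
apply: (@le_trans _ _ (bE (q0 + d) (fun s => stopped s ^+ 2 + 1))); last first.
  by rewrite bED// bE_cst// -natr1 lerD2r.
apply: bE_le => // s _ _; case: ifP => _; first by rewrite lerDl.
have := sqr_ge0 (bbias s); set y := stopped s; set be := bbias s => h.
have -> : (1 + be) / 2 * (y + (be - 1)) ^+ 2 + (1 - be) / 2 * (y + (be + 1)) ^+ 2 =
  y ^+ 2 + 1 - be ^+ 2 by field.
lra.
Qed.

(** A step from the value y with bias be adds at most 10 y^2 + 6 in mean: the cross term 8 y be (1 -
    be^2) is at most 4 (y^2 + 1), and the term free of y at most 2. As E y^2 <= d, the constant 11
    closes the induction: 10 d + 6 <= 22 d + 11. *)
Lemma bE_stopped_pow4 d : (q0 + d <= n.*2)%N ->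
  bE (q0 + d) (fun s => stopped s ^+ 4) <= 11 * d%:R ^+ 2.
Proof.
elim: d => [|d IH] dn.
  rewrite addn0 expr0n mulr0 -[leRHS](@bE_cst _ _ alpha_gt1 n q0); last by rewrite -[q0]addn0.
  by apply: bE_le => // s sq _; rewrite stopped_early ?sq// expr0n.
rewrite addnS (@bE_stopped_step (fun y => y ^+ 4)); [|exact: leq_addr|by rewrite -addnS].
have {}dn : (q0 + d <= n.*2)%N by apply: leq_trans dn; rewrite leq_add2l.
have {}IH := IH dn.
apply: (@le_trans _ _ (bE (q0 + d) (fun s => stopped s ^+ 4 + 10 * stopped s ^+ 2 + 6))); last first.
  rewrite bED// bED// bEZ// bE_cst//.
  have h2 := bE_stopped_sqr dn.
  rewrite -natr1; have : 0 <= d%:R :> R by []; nra.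
apply: bE_le => // s _ _; case: ifP => _.
  by have := sqr_ge0 (stopped s); lra.
have := norm_bias_le1 alpha_gt1 (bX n s) (bY n s); rewrite -/(bbias s).
set y := stopped s; set be := bbias s; rewrite ler_norml => /andP[b1 b2].
have -> : (1 + be) / 2 * (y + (be - 1)) ^+ 4 + (1 - be) / 2 * (y + (be + 1)) ^+ 4 =
  y ^+ 4 + 6 * y ^+ 2 * (1 - be ^+ 2) + 8 * (y * be) * (1 - be ^+ 2) +
  (1 - be ^+ 2) * (1 + 3 * be ^+ 2) by field.
have w0 : 0 <= 1 - be ^+ 2 by nra.
have w1 : 1 - be ^+ 2 <= 1 by have := sqr_ge0 be; lra.
set w := 1 - be ^+ 2 in w0 w1 *.
have h1 : y ^+ 2 * w <= y ^+ 2 by rewrite ler_piMr ?sqr_ge0.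
have h2 : y * be * w <= (y ^+ 2 + 1) / 2.
  have yb : y * be <= (y ^+ 2 + 1) / 2.
    by have := sqr_ge0 (y - be); rewrite sqrrB; nra.
  have ybp : 0 <= (y ^+ 2 + 1) / 2 by have := sqr_ge0 y; lra.
  apply: (@le_trans _ _ ((y ^+ 2 + 1) / 2 * w)); first by rewrite ler_wpM2r.
  by rewrite ler_piMr.
have h3 : w * (1 + 3 * be ^+ 2) <= 2.
  have -> : be ^+ 2 = 1 - w by rewrite /w; ring.
  nra.
lra.
Qed.

Lemma bE_drift_sum (psi : R -> R) (d : nat) : (q0 + d <= n.*2)%N ->
  forall G : seq bool -> R,
  (forall s, (size s <= q0)%N -> G s = 0) ->
  (forall b s, (q0 <= size s)%N -> G (b :: s) = G s + psi (bbias s)) ->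
  bE (q0 + d) G = \sum_(q0 <= q < q0 + d) bE q (fun s => psi (bbias s)).
Proof.
move=> dn G G0 GS; elim: d dn => [|d IH] dn.
  rewrite addn0 big_geq// -[RHS](@bE_cst _ _ alpha_gt1 n q0); last by rewrite -[q0]addn0.
  by apply: bE_eq => // s sq _; rewrite G0// sq.
have dn' : (q0 + d < n.*2)%N by rewrite -addnS.
rewrite addnS big_nat_recr ?leq_addr// -IH; last exact: ltnW.
rewrite -[RHS]/(_ + _) -bED// -(@bE_behead _ _ alpha_gt1 n (q0 + d) (fun s => G s + psi (bbias s)) dn'); apply: bE_eq => // -[|b s]//= [sq] _.
by rewrite GS// sq leq_addr.
Qed.

(** At level k the inequality |b| <= k^(-1/2) + k^(1/2) b^2 reduces the mean of |b| to the second
    moment, and the sum of k^(-1/2) telescopes. Unlike the next bound, this one survives when the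
    block reaches the lowest levels. *)
Lemma bE_drift_le d : (q0 + d < n.*2)%N ->
  bE (q0 + d) drift <=
  (1 + bias_const alpha ^+ 2) * (2 * Num.sqrt (n.*2 - q0)%:R).
Proof.
move=> dn.
rewrite (bE_drift_sum (psi := fun y => `|y|)) ?(ltnW dn)//; last 2 first.
- by move=> s; exact: drift_early.
- by move=> b s qs /=; rewrite ltnNge qs.
have sqrt_step (l : nat) : (0 < l)%N ->
  (Num.sqrt l%:R)^-1 <= 2 * (Num.sqrt l%:R - Num.sqrt (l.-1)%:R) :> R.
  move=> l0; have lp : 0 < l%:R :> R by rewrite ltr0n.
  have r0 : 0 < Num.sqrt l%:R :> R by rewrite sqrtr_gt0.
  set r := Num.sqrt l%:R in r0 *; set r' := Num.sqrt l.-1%:R.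
  have r'0 : 0 <= r' by exact: sqrtr_ge0.
  have rr : r ^+ 2 = r' ^+ 2 + 1.
    by rewrite !sqr_sqrtr// natr1 prednK.
  rewrite -[leLHS]mul1r ler_pdivrMr//.
  have := sqr_ge0 (r - r'); rewrite sqrrB; nra.
have sum_le N e : (e <= N)%N ->
   \sum_(N - e <= l < N) (Num.sqrt l.+1%:R)^-1 <= 2 * (Num.sqrt N%:R - Num.sqrt (N - e)%:R) :> R.
  elim: e => [|e IH] eN; first by rewrite subn0 big_geq// subrr mulr0.
  have eN' := ltnW eN.
  have E : (N - e = (N - e.+1).+1)%N by rewrite subnS prednK// subn_gt0.
  rewrite (@big_ltn _ _ _ (N - e.+1)); last by rewrite -E leq_subr.
  rewrite -E; have := sqrt_step (N - e)%N; rewrite subn_gt0 => /(_ eN).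
  have := IH eN'; rewrite subnS => h1 h2; lra.
set c := 1 + _ ^+ 2.
have c0 : 0 <= c by rewrite /c addr_ge0// sqr_ge0.
apply: (@le_trans _ _ (\sum_(q0 <= q < q0 + d) c * (Num.sqrt (n.*2 - q)%:R)^-1)).
  apply: ler_sum_nat => q /andP[qq qd].
  have qn : (q < n.*2)%N by exact: ltn_trans dn.
  have kp : 0 < (n.*2 - q)%:R :> R by rewrite ltr0n subn_gt0.
  set k : R := (n.*2 - q)%:R in kp *.
  have r0 : 0 < Num.sqrt k by rewrite sqrtr_gt0.
  set r := Num.sqrt k in r0 *.
  have rk : k = r ^+ 2 by rewrite sqr_sqrtr// ltW.
  apply: (@le_trans _ _ (bE q (fun s => r^-1 + r * bbias s ^+ 2))).
    apply: bE_le => // s _ _; rewrite -(real_normK (num_real (bbias s))).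
    set y := `|bbias s|; have y0 : 0 <= y by rewrite /y normr_ge0.
    rewrite -(ler_pM2l r0) mulrDr mulfV ?gt_eqF// mulrA -expr2.
    have := sqr_ge0 (r * y - 1); rewrite sqrrB1 exprMn.
    have : 0 <= r * y by rewrite mulr_ge0// ltW.
    have : 0 <= r ^+ 2 * y ^+ 2 by rewrite mulr_ge0 ?sqr_ge0.
    lra.
  rewrite bED// bEZ// bE_cst ?(ltnW qn)//.
  have := ler_wpM2l (ltW r0) (bE_bbias_sqr alpha_gt1 qn); rewrite -/k rk => h.
  have -> : c * r^-1 = r^-1 + r * (bias_const alpha ^+ 2 / r ^+ 2) by rewrite /c; field; lra.
  by rewrite lerD2l.
rewrite -big_distrr/= ler_wpM2l//.
have -> : \sum_(q0 <= q < q0 + d) (Num.sqrt (n.*2 - q)%:R)^-1 =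
  \sum_(n.*2 - q0 - d <= l < n.*2 - q0) (Num.sqrt l.+1%:R)^-1 :> R.
  elim: d dn => [|d IH] dn; first by rewrite addn0 subn0 !big_geq.
  rewrite addnS big_nat_recr ?leq_addr//= IH; last by rewrite (ltn_trans _ dn)// addnS.
  have E : (n.*2 - q0 - d = (n.*2 - q0 - d.+1).+1)%N.
    by rewrite !subnS prednK// -subnDA subn_gt0 (ltn_trans _ dn)// addnS.
  rewrite [in RHS]big_ltn; last by rewrite -E leq_subr.
  by rewrite -E addrC; congr (_ + _); rewrite subnDA.
have dq : (d <= n.*2 - q0)%N by rewrite leq_subRL ?(ltnW dn)// (leq_trans _ (ltnW dn))// leq_addr.
apply: (le_trans (sum_le _ _ dq)); rewrite ler_wpM2l// gerBl sqrtr_ge0//.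
Qed.

(** Fourth moments are used because a block of length and lowest level of order n/m, with x of order
    sqrt n, then has probability of order m^-2, summable over m blocks. *)
Lemma bE_drift_tail d : (0 < d)%N -> (q0 + d < n.*2)%N -> 0 < x ->
  bE (q0 + d) (fun s => (x <= drift s)%R%:R) <=
  64 * bias_const alpha ^+ 4 * d%:R ^+ 4 / ((n.*2 - (q0 + d))%:R ^+ 2 * x ^+ 4).
Proof.
move=> d0 dn x0.
(* From |y| <= cc + y^4 / cc^3, the first terms sum to x/2 over d steps. So a drift of at least x
   forces the sum [G] of fourth powers to reach x cc^3 / 2 = x^4 / (16 d^3). *)
pose cc := x / (2 * d%:R).
have dR : 0 < d%:R :> R by rewrite ltr0n.
have cc0 : 0 < cc by rewrite divr_gt0// mulr_gt0.
pose G := fix G (s : seq bool) : R := if s is _ :: s' then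
   if (size s' < q0)%N then G s' else G s' + bbias s' ^+ 4 else 0.
have G0 s : (size s <= q0)%N -> G s = 0.
  by elim: s => //= b s IH sq; rewrite sq; apply: IH; exact: ltnW.
have Gp s : 0 <= G s.
  by elim: s => //= b s IH; case: ifP => // _; rewrite addr_ge0// (exprM _ 2 2) sqr_ge0.
have dG s : (q0 <= size s)%N -> drift s <= (size s - q0)%:R * cc + G s / cc ^+ 3.
  elim: s => [|b s IH].
    by rewrite leqn0 => /eqP -> /=; rewrite mul0r mul0r addr0.
  rewrite [size _]/= => sq.
  have [E|ne] := eqVneq (size s).+1 q0.
    have e : (size (b :: s) <= q0)%N by rewrite /= E.
    by rewrite E subnn mul0r (drift_early e) (G0 _ e) mul0r addr0.
  have {}sq : (q0 <= size s)%N by rewrite -ltnS ltn_neqAle eq_sym ne.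
  have {}IH := IH sq.
  rewrite subSn// -natr1 /= ltnNge sq/=.
  set y := bbias s.
  have : `|y| <= cc + y ^+ 4 / cc ^+ 3.
    have y4 : y ^+ 4 = `|y| * `|y| ^+ 3.
      by rewrite -exprS -[4%N]/(2 * 2)%N !exprM real_normK ?num_real.
    have [yc|yc] := lerP `|y| cc.
      by rewrite (le_trans yc)// lerDl divr_ge0 ?(exprM _ 2 2) ?sqr_ge0// exprn_ge0// ltW.
    rewrite y4 -mulrA (@le_trans _ _ (`|y| * (`|y| ^+ 3 / cc ^+ 3)))//; last by rewrite lerDr ltW.
    rewrite ler_peMr// ler_pdivlMr ?exprn_gt0// mul1r lerXn2r ?nnegrE ?(ltW yc)//.
    exact: ltW.
  by move=> hy; rewrite mulrDl [(_ + y ^+ 4) / _]mulrDl mul1r addrACA lerD.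
have x4 : 0 < x ^+ 4 by rewrite exprn_gt0.
set kk : R := (n.*2 - (q0 + d))%:R.
have kk0 : 0 < kk by rewrite ltr0n subn_gt0.
apply: (@le_trans _ _ (bE (q0 + d) (fun s => (16 * d%:R ^+ 3 / x ^+ 4) * G s))).
  apply: bE_le => // s sq _.
  have c16 : 0 <= 16 * d%:R ^+ 3 / x ^+ 4.
    by rewrite divr_ge0 ?(ltW x4)// mulr_ge0// exprn_ge0.
  case: (boolP (x <= drift s)) => xd; last by rewrite mulr_ge0.
  have := dG s; rewrite sq leq_addr addKn => /(_ isT) h.
  have e1 : d%:R * cc = x / 2 by rewrite /cc; field; lra.
  have e2 : G s / cc ^+ 3 = (x / 2) * (16 * d%:R ^+ 3 / x ^+ 4 * G s).
    by rewrite /cc; field; lra.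
  rewrite e1 e2 in h.
  have x2 : 0 < x / 2 by rewrite divr_gt0.
  have : x / 2 * 1 <= x / 2 * (16 * d%:R ^+ 3 / x ^+ 4 * G s) by lra.
  by rewrite ler_pM2l.
rewrite bEZ// (bE_drift_sum (psi := fun y => y ^+ 4)) ?(ltnW dn)//; last first.
  by move=> b s qs /=; rewrite ltnNge qs.
apply: (@le_trans _ _ (16 * d%:R ^+ 3 / x ^+ 4 *
    (\sum_(q0 <= q < q0 + d) 4 * bias_const alpha ^+ 4 / kk ^+ 2))).
  rewrite ler_wpM2l//; first by rewrite divr_ge0 ?(ltW x4)// mulr_ge0// exprn_ge0.
  apply: ler_sum_nat => q /andP[_ qd].
  have qn : (q < n.*2)%N by exact: ltn_trans dn.
  apply: (le_trans (bE_bbias_pow4 alpha_gt1 qn)).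
  rewrite ler_wpM2l ?mulr_ge0 ?exprn_ge0 ?(ltW (bias_const_gt0 alpha_gt1))//.
  rewrite lef_pV2 ?posrE ?exprn_gt0 ?ltr0n ?subn_gt0//.
  by rewrite lerXn2r ?nnegrE ?(ltW kk0)// ler_nat leq_sub2l// ltnW.
rewrite sumr_const_nat addKn -mulr_natr le_eqVlt; apply/orP; left; apply/eqP.
by field; lra.
Qed.

Lemma bE_stopped_tail d : (q0 + d <= n.*2)%N -> 0 < x ->
  bE (q0 + d) (fun s => (x <= `|stopped s|)%R%:R) <= 11 * d%:R ^+ 2 / x ^+ 4.
Proof.
move=> dn x0; have x4 : 0 < x ^+ 4 by rewrite exprn_gt0.
apply: (@le_trans _ _ (bE (q0 + d) (fun s => x ^- 4 * stopped s ^+ 4))).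
  apply: bE_le => // s _ _.
  have s4 : stopped s ^+ 4 = `|stopped s| ^+ 4.
    by rewrite -[4%N]/(2 * 2)%N !exprM real_normK ?num_real.
  rewrite s4; case: (boolP (x <= `|stopped s|)) => h; last first.
    by rewrite mulr_ge0 ?invr_ge0 ?(ltW x4)// exprn_ge0.
  by rewrite mulrC ler_pdivlMr// mul1r lerXn2r ?nnegrE ?(ltW x0).
by rewrite bEZ// mulrC ler_wpM2r ?invr_ge0 ?(ltW x4)// bE_stopped_pow4.
Qed.

End BlockOscillation.

Lemma maxn_subC (c a b : nat) : (a <= b)%N -> (maxn c b <= maxn c a + (b - a))%N.
Proof. lia. Qed.

(** * Tightness: comparison of a path with its values on a grid *)

Section Tightness.
Variables (R : realType) (alpha : R).
Hypothesis alpha_gt1 : 1 < alpha.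

Definition grid_path (m : nat) (x : R -> R) (t : R) : R :=
  x ((Num.truncn (m%:R * t))%:R / m%:R).

Let clevel n (t : R) := maxn 2 (level n t).

Section Block.
Variables (n m : nat) (eta : R).
Hypotheses (m0 : (0 < m)%N) (mn : (m < n)%N) (eta0 : 0 < eta).

(** A quarter of the allowed oscillation: a point and the left grid point are both compared with the
    right end of the block, where it starts in backward time, and each comparison costs x for the
    martingale part and x for the drift. *)
Let x : R := eta * Num.sqrt n%:R / 4.
Let n0 : (0 < n)%N. Proof. exact: leq_trans m0 (ltnW mn). Qed.
Let nR : 0 < n%:R :> R. Proof. by rewrite ltr0n. Qed.
Let mR : 0 < m%:R :> R. Proof. by rewrite ltr0n. Qed.
Let mnR : m%:R <= n%:R :> R. Proof. by rewrite ler_nat ltnW. Qed.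
Let x0 : 0 < x. Proof. by rewrite /x divr_gt0// mulr_gt0// sqrtr_gt0. Qed.

Let lo (i : nat) := clevel n (i%:R / m%:R).
Let d (i : nat) := (lo i.+1 - lo i)%N.
Let q (i : nat) := (n.*2 - lo i)%N.

Let bad (i : nat) (s : seq bool) : bool :=
  (x <= `|stopped alpha n (q i.+1) x s|) || (x <= drift alpha n (q i.+1) s).

Let gridS i : i%:R / m%:R <= i.+1%:R / m%:R :> R.
Proof. by rewrite ler_wpM2r ?invr_ge0// ler_nat. Qed.

Let grid1 i : (i < m)%N -> i.+1%:R / m%:R <= 1 :> R.
Proof. by move=> im; rewrite ler_pdivrMr// mul1r ler_nat. Qed.

Let n2 : (2 <= n.*2)%N.
Proof. by rewrite -[2%N]/(1.*2) leq_double. Qed.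

Let lo_le i : (i <= m)%N -> (lo i <= n.*2)%N.
Proof.
move=> im; rewrite /lo /clevel geq_max n2/= level_le//.
by rewrite ler_pdivrMr// mul1r ler_nat.
Qed.

Let loS i : (lo i <= lo i.+1)%N.
Proof.
rewrite /lo /clevel geq_max leq_maxl/=.
by apply: leq_trans (leq_maxr _ _); apply: le_level.
Qed.

Let qd i : (i < m)%N -> (q i.+1 + d i = q i)%N.
Proof.
move=> im; rewrite /q /d; have h1 := lo_le im; have h2 := loS i.
by rewrite addnBA// subnK.
Qed.

(** Width 2n/m plus at most 1 for rounding, and 1 <= n/m. *)
Let d_le i : (d i)%:R <= 3 * (n%:R / m%:R) :> R.
Proof.
have h2 := loS i.
have : (lo i.+1 <= lo i + (level n (i.+1%:R / m%:R : R) - level n (i%:R / m%:R : R)))%N.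
  by rewrite /lo /clevel maxn_subC// le_level.
rewrite -leq_subLR -/(d i) -(ler_nat R) => /le_trans; apply.
rewrite natrB ?le_level//.
have g0 : 0 <= i%:R / m%:R :> R by rewrite divr_ge0.
have g1 : 0 <= i.+1%:R / m%:R :> R by rewrite divr_ge0.
have := @level_ge R n _ g0.
have : (level n (i.+1%:R / m%:R : R))%:R <= n.*2%:R * (i.+1%:R / m%:R) :> R.
  by rewrite truncn_le mulr_ge0.
have -> : i.+1%:R / m%:R = i%:R / m%:R + m%:R^-1 :> R by rewrite -natr1 mulrDl mul1r.
rewrite mulrDr -muln2 natrM.
have : 1 <= n%:R / m%:R :> R by rewrite ler_pdivlMr// mul1r.
lra.
Qed.

Let q_lt i : (i < m)%N -> (q i < n.*2)%N.
Proof.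
by move=> im; rewrite /q ltn_subrL (leq_trans _ n2)// /lo /clevel (leq_trans _ (leq_maxl _ _)).
Qed.

Let q_le2 i : (q i <= n.*2 - 2)%N.
Proof. by rewrite /q leq_sub2l// /lo /clevel leq_maxl. Qed.

Let lo_ge i : (0 < i)%N -> n%:R / m%:R <= (lo i)%:R :> R.
Proof.
move=> i0; apply: (@le_trans _ _ (level n (i%:R / m%:R : R))%:R); last first.
  by rewrite ler_nat /lo /clevel leq_maxr.
have g0 : 0 <= i%:R / m%:R :> R by rewrite divr_ge0.
apply: le_trans (level_ge n g0); rewrite -muln2 natrM.
have h1 : 1 <= n%:R / m%:R :> R by rewrite ler_pdivlMr// mul1r.
have : n%:R / m%:R <= n%:R * (i%:R / m%:R) :> R.
  by rewrite ler_wpM2l// -[leLHS]mul1r ler_wpM2r ?invr_ge0// ler1n.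
lra.
Qed.

Let x4 : x ^+ 4 = eta ^+ 4 * n%:R ^+ 2 / 4 ^+ 4.
Proof.
have nE : n%:R = Num.sqrt n%:R ^+ 2 :> R by rewrite sqr_sqrtr// ltW.
by rewrite /x [in RHS]nE; field.
Qed.

(** In [C1] and [C2] the powers of 3 come from the block length 3n/m and the powers of 4 from [x].
    In [C3], 16 is 4 from 1/x, 2 from [bE_drift_le] and 2 from the square root of lo 1 <= 4n/m. *)
Let C1 : R := 11 * 3 ^+ 2 * 4 ^+ 4 / eta ^+ 4.
Let C2 : R := 64 * bias_const alpha ^+ 4 * 3 ^+ 4 * 4 ^+ 4 / eta ^+ 4.
Let C2_ge0 : 0 <= C2.
Proof.
have e4 : 0 <= eta ^+ 4 by rewrite exprn_ge0// ltW.
have b4 : 0 <= bias_const alpha ^+ 4 by rewrite exprn_ge0// ltW// bias_const_gt0.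
rewrite /C2; apply: divr_ge0 => //; apply: mulr_ge0; last by rewrite exprn_ge0.
by apply: mulr_ge0; [rewrite mulr_ge0|rewrite exprn_ge0].
Qed.

Let C3 : R := (1 + bias_const alpha ^+ 2) * 16 / eta.

Let P_stopped i : (i < m)%N ->
  bE alpha n (q i) (fun s => (x <= `|stopped alpha n (q i.+1) x s|)%R%:R) <= C1 / m%:R ^+ 2.
Proof.
move=> im; rewrite -(qd im).
apply: (le_trans (@bE_stopped_tail R alpha alpha_gt1 n (q i.+1) x (d i) _ x0)).
  by rewrite (qd im) ltnW// q_lt.
rewrite x4 /C1.
apply: (@le_trans _ _ (11 * (3 * (n%:R / m%:R)) ^+ 2 / (eta ^+ 4 * n%:R ^+ 2 / 4 ^+ 4))).
  rewrite ler_wpM2r ?invr_ge0 ?divr_ge0 ?mulr_ge0 ?exprn_ge0 ?(ltW eta0)//.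
  rewrite ler_wpM2l// lerXn2r ?nnegrE ?mulr_ge0 ?divr_ge0//; exact: d_le.
rewrite le_eqVlt; apply/orP; left; apply/eqP.
by field; rewrite !gt_eqF.
Qed.

Let P_drift i : (0 < i)%N -> (i < m)%N ->
  bE alpha n (q i) (fun s => (x <= drift alpha n (q i.+1) s)%R%:R) <= C2 / m%:R ^+ 2.
Proof.
move=> i0 im.
have [dz|dp] := posnP (d i).
  have qq : q i = q i.+1 by rewrite -(qd im) dz addn0.
  apply: (@le_trans _ _ (bE alpha n (q i) (fun=> 0))); last first.
    rewrite bE_cst//; last by rewrite ltnW// q_lt.
    by rewrite divr_ge0 ?sqr_ge0.
  apply: bE_le => // s sq _; rewrite drift_early ?sq ?qq//.
  by rewrite (lt_geF x0).
rewrite -(qd im).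
apply: (le_trans (@bE_drift_tail R alpha alpha_gt1 n (q i.+1) x (d i) dp _ x0)).
  by rewrite (qd im) q_lt.
rewrite (qd im) x4 /q subKn ?lo_le ?(ltnW im)//.
set B := bias_const alpha; have B0 : 0 < B by exact: bias_const_gt0.
have lop : 0 < (lo i)%:R :> R by apply: lt_le_trans (lo_ge i0); rewrite divr_gt0.
apply: (@le_trans _ _ (64 * B ^+ 4 * (3 * (n%:R / m%:R)) ^+ 4 /
    ((n%:R / m%:R) ^+ 2 * (eta ^+ 4 * n%:R ^+ 2 / 4 ^+ 4)))).
  apply: ler_pM.
  - by rewrite !mulr_ge0// ?exprn_ge0// ltW.
  - by rewrite invr_ge0 !mulr_ge0 ?exprn_ge0 ?(ltW eta0)// ?(ltW lop).
  - rewrite ler_wpM2l ?mulr_ge0 ?exprn_ge0 ?(ltW B0)// lerXn2r ?nnegrE ?mulr_ge0 ?divr_ge0 ?d_le//.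
  have p1 : 0 < (n%:R / m%:R) ^+ 2 :> R by rewrite exprn_gt0// divr_gt0.
  have p2 : 0 < eta ^+ 4 * n%:R ^+ 2 / 4 ^+ 4 by rewrite divr_gt0 ?mulr_gt0 ?exprn_gt0.
  have p3 : 0 < (lo i)%:R ^+ 2 :> R by rewrite exprn_gt0.
  rewrite lef_pV2 ?posrE ?(mulr_gt0 p3 p2) ?(mulr_gt0 p1 p2)//.
  rewrite ler_wpM2r ?divr_ge0 ?mulr_ge0 ?exprn_ge0 ?(ltW eta0)//.
  by rewrite lerXn2r ?nnegrE ?divr_ge0// lo_ge.
rewrite /C2 -/B le_eqVlt; apply/orP; left; apply/eqP.
by field; rewrite !gt_eqF.
Qed.

(** The lowest block ends at level 2, where the fourth-moment bound is useless. Markov's inequality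
    with the first moment, of order sqrt(n/m), suffices since it is used only once. *)
Let P_drift0 :
  bE alpha n (q 0) (fun s => (x <= drift alpha n (q 1) s)%R%:R) <= C3 / Num.sqrt m%:R.
Proof.
rewrite -(qd m0).
apply: (@le_trans _ _ (bE alpha n (q 1 + d 0) (fun s => x^-1 * drift alpha n (q 1) s))).
  apply: bE_le => // s _ _.
  case: (boolP (x <= _)%R) => h; last by rewrite mulr_ge0 ?invr_ge0 ?(ltW x0)// drift_ge0.
  by rewrite mulrC ler_pdivlMr// mul1r.
rewrite bEZ//; have qdn : (q 1 + d 0 < n.*2)%N by rewrite (qd m0) q_lt.
apply: (@le_trans _ _ (x^-1 * ((1 + bias_const alpha ^+ 2) * (2 * Num.sqrt (n.*2 - q 1)%:R)))).
  by rewrite ler_wpM2l ?invr_ge0 ?(ltW x0)// bE_drift_le.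
rewrite /q subKn; last by rewrite lo_le.
have hlo : (lo 1)%:R <= 4 * (n%:R / m%:R) :> R.
  have nm1 : 1 <= n%:R / m%:R :> R by rewrite ler_pdivlMr// mul1r.
  rewrite /lo /clevel natr_max ge_max; apply/andP; split; first lra.
    have g1 : 0 <= 1%:R / m%:R :> R by rewrite divr_ge0.
    have : (level n (1%:R / m%:R : R))%:R <= n.*2%:R * (1%:R / m%:R) :> R.
      by rewrite truncn_le mulr_ge0.
    have : 0 <= n%:R / m%:R :> R by rewrite divr_ge0.
    rewrite -muln2 natrM; lra.
have sm0 : 0 < Num.sqrt m%:R :> R by rewrite sqrtr_gt0.
have sn0 : 0 < Num.sqrt n%:R :> R by rewrite sqrtr_gt0.
have hs : Num.sqrt (lo 1)%:R <= 2 * (Num.sqrt n%:R / Num.sqrt m%:R) :> R.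
  rewrite -(ler_pXn2r (n := 2)) ?nnegrE ?sqrtr_ge0 ?mulr_ge0 ?divr_ge0 ?sqrtr_ge0//.
  by rewrite sqr_sqrtr// exprMn expr_div_n !sqr_sqrtr// (_ : 2 ^+ 2 = 4)//; ring.
apply: (@le_trans _ _ (x^-1 * ((1 + bias_const alpha ^+ 2) * (2 * (2 * (Num.sqrt n%:R / Num.sqrt m%:R)))))).
  rewrite ler_wpM2l ?invr_ge0 ?(ltW x0)// ler_wpM2l ?addr_ge0 ?sqr_ge0// ler_wpM2l//.
rewrite /x /C3 le_eqVlt; apply/orP; left; apply/eqP.
by field; rewrite !gt_eqF.
Qed.

Definition bad_path (s : seq bool) : bool :=
  has (fun i => bad i (drop (n.*2 - 2 - q i) s)) (iota 0 m).

Definition osc_bound : R := (C1 + C2) / m%:R + C3 / Num.sqrt m%:R.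

(** A union bound over m blocks of order m^-2 each, plus m^(-1/2) for the lowest one. The bound does
    not involve n. *)
Lemma cE_bad_path : cE alpha n (fun s => (bad_path s)%:R) <= osc_bound / hit_lower alpha.
Proof.
apply: (@le_trans _ _ (\sum_(i < m)
   cE alpha n (fun s => ((bad i (drop (n.*2 - 2 - q i) s))%:R : R)))).
  have sumE (F : 'I_m -> seq bool -> R) :
      \sum_(i < m) cE alpha n (F i) = cE alpha n (fun s => \sum_(i < m) F i s).
    rewrite /cE -big_distrl/= -bE_sum//; congr (_ / _).
    by apply: bE_eq => // s _ _; rewrite big_distrl.
  rewrite (sumE (fun i s => (bad i (drop (n.*2 - 2 - q i) s))%:R)).
  apply: cE_le => // s _ _.
  rewrite /bad_path; case: hasP => [[i]|_]; last exact: sumr_ge0.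
  rewrite mem_iota add0n /= => im bi; rewrite (bigD1 (Ordinal im))//= bi lerDl.
  exact: sumr_ge0.
have hl := hit_lower_gt0 alpha.
have step (i : 'I_m) : cE alpha n (fun s => ((bad i (drop (n.*2 - 2 - q i) s))%:R : R)) <=
    (C1 / m%:R ^+ 2 + C2 / m%:R ^+ 2 + (if i == 0%N :> nat then C3 / Num.sqrt m%:R else 0))
     / hit_lower alpha.
  apply: (le_trans (@cE_drop_le R alpha alpha_gt1 n n0 (fun s => (bad i s)%:R) (q i) (q_le2 i) _)).
    by move=> s _; exact: ler0n.
  rewrite ler_wpM2r ?invr_ge0 ?(ltW hl)//.
  apply: (@le_trans _ _ (bE alpha n (q i) (fun s => (x <= `|stopped alpha n (q i.+1) x s|)%R%:R +
      (x <= drift alpha n (q i.+1) s)%R%:R))).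
    apply: bE_le => // s _ _; rewrite /bad.
    by move: (x <= `|stopped alpha n (q i.+1) x s|)%R (x <= drift alpha n (q i.+1) s)%R => [] [] /=; lra.
  rewrite bED// -addrA; apply: lerD; first exact: P_stopped.
  have [i0|i0] := eqVneq (i : nat) 0%N.
    rewrite i0; apply: (le_trans P_drift0); by rewrite lerDr divr_ge0 ?sqr_ge0.
  by rewrite addr0 P_drift// lt0n.
apply: (le_trans (ler_sum _ (fun i _ => step i))).
rewrite -big_distrl/= ler_wpM2r ?invr_ge0 ?(ltW hl)//.
rewrite big_split/= sumr_const card_ord -(mulr_natr (C1 / _ + _)).
rewrite -big_mkcond/= (bigD1 (Ordinal m0))//= big1 ?addr0; last first.
  by move=> i /andP[/eqP h1]; rewrite -val_eqE/= h1.
rewrite /osc_bound; apply: lerD => //; rewrite le_eqVlt; apply/orP; left; apply/eqP.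
by field; rewrite !gt_eqF.
Qed.

Lemma bad_path_osc s : size s = (n.*2 - 2)%N -> end11 R n s != 0 -> ~~ bad_path s ->
  forall t, 0 <= t <= 1 ->
  `|scaled_path n s t - grid_path m (scaled_path n s) t| <= eta.
Proof.
move=> sn e1 /hasPn ok t /andP[t0 t1].
rewrite /grid_path /scaled_path -mulrBr normrM.
have sn0 : 0 < Num.sqrt n%:R :> R by rewrite sqrtr_gt0.
rewrite ger0_norm ?invr_ge0 ?(ltW sn0)// mulrC ler_pdivrMr//.
set i := Num.truncn (m%:R * t).
have mt0 : 0 <= m%:R * t by rewrite mulr_ge0.
have /andP[i1 i2] := truncn_itv mt0; rewrite -/i in i1 i2.
have [im|mi] := ltnP i m; last first.
  (* Only t = 1 lies beyond the last block, and it is itself a grid point. *)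
  have it : i%:R / m%:R = t.
    apply/eqP; rewrite eq_le ler_pdivrMr// (mulrC t) i1/= ler_pdivlMr//.
    by rewrite (le_trans _ (_ : m%:R <= i%:R))// ?ler_nat// -[leRHS]mul1r ler_wpM2r.
  by rewrite it subrr normr0 mulr_ge0// ltW.
have gi : i%:R / m%:R <= t by rewrite ler_pdivrMr// mulrC.
have gi1 : t <= i.+1%:R / m%:R by rewrite ler_pdivlMr// mulrC ltW.
have lt2 : (level n t <= n.*2)%N by exact: level_le.
have gl : (level n (i%:R / m%:R : R) <= n.*2)%N by apply: level_le; exact: le_trans gi t1.
rewrite (Delta_bD alpha_gt1 n0 sn e1 lt2) (Delta_bD alpha_gt1 n0 sn e1 gl).
rewrite -/(level n t) -/(level n (i%:R / m%:R)) -/(clevel n t) -/(clevel n (i%:R / m%:R)) -/(lo i).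
have := ok i; rewrite mem_iota add0n im => /(_ isT).
rewrite /bad negb_or -!ltNge => /andP[h1 h2].
set u := drop (n.*2 - 2 - q i) s in h1 h2.
have su : size u = q i.
  by rewrite /u size_drop sn subKn// q_le2.
have lo1 : (lo i <= clevel n t)%N.
  by rewrite /lo /clevel geq_max leq_maxl/= (leq_trans _ (leq_maxr _ _))// le_level.
have lo2 : (clevel n t <= lo i.+1)%N.
  by rewrite /lo /clevel geq_max leq_maxl/= (leq_trans _ (leq_maxr _ _))// le_level.
have lon := lo_le im.
have osc p : (lo i <= p)%N -> (p <= lo i.+1)%N ->
   `|bD R n (drop (p - 2) s) - bD R n (drop (lo i.+1 - 2) s)| <= x + x.
  move=> p1 p2.
  have e2 : (2 <= lo i)%N by rewrite /lo /clevel leq_maxl.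
  have H := @stopped_osc R alpha n (q i.+1) x u (n.*2 - p) _ _ h1.
  have H' := H (leq_sub2l _ p2) _; rewrite su in H'.
  have {H H'} := H' (leq_sub2l _ p1).
  rewrite /u !drop_drop /q.
  have -> : (n.*2 - lo i - (n.*2 - p) + (n.*2 - 2 - (n.*2 - lo i)) = p - 2)%N.
    by clear -p1 p2 e2 lon; lia.
  have -> : (n.*2 - lo i - (n.*2 - lo i.+1) + (n.*2 - 2 - (n.*2 - lo i)) = lo i.+1 - 2)%N.
    by have := leq_trans p1 p2; clear -e2 lon; move: (lo i) (lo i.+1) e2 lon => a b; lia.
  by move=> h; apply: (le_trans h); rewrite lerD2l ltW.
have o1 := osc _ lo1 lo2; have o2 := osc _ (leqnn _) (loS i).
rewrite distrC in o2.
set A := bD R n _ in o1 *; set B := bD R n (drop (lo i - 2) s) in o2 *.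
set Z := bD R n _ in o1 o2.
have -> : A - B = (A - Z) + (Z - B) by ring.
rewrite (le_trans (ler_normD _ _))//.
by rewrite (_ : eta * _ = (x + x) + (x + x)) ?lerD//; rewrite /x; field.
Qed.

End Block.

Lemma cvg_osc_bound (eta : R) : osc_bound m eta @[m --> \oo] --> (0 : R).
Proof.
rewrite /osc_bound -[0]addr0; apply: cvgD.
  rewrite -[X in _ --> X](mulr0 (11 * 3 ^+ 2 * 4 ^+ 4 / eta ^+ 4 + 64 * bias_const alpha ^+ 4 * 3 ^+ 4 * 4 ^+ 4 / eta ^+ 4)).
  apply: cvgM; first exact: cvg_cst.
  by apply: (@cvgn_inv_ge R 1) => //; near=> n; rewrite mul1r.
rewrite -[X in _ --> X](mulr0 ((1 + bias_const alpha ^+ 2) * 16 / eta)).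
by apply: cvgM; [exact: cvg_cst|exact: cvgn_inv_sqrt].
Unshelve. all: by end_near. Qed.

End Tightness.

(** * Approximation of Lipschitz functions by trigonometric polynomials *)

Section TrigApproximation.
Variable R : realType.
Implicit Types (x y : nat -> R) (f g : (nat -> R) -> R).

(** The phase [b] supplies the sines, so the product-to-sum formula makes this span an algebra.
    Coordinates are indexed by all naturals so that m can vary in an induction. *)
Inductive trigp (m : nat) : ((nat -> R) -> R) -> Prop :=
| trigp_cos (b : R) (c : 'I_m -> R) : trigp m (fun x => cos (b + \sum_(i < m) c i * x i))
| trigp_add f g : trigp m f -> trigp m g -> trigp m (fun x => f x + g x)
| trigp_scale (a : R) f : trigp m f -> trigp m (fun x => a * f x).

Lemma trigp_ext m f g : f =1 g -> trigp m f -> trigp m g.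
Proof. by move=> /funext ->. Qed.

Lemma trigp_cst m (a : R) : trigp m (fun=> a).
Proof.
apply: trigp_ext (trigp_scale a (trigp_cos 0 (fun=> 0 : R))) => x /=.
by rewrite big1 ?addr0 ?cos0 ?mulr1// => i _; rewrite mul0r.
Qed.

Let trigp_mul_cos m b c g : trigp m g ->
  trigp m (fun x => cos (b + \sum_(i < m) c i * x i) * g x).
Proof.
elim => [b' c'|f1 f2 _ h1 _ h2|a f _ h].
- apply: trigp_ext (trigp_add
    (trigp_scale 2^-1 (trigp_cos (b + b') (fun i => c i + c' i)))
    (trigp_scale 2^-1 (trigp_cos (b - b') (fun i => c i - c' i)))) => x /=.
  set u := b + \sum_(i < m) c i * x i; set v := b' + _.
  have -> : b + b' + \sum_(i < m) (c i + c' i) * x i = u + v.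
    under eq_bigr do rewrite mulrDl.
    by rewrite big_split/= /u /v; ring.
  have -> : b - b' + \sum_(i < m) (c i - c' i) * x i = u - v.
    under eq_bigr do rewrite mulrBl.
    by rewrite sumrB /u /v; ring.
  by rewrite cosD cosB; field.
- by apply: trigp_ext (trigp_add h1 h2) => x /=; rewrite mulrDr.
- by apply: trigp_ext (trigp_scale a h) => x /=; rewrite mulrCA.
Qed.

Lemma trigp_mul m f g : trigp m f -> trigp m g -> trigp m (fun x => f x * g x).
Proof.
move=> tf tg; elim: tf => [b c|f1 f2 _ h1 _ h2|a f1 _ h].
- exact: trigp_mul_cos.
- by apply: trigp_ext (trigp_add h1 h2) => x /=; rewrite mulrDl.
- by apply: trigp_ext (trigp_scale a h) => x /=; rewrite mulrA.
Qed.

Lemma trigp_widen m f : trigp m f -> trigp m.+1 f.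
Proof.
elim => [b c|f1 f2 _ h1 _ h2|a f1 _ h]; [|exact: trigp_add|exact: trigp_scale].
apply: trigp_ext (trigp_cos b (fun i : 'I_m.+1 => if unlift ord_max i is Some j then c j else 0)) => x /=.
rewrite big_ord_recr/= unlift_none mul0r addr0; congr (cos (_ + _)).
apply: eq_bigr => i _; have -> : widen_ord (leqnSn m) i = lift ord_max i.
  by apply: val_inj; rewrite /= /bump leqNgt ltn_ord.
by rewrite liftK.
Qed.

Lemma trigp_sin m (L : R) : trigp m.+1 (fun x => sin (x m / L)).
Proof.
apply: trigp_ext (trigp_cos (- (pi / 2)) (fun i : 'I_m.+1 => if i == ord_max then L^-1 else 0)) => x /=.
rewrite big_ord_recr/= eqxx big1 ?add0r; last first.
  move=> i _; have /negbTE -> : widen_ord (leqnSn m) i != ord_max.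
    by rewrite -val_eqE/= ltn_eqF.
  by rewrite mul0r.
by rewrite addrC mulrC cosBpihalf.
Qed.

(** The Bernstein polynomial, that is the mean of phi at a binomial (N, p) variable, by conditioning
    on one trial; binomial coefficients are avoided. *)
Fixpoint bern (N : nat) (phi : nat -> R) (p : R) : R :=
  if N is N'.+1 then p * bern N' (fun k => phi k.+1) p + (1 - p) * bern N' phi p
  else phi 0%N.

Lemma bern_le N phi psi p : 0 <= p <= 1 -> (forall k, phi k <= psi k) ->
  bern N phi p <= bern N psi p.
Proof.
move=> /andP[p0 p1]; elim: N phi psi => [|N IH] phi psi h //=.
by apply: lerD; apply: ler_wpM2l; rewrite ?subr_ge0// IH.
Qed.

Lemma bernD N phi psi p :
  bern N (fun k => phi k + psi k) p = bern N phi p + bern N psi p.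
Proof. by elim: N phi psi => [|N IH] phi psi //=; rewrite !IH; ring. Qed.

Lemma bernZ N a phi p : bern N (fun k => a * phi k) p = a * bern N phi p.
Proof. by elim: N phi => [|N IH] phi //=; rewrite !IH; ring. Qed.

Lemma bern_cst N a p : bern N (fun=> a) p = a.
Proof. by elim: N => [|N IH] //=; rewrite !IH; ring. Qed.

(** The centre c is free because the induction shifts it by 1; with c = N p the right-hand side is
    the binomial variance. *)
Lemma bern_var N (c : R) p :
  bern N (fun k => (k%:R - c) ^+ 2) p = (N%:R * p - c) ^+ 2 + N%:R * p * (1 - p).
Proof.
elim: N c => [|N IH] c /=; first by ring.
have -> : (fun k : nat => (k.+1%:R - c) ^+ 2) = (fun k : nat => (k%:R - (c - 1)) ^+ 2).
  by apply/funext => k; rewrite -natr1; ring.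
by rewrite !IH -natr1; ring.
Qed.

Lemma ler_norm_bern N phi p : 0 <= p <= 1 ->
  `|bern N phi p| <= bern N (fun k => `|phi k|) p.
Proof.
move=> p01; rewrite ler_norml; apply/andP; split; last by apply: bern_le => // k; rewrite ler_norm.
rewrite -mulN1r -bernZ; apply: bern_le => // k.
by rewrite mulN1r lerNnormlW.
Qed.

Lemma trigp_bern m N (phi : nat -> (nat -> R) -> R) (P : (nat -> R) -> R) :
  trigp m P -> (forall k, trigp m (phi k)) ->
  trigp m (fun x => bern N (fun k => phi k x) (P x)).
Proof.
move=> tP; elim: N phi => [|N IH] phi tphi /=; first exact: tphi.
apply: trigp_add; apply: trigp_mul => //; [exact: IH (fun k => phi k.+1) _| |exact: IH].
have tN := trigp_scale (-1) tP.
by apply: trigp_ext (trigp_add (trigp_cst m 1) tN) => x /=; rewrite mulN1r.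
Qed.

(** A trigonometric stand-in for the coordinate u: for large L, L sin(u/L) is close to u on a
    bounded range, while the value lies in [0, 1] for every u. [node] undoes this rescaling at the
    Bernstein points k/N. *)
Definition sin01 (L u : R) : R := (1 + sin (u / L)) / 2.

Lemma sin01_01 L u : 0 <= sin01 L u <= 1.
Proof.
have := sin_max (u / L); rewrite ler_norml /sin01 => /andP[h1 h2].
by apply/andP; split; lra.
Qed.

Definition node (L : R) (N k : nat) : R := L * (2 * k%:R / N%:R - 1).

Lemma bern_node (B e : R) : 0 <= B -> 0 < e ->
  exists L, exists N : nat, forall u, `|u| <= B ->
    bern N (fun k => `|node L N k - u|) (sin01 L u) <= e.
Proof.
move=> B0 e0.
(* Chosen so that |L sin(u/L) - u| <= B^3/L^2 <= B^3/L <= e/2. *)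
pose L := 1 + 2 * B ^+ 3 / e.
have B3 : 0 <= B ^+ 3 by rewrite exprn_ge0.
have L1 : 1 <= L by rewrite /L lerDl divr_ge0 ?mulr_ge0// ltW.
have L0 : 0 < L by exact: lt_le_trans L1.
pose N := (Num.truncn (4 * L ^+ 2 / e ^+ 2)).+1.
have N0 : 0 < N%:R :> R by rewrite ltr0n.
have NL : L ^+ 2 / (N%:R * e) <= e / 4.
  have : 4 * L ^+ 2 / e ^+ 2 < N%:R by exact: truncnS_gt.
  rewrite ltr_pdivrMr ?exprn_gt0// => h.
  by rewrite ler_pdivrMr ?mulr_gt0//; nra.
exists L, N => u uB; set p := sin01 L u.
have p01 := sin01_01 L u.
have hs : `|L * sin (u / L) - u| <= e / 2.
  have -> : L * sin (u / L) - u = L * (sin (u / L) - u / L) by field; lra.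
  rewrite normrM (gtr0_norm L0).
  apply: (@le_trans _ _ (L * `|u / L| ^+ 3)); first by rewrite ler_wpM2l ?norm_sinBid_le// ltW.
  rewrite normrM normfV (gtr0_norm L0).
  have -> : L * (`|u| / L) ^+ 3 = `|u| ^+ 3 / L ^+ 2 by field; lra.
  apply: (@le_trans _ _ (B ^+ 3 / L)).
    apply: ler_pM; rewrite ?exprn_ge0 ?invr_ge0 ?exprn_ge0 ?(ltW L0)//.
      by rewrite lerXn2r ?nnegrE.
    by rewrite lef_pV2 ?posrE ?exprn_gt0//; nra.
  rewrite ler_pdivrMr// /L mulrDr mulr1.
  have -> : e / 2 * (2 * B ^+ 3 / e) = B ^+ 3 by field; lra.
  by rewrite lerDr divr_ge0// ltW.
(* The deviation z of the node from its mean obeys |z| <= e/4 + z^2/e. The mean of z^2 is at most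
   L^2/N, and N was chosen to make its contribution at most e/4. *)
apply: (@le_trans _ _ (bern N (fun k => (e / 2 + e / 4) +
   4 * L ^+ 2 / (N%:R ^+ 2 * e) * (k%:R - N%:R * p) ^+ 2) p)).
  apply: bern_le => // k.
  have -> : node L N k - u = (2 * L / N%:R * (k%:R - N%:R * p)) + (L * sin (u / L) - u).
    by rewrite /node /p /sin01; field; lra.
  rewrite (le_trans (ler_normD _ _))// addrC -addrA lerD//.
  set z := 2 * L / N%:R * _.
  have -> : 4 * L ^+ 2 / (N%:R ^+ 2 * e) * (k%:R - N%:R * p) ^+ 2 = z ^+ 2 / e.
    by rewrite /z; field; lra.
  rewrite -(real_normK (num_real z)) -(ler_pM2l e0) mulrDr.
  have -> : e * (`|z| ^+ 2 / e) = `|z| ^+ 2 by field; lra.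
  by have := sqr_ge0 (e / 2 - `|z|); rewrite sqrrB; nra.
rewrite bernD bern_cst bernZ bern_var subrr expr0n add0r.
have -> : 4 * L ^+ 2 / (N%:R ^+ 2 * e) * (N%:R * p * (1 - p)) =
  L ^+ 2 / (N%:R * e) * (4 * (p * (1 - p))) by field; lra.
have pp : 4 * (p * (1 - p)) <= 1 by have := sqr_ge0 (2 * p - 1); nra.
have X0 : 0 <= L ^+ 2 / (N%:R * e) by rewrite divr_ge0 ?sqr_ge0// mulr_ge0// ltW.
have := ler_wpM2l X0 pp; rewrite mulr1; lra.
Qed.

Definition update (x : nat -> R) (m : nat) (v : R) : nat -> R :=
  fun i => if i == m then v else x i.

(** The case r = 0 makes h depend on the first m coordinates only. *)
Definition lipschitz_coord (m : nat) (K : R) (h : (nat -> R) -> R) : Prop :=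
  forall x y r, 0 <= r -> (forall i, (i < m)%N -> `|x i - y i| <= r) ->
    `|h x - h y| <= K * r.

Lemma trig_approx m (h : (nat -> R) -> R) (M K B e : R) :
  0 <= K -> 0 <= B -> 0 < e -> (forall x, `|h x| <= M) -> lipschitz_coord m K h ->
  exists p, [/\ trigp m p, forall x, `|p x| <= M &
    forall x, (forall i, (i < m)%N -> `|x i| <= B) -> `|p x - h x| <= e].
Proof.
move=> K0 B0; elim: m h e => [|m IH] h e e0 hM hK.
  exists (fun=> h (fun=> 0)); split => [|x|x _]; [exact: trigp_cst|exact: hM|].
  by rewrite (le_trans (hK _ x 0 _ _))// mulr0 ltW.
have e2 : 0 < e / 2 by rewrite divr_gt0.
(* K + 1 instead of K, as K may be 0. *)
have e3 : 0 < e / 2 / (K + 1) by rewrite divr_gt0// ltr_wpDl.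
have [L [N LN]] := bern_node B0 e3.
have hk k : exists p, [/\ trigp m p, forall x, `|p x| <= M &
    forall x, (forall i, (i < m)%N -> `|x i| <= B) -> `|p x - h (update x m (node L N k))| <= e / 2].
  apply: (IH (fun x => h (update x m (node L N k)))) => // x y r r0 xy.
  apply: hK => // i im; rewrite /update; case: eqP => [_|/eqP ne]; first by rewrite subrr normr0.
  by apply: xy; rewrite ltn_neqAle ne -ltnS.
have [p Hp] := choice hk.
exists (fun x => bern N (fun k => p k x) (sin01 L (x m))); split => [|x|x xB].
- apply: trigp_bern => [|k]; last by have [h1 _ _] := Hp k; exact: trigp_widen.
  apply: trigp_ext (trigp_scale 2^-1 (trigp_add (trigp_cst m.+1 1) (trigp_sin m L))) => x /=.
  by rewrite /sin01 mulrC.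
- rewrite (le_trans (ler_norm_bern _ _ (sin01_01 _ _)))// -[leRHS](bern_cst N M (sin01 L (x m))).
  by apply: bern_le => [|k]; [exact: sin01_01|have [_ h2 _] := Hp k].
have -> : bern N (fun k => p k x) (sin01 L (x m)) - h x =
    bern N (fun k => p k x - h x) (sin01 L (x m)).
  by rewrite bernD bern_cst.
rewrite (le_trans (ler_norm_bern _ _ (sin01_01 _ _)))//.
apply: (@le_trans _ _ (bern N (fun k => e / 2 + K * `|node L N k - x m|) (sin01 L (x m)))).
  apply: bern_le => [|k]; first exact: sin01_01.
  have [_ _ h3] := Hp k.
  have -> : p k x - h x = (p k x - h (update x m (node L N k))) + (h (update x m (node L N k)) - h x) by ring.
  rewrite (le_trans (ler_normD _ _))//; apply: lerD.
    by apply: h3 => i im; apply: xB; exact: ltnW.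
  apply: hK => // i im; rewrite /update; case: eqP => [->//|_].
  by rewrite subrr normr0.
rewrite bernD bern_cst bernZ.
have := LN (x m) (xB _ (leqnn _)); set X := bern _ _ _ => hX.
have := ler_wpM2l K0 hX.
have : K * (e / 2 / (K + 1)) <= e / 2.
  by rewrite mulrCA ger_pMr// ler_pdivrMr ?ltr_wpDl// mul1r lerDl.
lra.
Qed.

End TrigApproximation.

(** * The characteristic function of a centred normal law *)

Section GaussianCharacteristic.
Variable R : realType.
Local Notation mu := (@lebesgue_measure R).

Section Truncated.
Variables (s b A : R).
Hypotheses (s0 : 0 < s) (A0 : 0 < A).

(** The factor exp(th^2 s^2/2) makes the integral of [f th] over the line independent of th.
    Comparing th = 1 with th = 0 gives the characteristic function. *)
Let E (th x : R) : R := expR (th ^+ 2 * s ^+ 2 / 2 - x ^+ 2 / (s ^+ 2 *+ 2)).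
Let f (th x : R) : R := cos (b + th * x) * E th x.
Let g (th x : R) : R := (th * s ^+ 2 * cos (b + th * x) - x * sin (b + th * x)) * E th x.
Let F (th x : R) : R := s ^+ 2 * (sin (b + th * x) * E th x).

Let s2 : s ^+ 2 *+ 2 != 0. Proof. by rewrite mulrn_eq0/= sqrf_eq0 gt_eqF. Qed.

Let f_th (th x : R) : is_derive th (1 : R) (fun t => f t x) (g th x).
Proof.
rewrite /f /g /E; apply: is_derive_eq; rewrite /GRing.scale/=.
by field.
Qed.

(* [g] is also a derivative in the space variable, so the derivative in [th] of
   the truncated integral is a boundary term. *)
Let F_x (th x : R) : is_derive x (1 : R) (F th) (g th x).
Proof.
rewrite /F /g /E; apply: is_derive_eq; rewrite /GRing.scale/=.
field.
by rewrite gt_eqF.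
Qed.

Let cont_of_derive (h : R -> R) (h' : R -> R) :
  (forall x : R, is_derive x (1 : R) h (h' x)) -> continuous h.
Proof.
by move=> H x; apply: differentiable_continuous; apply/derivable1_diffP; have [] := H x.
Qed.

Let cont_f th : continuous (f th).
Proof.
have H (x : R) : is_derive x (1 : R) (f th)
  (- (th * sin (b + th * x)) * E th x + cos (b + th * x) * (- (x / s ^+ 2) * E th x)).
  rewrite /f /E; apply: is_derive_eq; rewrite /GRing.scale/=.
  field.
  by rewrite gt_eqF.
exact: cont_of_derive H.
Qed.

Let cont_g th : continuous (g th).
Proof.
have H (x : R) : is_derive x (1 : R) (g th)
  ((- (th ^+ 2 * s ^+ 2 * sin (b + th * x)) - sin (b + th * x) - x * th * cos (b + th * x)) * E th x
   + (th * s ^+ 2 * cos (b + th * x) - x * sin (b + th * x)) * (- (x / s ^+ 2) * E th x)).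
  rewrite /g /E; apply: is_derive_eq; rewrite /GRing.scale/=.
  field.
  by rewrite gt_eqF.
exact: cont_of_derive H.
Qed.

Let int_cont (h : R -> R) : continuous h -> mu.-integrable `[- A, A] (EFin \o h).
Proof.
move=> ch; apply: continuous_compact_integrable; first exact: segment_compact.
exact: continuous_subspaceT.
Qed.

Definition gauss_trunc (th : R) : R := \int[mu]_(x in `[- A, A]) f th x.

(** An open range containing [0, 1], so that differentiation under the integral is available at both
    end points. *)
Let g_ub (th x : R) : -2 < th < 2 -> - A <= x <= A ->
  `|g th x| <= (2 * s ^+ 2 + A) * expR (2 * s ^+ 2).
Proof.
move=> /andP[t1 t2] /andP[x1 x2].
have th2 : `|th| <= 2 by rewrite ler_norml; lra.
have xA : `|x| <= A by rewrite ler_norml x1.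
have ss : 0 <= s ^+ 2 by exact: sqr_ge0.
rewrite /g normrM (ger0_norm (expR_ge0 _)); apply: ler_pM => //.
  rewrite (le_trans (ler_normB _ _))//; apply: lerD.
    rewrite normrM -[leRHS]mulr1; apply: ler_pM => //; last exact: cos_max.
    by rewrite normrM (ger0_norm ss) ler_wpM2r.
  by rewrite normrM -[leRHS]mulr1; apply: ler_pM => //; exact: sin_max.
rewrite ler_expR.
have : 0 <= x ^+ 2 / (s ^+ 2 *+ 2) by rewrite divr_ge0 ?sqr_ge0// mulrn_wge0.
have : th ^+ 2 <= 4.
  by rewrite -(real_normK (num_real th)) (_ : 4 = 2 ^+ 2)// ?lerXn2r ?nnegrE//; ring.
move=> h1 h2; have := ler_wpM2r ss h1; lra.
Qed.

Let d1f th x : partial1of2 f th x = g th x.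
Proof. by rewrite partial1of2E; have [_ ->] := f_th th x. Qed.

Let gauss_trunc_derive (th : R) : -2 < th < 2 ->
  is_derive th (1 : R) gauss_trunc (F th A - F th (- A)).
Proof.
move=> thI.
pose G (x : R) : R := (2 * s ^+ 2 + A) * expR (2 * s ^+ 2).
have G0 x : 0 <= G x.
  by rewrite /G mulr_ge0 ?expR_ge0// addr_ge0 ?mulr_ge0 ?sqr_ge0// ltW.
have Ia : [set` `](-2 : R), 2[] th by rewrite /= in_itv/=.
have h1 (x : R) : [set` `](-2 : R), 2[] x -> mu.-integrable `[- A, A] (EFin \o f x).
  by move=> _; apply: int_cont; exact: cont_f.
have h2 (x y : R) : [set` `](-2 : R), 2[] x -> `[- A, A]%classic y -> derivable (f ^~ y) x 1.
  by move=> _ _; have [] := f_th x y.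
have h3 : mu.-integrable `[- A, A] (EFin \o G).
  by apply: int_cont => x; exact: cvg_cst.
have h4 (x y : R) : [set` `](-2 : R), 2[] x -> `[- A, A]%classic y -> `|partial1of2 f x y| <= G y.
  by rewrite /= !in_itv/= => hx hy; rewrite d1f; exact: g_ub.
have mI : measurable `[- A, A]%classic by exact: measurable_itv.
have dJ : derivable gauss_trunc th 1.
  rewrite /gauss_trunc.
  exact: (@derivable_under_integral R _ _ mu f _ mI th _ _ Ia h1 h2 G G0 h3 h4).
apply: DeriveDef => //.
have := @differentiation_under_integral R _ _ mu f _ mI th _ _ Ia h1 h2 G G0 h3 h4.
rewrite derive1E => ->.
have AA : - A < A by rewrite gtrN.
have := @continuous_FTC2 R (g th) (F th) (- A) A AA.
rewrite /Rintegral => H.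
under eq_integral do rewrite d1f.
rewrite H ?fineK//.
- by apply: continuous_subspaceT; exact: cont_g.
- have cF := cont_of_derive (F_x th); split.
  + by move=> x _; have [] := F_x th x.
  + by apply: cvg_at_right_filter; exact: cF.
  + by apply: cvg_at_left_filter; exact: cF.
- by move=> x _; rewrite derive1E; have [_ ->] := F_x th x.
Qed.

Lemma gauss_trunc_diff :
  `|gauss_trunc 1 - gauss_trunc 0| <= 2 * s ^+ 2 * expR (s ^+ 2 / 2 - A ^+ 2 / (s ^+ 2 *+ 2)).
Proof.
have dJ (th : R) : th \in `]0, 1[ -> is_derive th (1 : R) gauss_trunc (F th A - F th (- A)).
  by rewrite in_itv/= => /andP[h1 h2]; apply: gauss_trunc_derive; apply/andP; split; lra.
have cJ : {within `[0, 1], continuous gauss_trunc}.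
  apply: derivable_within_continuous => th; rewrite in_itv/= => /andP[h1 h2].
  have thI : -2 < th < 2 by apply/andP; split; lra.
  by have [] := gauss_trunc_derive thI.
have [c] := @MVT R gauss_trunc _ 0 1 ltr01 dJ cJ.
rewrite in_itv/= subr0 mulr1 => /andP[c0 c1] ->.
rewrite (le_trans (ler_normB _ _))//.
have ss : 0 <= s ^+ 2 by exact: sqr_ge0.
have H (y : R) : y ^+ 2 = A ^+ 2 -> `|F c y| <= s ^+ 2 * expR (s ^+ 2 / 2 - A ^+ 2 / (s ^+ 2 *+ 2)).
  move=> yA; rewrite /F normrM (ger0_norm ss) ler_wpM2l// normrM -[leRHS]mul1r.
  apply: ler_pM => //; first exact: sin_max.
  rewrite ger0_norm ?expR_ge0// /E yA ler_expR lerD2r ler_wpM2r// ler_piMl//.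
  by rewrite expr_le1// ltW.
by have := H A erefl; have := H (- A) (sqrrN _); lra.
Qed.

Lemma gauss_truncE0 : gauss_trunc 0 =
  \int[mu]_(x in `[- A, A]) (cos b * expR (- x ^+ 2 / (s ^+ 2 *+ 2))).
Proof.
rewrite /gauss_trunc; apply: eq_Rintegral => x _.
by rewrite /f /E mul0r addr0 expr0n/= !mul0r add0r mulNr.
Qed.

Lemma gauss_truncE1 : gauss_trunc 1 =
  \int[mu]_(x in `[- A, A]) (expR (s ^+ 2 / 2) * cos (b + x) * expR (- x ^+ 2 / (s ^+ 2 *+ 2))).
Proof.
rewrite /gauss_trunc; apply: eq_Rintegral => x _.
by rewrite /f /E mul1r expr1n mul1r expRD mulNr; ring.
Qed.

End Truncated.

Section Limit.
Variables (s b : R).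
Hypothesis s0 : 0 < s.

Let sN0 : s != 0. Proof. by rewrite gt_eqF. Qed.

(** The integrand at th = 1 minus that at th = 0, normalised. Its integral is 0, being the limit of
    truncated ones that are bounded by a Gaussian tail. *)
Let D (x : R) : R := (expR (s ^+ 2 / 2) * cos (b + x) - cos b) * normal_pdf 0 s x.

Let mpdf : measurable_fun setT (normal_pdf 0 s : R -> R).
Proof. exact: measurable_normal_pdf. Qed.

Let mcos : measurable_fun setT (fun x : R => cos (b + x)).
Proof.
apply: (@measurableT_comp _ _ _ _ _ _ (@cos R)).
  by apply: continuous_measurable_fun; exact: continuous_cos.
exact: measurable_funD.
Qed.

Let int_bdd (h : R -> R) (M : R) : measurable_fun setT h -> (forall x, `|h x| <= M) ->
  mu.-integrable setT (EFin \o (fun x => h x * normal_pdf 0 s x)).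
Proof.
move=> mh hM; apply: (le_integrable measurableT _ _ (integrableZl measurableT M (integrable_normal_pdf 0 s))).
- by apply/measurable_EFinP; apply: measurable_funM.
- move=> x _; rewrite /= lee_fin normrM [leRHS]ger0_norm ?mulr_ge0 ?normal_pdf_ge0//; last first.
    exact: le_trans (hM x).
  by rewrite (ger0_norm (normal_pdf_ge0 _ _ _)) ler_wpM2r ?normal_pdf_ge0.
Qed.

Let mD : measurable_fun setT D.
Proof.
apply: measurable_funM => //; apply: measurable_funB => //.
exact: measurable_funM.
Qed.

Let intD : mu.-integrable setT (EFin \o D).
Proof.
apply: (@int_bdd _ (expR (s ^+ 2 / 2) + 1)).
  by apply: measurable_funB => //; exact: measurable_funM.
move=> x; rewrite (le_trans (ler_normB _ _))// lerD ?cos_max//.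
rewrite normrM ger0_norm ?expR_ge0// -[leRHS]mulr1 ler_wpM2l ?expR_ge0//.
exact: cos_max.
Qed.

Let I (n : nat) : set R := `[(- n.+1%:R : R), n.+1%:R]%classic.

Let mI n : measurable (I n). Proof. exact: measurable_itv. Qed.

Let cvg_trunc : (\int[mu]_(x in I n) (D x)%:E)%E @[n --> \oo] --> (\int[mu]_x (D x)%:E)%E.
Proof.
have -> : (fun n => \int[mu]_(x in I n) (D x)%:E)%E =
          (fun n => \int[mu]_x ((EFin \o D) \_ (I n)) x)%E.
  by apply/funext => n; rewrite integral_mkcond.
apply: (@dominated_cvg _ _ R mu setT measurableT _ _ (fun x => `|(D x)%:E|)%E) => //.
- move=> n; have /(measurable_restrictT _ (mI n)) := measurable_funTS (D := I n) ((measurable_EFinP _ _).2 mD).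
  exact.
- move=> x _; apply: cvg_near_cst; near=> n.
  have xn : `|x| <= n%:R by near: n; exact: nbhs_infty_ger.
  rewrite patchE ifT// inE /I/= in_itv/= -ler_norml (le_trans xn)// ler_nat.
  exact: leqnSn.
- by apply: integrable_abse.
- move=> n x _; rewrite patchE; case: ifP => // _.
  by have -> : point = 0%E :> \bar R by []; rewrite abse0 abse_ge0.
Unshelve. all: by end_near. Qed.

Let trunc_small n : (\int[mu]_(x in I n) (D x)%:E)%E =
  (normal_peak s * (gauss_trunc s b n.+1%:R 1 - gauss_trunc s b n.+1%:R 0))%:E.
Proof.
have n0 : 0 < n.+1%:R :> R by rewrite ltr0n.
have iD : mu.-integrable (I n) (EFin \o D) by apply: integrableS intD => //; exact: mI.
have fD : (\int[mu]_(x in I n) (D x)%:E)%E \is a fin_num.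
  by apply: integrable_fin_num iD; exact: mI.
rewrite -(fineK fD).
congr EFin; rewrite -/(Rintegral mu (I n) D) gauss_truncE0 gauss_truncE1.
have int1 (h : R -> R) : continuous h -> mu.-integrable (I n) (EFin \o h).
  move=> ch; apply: continuous_compact_integrable; first exact: segment_compact.
  exact: continuous_subspaceT.
have cE : continuous (fun x : R => expR (- x ^+ 2 / (s ^+ 2 *+ 2))).
  have := @continuous_normal_pdf R 0 s sN0; rewrite normal_pdfE// => h x.
  have := h x.
  have -> : (fun x : R => expR (- x ^+ 2 / (s ^+ 2 *+ 2))) =
    (fun x => (normal_peak s)^-1 * (normal_peak s * normal_fun 0 s x)).
    apply/funext => y; rewrite mulKf ?gt_eqF ?normal_peak_gt0// /normal_fun subr0 //.
  by move=> hx; apply: cvgM; [exact: cvg_cst|exact: hx].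
have cc : continuous (fun x : R => cos (b + x)).
  move=> x; apply: (@cvg_comp _ _ _ (fun x => b + x) cos); last exact: continuous_cos.
  by apply: cvgD; [exact: cvg_cst|exact: cvg_id].
rewrite -RintegralB//.
- rewrite -RintegralZl//.
    apply: eq_Rintegral => x _.
    by rewrite /D normal_pdfE// /normal_fun subr0; ring.
  apply: int1 => x; apply: cvgB; apply: cvgM; first apply: cvgM.
  + exact: cvg_cst.
  + exact: cc.
  + exact: cE.
  + exact: cvg_cst.
  + exact: cE.
- apply: int1 => x; apply: cvgM; last exact: cE.
  by apply: cvgM; [exact: cvg_cst|exact: cc].
- by apply: int1 => x; apply: cvgM; [exact: cvg_cst|exact: cE].
Qed.

Let int0 : (\int[mu]_x (D x)%:E = 0)%E.
Proof.
apply: (@cvg_unique _ (@ereal_hausdorff R) _ _ _ _ cvg_trunc) => /=.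
rewrite (_ : (fun n => _) = (fun n => (normal_peak s * (gauss_trunc s b n.+1%:R 1 - gauss_trunc s b n.+1%:R 0))%:E)); last first.
  by apply/funext => n; exact: trunc_small.
apply: cvg_EFin; first by near=> n.
have e0 : (expR (- (n.+1%:R ^+ 2 / (s ^+ 2 *+ 2)))) @[n --> \oo] --> (0 : R).
  have -> : (fun n : nat => expR (- (n.+1%:R ^+ 2 / (s ^+ 2 *+ 2)))) =
     (fun n : nat => (expR (n.+1%:R ^+ 2 / (s ^+ 2 *+ 2)))^-1 : R).
    by apply/funext => n; rewrite expRN.
  have s2 : 0 < s ^+ 2 *+ 2 by rewrite mulrn_wgt0// exprn_gt0.
  apply: (@cvgn_inv_ge R (s ^+ 2 *+ 2)^-1); first by rewrite invr_gt0.
  near=> n; apply: le_trans (expR_ge1Dx _).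
  rewrite mulrC (@le_trans _ _ (n.+1%:R ^+ 2 / (s ^+ 2 *+ 2)))//; last by rewrite lerDr.
  rewrite ler_wpM2r ?invr_ge0 ?(ltW s2)// (@le_trans _ _ n.+1%:R)// ?ler_nat//.
  by rewrite -[leLHS]mulr1 expr2 ler_wpM2l// ler1n.
apply: (@cvgn_close _ _ (cst 0) (fun n => normal_peak s *
   (2 * s ^+ 2 * expR (s ^+ 2 / 2)) * expR (- (n.+1%:R ^+ 2 / (s ^+ 2 *+ 2))))).
- near=> n; rewrite /cst subr0 normrM (ger0_norm (normal_peak_ge0 _)) -[leRHS]mulrA ler_wpM2l ?normal_peak_ge0//.
  by rewrite -[leRHS]mulrA -expRD; apply: gauss_trunc_diff.
- rewrite -[X in _ --> X](mulr0 (normal_peak s * (2 * s ^+ 2 * expR (s ^+ 2 / 2)))).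
  by apply: cvgM; [exact: cvg_cst|exact: e0].
- exact: cvg_cst.
Unshelve. all: by end_near. Qed.

Lemma integral_cos_normal_pdf :
  (\int[mu]_x (cos (b + x) * normal_pdf 0 s x)%:E = (expR (- (s ^+ 2 / 2)) * cos b)%:E)%E.
Proof.
have i1 : mu.-integrable setT (EFin \o (fun x => cos (b + x) * normal_pdf 0 s x)).
  by apply: (@int_bdd _ 1) => // x; exact: cos_max.
have := int0; rewrite /D.
under eq_integral do rewrite mulrBl -mulrA EFinB EFinM [X in (_ - X)%E]EFinM.
rewrite integralB//=; last 2 first.
- exact: integrableZl.
- by apply: integrableZl => //; exact: integrable_normal_pdf.
rewrite integralZl// integralZl//; last exact: integrable_normal_pdf.
rewrite integral_normal_pdf mule1.
have := integrable_fin_num measurableT i1; rewrite /=.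
move=> /fineK <-; set r := fine _; rewrite -EFinM -EFinB => -[h].
have e0 := expR_gt0 (s ^+ 2 / 2).
congr EFin; rewrite expRN; apply: (mulfI (lt0r_neq0 e0)).
by rewrite mulrA mulfV ?gt_eqF// mul1r; lra.
Qed.

End Limit.

(** Change of variables holds for the Radon-Nikodym derivative, which agrees almost everywhere with
    [normal_pdf] because both have the same integral over every measurable set. *)
Lemma integral_normal_prob (s : R) (h : R -> R) (M : R) :
  measurable_fun setT h -> (forall x, `|h x| <= M) ->
  (\int[normal_prob 0 s]_x (h x)%:E = \int[mu]_x (h x * normal_pdf 0 s x)%:E)%E.
Proof.
move=> mh hM.
have ih : (normal_prob 0 s).-integrable setT (EFin \o h).
  apply: measurable_bounded_integrable => //.
    by rewrite (le_lt_trans (probability_le1 _ measurableT))// ltry.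
  by exists M; split; [rewrite num_real|move=> r Mr x _; exact: le_trans (hM x) (ltW Mr)].
have dom := @normal_prob_dominates R 0 s.
under [RHS]eq_integral do rewrite EFinM.
rewrite -(Radon_Nikodym_change_of_variables dom)//=.
apply: ae_eq_integral => //.
- apply: emeasurable_funM; first exact/measurable_EFinP.
  apply: (measurable_int mu); apply: Radon_Nikodym_integrable; exact: dom.
- apply: emeasurable_funM; first exact/measurable_EFinP.
  by apply/measurable_EFinP; exact: measurable_normal_pdf.
apply: ae_eqe_mul2l => /=.
rewrite Radon_NikodymE/=.
case: cid => /= g [g1 g2 g3].
apply: integral_ae_eq => //=.
- by apply/measurable_EFinP; exact: measurable_normal_pdf.
- by move=> E _ mE; rewrite -g3.
Qed.

Lemma expectation_cos_normal d (T : measurableType d) (P : probability T R) (Y : T -> R) (v b : R) :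
  measurable_fun setT Y -> 0 <= v -> centered_normal P Y v ->
  ('E_P[fun w => cos (b + Y w)] = (expR (- (v / 2)) * cos b)%:E)%E.
Proof.
move=> mY v0 hY.
have mc : measurable_fun setT (fun x : R => cos (b + x)).
  apply: (@measurableT_comp _ _ _ _ _ _ (@cos R)).
    by apply: continuous_measurable_fun; exact: continuous_cos.
  exact: measurable_funD.
rewrite unlock.
have ic : P.-integrable setT (EFin \o (fun w => cos (b + Y w))).
  apply: measurable_bounded_integrable => //.
  - by rewrite (le_lt_trans (probability_le1 _ measurableT))// ltry.
  - exact: (measurableT_comp mc).
  by exists 1; split; [rewrite num_real|move=> r r1 x _; exact: le_trans (cos_max _) (ltW r1)].
have E := @integral_pushforward _ _ _ (g_sigma_algebraType (R.-ocitv.-measurable)) R Y mY P setT (fun x => (cos (b + x))%:E).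
rewrite preimage_setT in E.
rewrite -[LHS]E//; last exact/measurable_EFinP.
move: hY; rewrite /centered_normal; have [->|vn0] := eqVneq v 0 => hY.
  rewrite (eq_measure_integral (\d_(0 : g_sigma_algebraType (R.-ocitv.-measurable)))); last by move=> B mB _; exact: hY.
  rewrite integral_dirac//=; last exact/measurable_EFinP.
  by rewrite diracT mul1e mul0r oppr0 expR0 mul1r addr0.
have vp : 0 < v by rewrite lt_neqAle eq_sym vn0.
transitivity (\int[normal_prob 0 (Num.sqrt v)]_x (cos (b + x))%:E)%E.
  by apply: eq_measure_integral => B mB _; exact: hY.
rewrite (@integral_normal_prob _ _ 1)//; last by move=> x; exact: cos_max.
by rewrite integral_cos_normal_pdf ?sqrtr_gt0// sqr_sqrtr.
Qed.

End GaussianCharacteristic.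

(** * Exchange of limits *)

Section Approximation.
Variable R : realType.

Lemma cvgn_approx (u : nat -> R) (v : nat -> nat -> R) (l' del : nat -> R) (l : R) :
  (forall N, \forall n \near \oo, `|u n - v N n| <= del N) ->
  (forall N, v N @ \oo --> l' N) -> del @ \oo --> (0 : R) -> l' @ \oo --> l -> u @ \oo --> l.
Proof.
move=> uv vl del0 ll; apply/cvgrPdist_le => e e0.
have e3 : 0 < e / 3 by rewrite divr_gt0.
have [N1 _ H1] := cvgr_dist_le _ _ del0 _ e3.
have [N2 _ H2] := cvgr_dist_le _ _ ll _ e3.
pose N := maxn N1 N2.
have h1 := H1 N (leq_maxl _ _); have h2 := H2 N (leq_maxr _ _).
have h4 : \forall n \near \oo, `|l' N - v N n| <= e / 3 by exact: cvgr_dist_le _ _ (vl N) _ e3.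
have h3 := uv N.
near=> n.
have k3 : `|u n - v N n| <= del N by near: n.
have k4 : `|l' N - v N n| <= e / 3 by near: n.
move: h1; rewrite /= sub0r normrN => h1.
have := ler_norm (del N).
have -> : l - u n = (l - l' N) + (l' N - v N n) - (u n - v N n) by ring.
have := ler_normD (l - l' N) (l' N - v N n).
have := ler_normB (l - l' N + (l' N - v N n)) (u n - v N n).
move: h2 => /= h2; lra.
Unshelve. all: by end_near. Qed.

Lemma cvgn_sandwich (u : nat -> R) (a b : nat -> nat -> R) (A B : nat -> R) (l : R) :
  (forall k, \forall n \near \oo, a k n <= u n <= b k n) ->
  (forall k, a k @ \oo --> A k) -> (forall k, b k @ \oo --> B k) ->
  A @ \oo --> l -> B @ \oo --> l -> u @ \oo --> l.
Proof.
move=> ab aA bB Al Bl; apply/cvgrPdist_le => e e0.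
have e2 : 0 < e / 2 by rewrite divr_gt0.
have [N1 _ H1] := cvgr_dist_le _ _ Al _ e2.
have [N2 _ H2] := cvgr_dist_le _ _ Bl _ e2.
pose N := maxn N1 N2.
have := H1 N (leq_maxl _ _); have := H2 N (leq_maxr _ _).
rewrite /= !ler_norml => /andP[B1 B2] /andP[A1 A2].
have h3 : \forall n \near \oo, `|A N - a N n| <= e / 2 by exact: cvgr_dist_le _ _ (aA N) _ e2.
have h4 : \forall n \near \oo, `|B N - b N n| <= e / 2 by exact: cvgr_dist_le _ _ (bB N) _ e2.
have h5 := ab N.
near=> n.
have : `|A N - a N n| <= e / 2 by near: n.
have : `|B N - b N n| <= e / 2 by near: n.
have : a N n <= u n <= b N n by near: n.
rewrite !ler_norml => /andP[u1 u2] /andP[b1 b2] /andP[a1 a2].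
by apply/andP; split; lra.
Unshelve. all: by end_near. Qed.

End Approximation.

(** * Cadlag paths and the sup distance on [0, 1] *)

Section Paths.
Variable R : realType.
Implicit Types (x y : R -> R).

Definition sup_close (r : R) x y : Prop := forall t, 0 <= t <= 1 -> `|x t - y t| <= r.

Lemma sup_close_sym r x y : sup_close r x y -> sup_close r y x.
Proof. by move=> h t /h; rewrite distrC. Qed.

Lemma sup_close_trans r r' y x z :
  sup_close r x y -> sup_close r' y z -> sup_close (r + r') x z.
Proof. by move=> h h' t t01; rewrite (le_trans (ler_distD (y t) _ _))// lerD ?h ?h'. Qed.

(** Required for all functions, cadlag or not, so that g may be evaluated on arbitrary step
    functions of grid values. *)
Definition sup_lipschitz (K : R) (g : (R -> R) -> R) : Prop :=
  forall x y r, 0 <= r -> sup_close r x y -> `|g x - g y| <= K * r.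

(** By the identity time change. This is the only property of the Skorohod distance on which the
    argument rests. *)
Lemma skorohod_dist_le r x y : 0 <= r -> sup_close r x y -> skorohod_dist x y <= r.
Proof.
move=> r0 xy; apply: inf_lbound.
  exists 0 => e [l [_ /(_ 0 (lexx _) ler01)[h _]]].
  exact: le_trans h.
exists id; split.
  by split => //; apply: continuous_subspaceT => t; exact: cvg_id.
by move=> t t0 t1; rewrite subrr normr0; split => //; apply: xy; rewrite t0.
Qed.

Lemma continuous_cadlag01 x : {within `[0, 1], continuous x} -> cadlag01 x.
Proof.
move=> /(continuous_within_itvP _ ltr01)[xc x0 x1]; split => t t0 t1.
  have [->//|tn0] := eqVneq t 0.
  apply: cvg_at_right_filter; apply: xc; rewrite in_itv/= t1 andbT.
  by rewrite lt_neqAle eq_sym tn0.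
have [->|tn1] := eqVneq t 1; first by apply/cvg_ex; exists (x 1).
apply/cvg_ex; exists (x t); apply: cvg_at_left_filter; apply: xc.
by rewrite in_itv/= t0/= lt_neqAle tn1.
Qed.

Lemma cadlag01_cst (c : R) : cadlag01 (fun=> c).
Proof. by split => t _ _; [exact: cvg_cst|exact: is_cvg_cst]. Qed.

Lemma cadlag01_comp_truncn (c : R) (F : nat -> R) : 0 < c ->
  cadlag01 (fun t => F (Num.truncn (c * t))).
Proof.
move=> c0; split => t t0 _.
  apply: cvg_near_cst.
  have tc : t < (Num.truncn (c * t)).+1%:R / c.
    by rewrite ltr_pdivlMr// mulrC; exact: truncnS_gt.
  near=> u; congr F; apply/eqP.
  have tu : t < u by near: u; exact: nbhs_right_gt.
  have uc : u < (Num.truncn (c * t)).+1%:R / c by near: u; exact: nbhs_right_lt.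
  rewrite truncn_eq ?mulr_ge0 ?(ltW c0)//; last by rewrite ltW// (le_lt_trans t0).
  apply/andP; split; last by rewrite mulrC -ltr_pdivlMr.
  have /andP[h _] := truncn_itv (mulr_ge0 (ltW c0) t0).
  by rewrite (le_trans h)// ler_pM2l// ltW.
(* Just left of t the truncation equals k; when c t is an integer this is c t - 1, not the value at
   t. *)
have [k [kt tk]] : exists k : nat, k%:R / c < t /\ t <= k.+1%:R / c.
  have ct : 0 <= c * t by rewrite mulr_ge0 ?ltW.
  have /andP[h1 h2] := truncn_itv ct.
  have [E|ne] := eqVneq (Num.truncn (c * t))%:R (c * t).
    case: (Num.truncn (c * t)) E => [E|k E].
      by have := mulr_gt0 c0 t0; rewrite -E ltxx.
    exists k; rewrite ltr_pdivrMr// ler_pdivlMr// mulrC -E; split => //.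
    by rewrite ltr_nat.
  exists (Num.truncn (c * t)); rewrite ltr_pdivrMr// ler_pdivlMr// (mulrC t); split; last exact: ltW.
  by rewrite lt_neqAle ne.
apply/cvg_ex; exists (F k); apply: cvg_near_cst.
near=> u; congr F; apply/eqP.
have uk : k%:R / c < u by near: u; exact: nbhs_left_gt.
have ut : u < t by near: u; exact: nbhs_left_lt.
have u0 : 0 <= u by rewrite (le_trans _ (ltW uk))// divr_ge0// ltW.
rewrite truncn_eq ?mulr_ge0 ?(ltW c0)// mulrC.
by rewrite -ler_pdivrMr// (ltW uk)/= -ltr_pdivlMr// (lt_le_trans ut).
Unshelve. all: by end_near. Qed.

Lemma cadlag01_scaled_path n s : (0 < n)%N -> cadlag01 (scaled_path n s : R -> R).
Proof.
move=> n0; apply: (@cadlag01_comp_truncn n.*2%:R (fun k => (Num.sqrt n%:R)^-1 * Delta R s k)).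
by rewrite ltr0n double_gt0.
Qed.

Lemma uniform_continuity01 x (e : R) : {within `[0, 1], continuous x} -> 0 < e ->
  exists2 d : R, 0 < d & forall s t, 0 <= s <= 1 -> 0 <= t <= 1 -> `|s - t| < d -> `|x s - x t| <= e.
Proof.
move=> /subspace_continuousP xc e0.
have e2 : 0 < e / 2 by rewrite divr_gt0.
have := @segment_compact R 0 1; rewrite compact_near_coveringP => /(_ R (0^'+) (fun d s =>
  forall t, 0 <= s <= 1 -> 0 <= t <= 1 -> `|s - t| < d -> `|x s - x t| <= e) _) H.
have [|d /= d0 hd] := H _; last first.
  exists (d / 2); first by rewrite divr_gt0.
  move=> s t s01 t01 st; apply: (hd (d / 2) _ _ s) => //=.
  - by rewrite sub0r normrN gtr0_norm ?divr_gt0// ltr_pdivrMr// ltr_pMr// ltr1n.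
  - by rewrite divr_gt0.
move=> s; rewrite /= in_itv/= => s01.
have := xc s; rewrite /= in_itv/= => /(_ s01) /cvgrPdist_le /(_ _ e2).
rewrite near_withinE => -[rho /= rho0 hrho].
have r2 : 0 < rho / 2 by rewrite divr_gt0.
exists (ball s (rho / 2), [set d | d < rho / 2]).
  split; first exact: nbhsx_ballx.
  exact: nbhs_right_lt.
move=> [s' d] /= [ss' dr] t s'01 t01 s't.
have h1 : `|x s - x s'| <= e / 2.
  apply: hrho; last by rewrite /= in_itv.
  by rewrite /= (lt_trans ss')// ltr_pdivrMr// ltr_pMr// ltr1n.
have h2 : `|x s - x t| <= e / 2.
  apply: hrho; last by rewrite /= in_itv.
  rewrite /= (le_lt_trans (ler_distD s' _ _))// [ltRHS](splitr rho) ltrD//.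
  exact: lt_trans dr.
rewrite (le_trans (ler_distD (x s) _ _))// [leRHS](splitr e) lerD// distrC//.
Qed.

Lemma sup_close_grid_path x (e : R) : {within `[0, 1], continuous x} -> 0 < e ->
  \forall m \near \oo, sup_close e (grid_path m x) x.
Proof.
move=> xc e0; have [d d0 hd] := uniform_continuity01 xc e0.
near=> m => t /andP[t0 t1].
have m0 : 0 < m%:R :> R by rewrite ltr0n; near: m; exact: nbhs_infty_gt.
have md : d^-1 < m%:R by near: m; exact: nbhs_infty_gtr.
have /andP[h1 h2] := truncn_itv (mulr_ge0 (ltW m0) t0).
have le1 : (Num.truncn (m%:R * t))%:R / m%:R <= t by rewrite ler_pdivrMr// [leRHS]mulrC.
apply: hd; rewrite ?t0 ?t1//.
  by rewrite divr_ge0//= (le_trans le1).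
rewrite ler0_norm ?subr_le0// opprB.
apply: (@lt_trans _ _ m%:R^-1); last by rewrite invf_plt ?posrE.
rewrite [ltRHS](_ : _ = (Num.truncn (m%:R * t)).+1%:R / m%:R - (Num.truncn (m%:R * t))%:R / m%:R); last first.
  by rewrite -natr1; ring.
by rewrite ltrD2r ltr_pdivlMr// [ltLHS]mulrC.
Unshelve. all: by end_near. Qed.

End Paths.

(** * Lipschitz envelopes of a functional *)

Section LipschitzEnvelope.
Variables (R : realType) (f : (R -> R) -> R) (M : R).
Hypothesis fM : forall x, cadlag01 x -> `|f x| <= M.
Implicit Types (x y : R -> R).

(** The infimum of these costs is the inf-convolution of f with k times the sup distance. The
    competitors y are cadlag because f is bounded only there, while x is arbitrary. *)
Let cost (k : R) x : set R :=
  [set z | exists y r, [/\ cadlag01 y, 0 <= r, 1 <= r \/ sup_close r x y & z = f y + k * r]].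

(* The penalty is truncated at distance 1 so that the infimum runs over a
   nonempty set also when [x] is unbounded. *)
Definition envelope (k : R) x : R := inf (cost k x).

Let cost_lb k x : 0 <= k -> lbound (cost k x) (- M).
Proof.
move=> k0 z [y [r [cy r0 _ ->]]].
have := fM cy; rewrite ler_norml => /andP[h _].
by rewrite (le_trans h)// lerDl mulr_ge0.
Qed.

Let cost_inf k x : 0 <= k -> has_inf (cost k x).
Proof.
move=> k0; split; last by exists (- M); exact: cost_lb.
exists (f (fun=> 0) + k * 1), (fun=> 0), 1; split => //; last by left.
exact: cadlag01_cst.
Qed.

Let envelope_le_cost k x y r : 0 <= k -> cadlag01 y -> 0 <= r ->
  1 <= r \/ sup_close r x y -> envelope k x <= f y + k * r.
Proof.
move=> k0 cy r0 h; apply: inf_lbound; first by case: (cost_inf x k0).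
by exists y, r.
Qed.

Lemma envelope_ge k x : 0 <= k -> - M <= envelope k x.
Proof. by move=> k0; apply: lb_le_inf; [case: (cost_inf x k0)|exact: cost_lb]. Qed.

Lemma envelope_le k x : 0 <= k -> cadlag01 x -> envelope k x <= f x.
Proof.
move=> k0 cx; rewrite -[leRHS]addr0 -[X in _ + X](mulr0 k).
by apply: envelope_le_cost => //; right => t _; rewrite subrr normr0.
Qed.

Lemma norm_envelope_le k x : 0 <= k -> `|envelope k x| <= M + k.
Proof.
move=> k0; have := envelope_ge x k0.
have := @envelope_le_cost k x (fun=> 0) 1 k0 (cadlag01_cst _) ler01 (or_introl (lexx _)).
have := fM (cadlag01_cst 0); rewrite !ler_norml => /andP[_ h] h1 h2.
by apply/andP; split; lra.
Qed.

Lemma norm_envelope_le_cadlag k x : 0 <= k -> cadlag01 x -> `|envelope k x| <= M.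
Proof.
move=> k0 cx; have := envelope_ge x k0; have := envelope_le k0 cx; have := fM cx.
by rewrite !ler_norml => /andP[_ h] h1 h2; apply/andP; split; lra.
Qed.

Lemma envelope_lipschitz k : 0 <= k -> sup_lipschitz k (envelope k).
Proof.
move=> k0.
suff H x y r : 0 <= r -> sup_close r x y -> envelope k x <= envelope k y + k * r.
  move=> x y r r0 xy; rewrite ler_norml; have h1 := H _ _ _ r0 xy.
  have h2 := H _ _ _ r0 (sup_close_sym xy).
  by apply/andP; split; lra.
move=> r0 xy; rewrite -lerBlDr; apply: lb_le_inf; first by case: (cost_inf y k0).
move=> z [y' [r' [cy' r'0 h ->]]].
rewrite lerBlDr -addrA -mulrDr; apply: envelope_le_cost => //; first exact: addr_ge0.
case: h => [h|h]; first by left; rewrite (le_trans h)// lerDl.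
by right; rewrite addrC; exact: sup_close_trans h.
Qed.

(** For k >= 2M/d', a competitor at distance at least d' pays a penalty of 2M, more than it can
    gain; a closer one has nearly the same value by continuity of f at x. *)
Lemma cvg_envelope x : cadlag01 x ->
  (forall e : R, 0 < e -> exists2 d : R, 0 < d & forall y, cadlag01 y ->
     skorohod_dist x y < d -> `|f y - f x| < e) ->
  envelope k%:R x @[k --> \oo] --> f x.
Proof.
move=> cx fc; apply/cvgrPdist_le => e e0.
have [d d0 hd] := fc _ e0.
pose d' := Num.min d 1.
have d'0 : 0 < d' by rewrite lt_min d0 ltr01.
near=> k.
have kd : 2 * M / d' <= k%:R by near: k; exact: nbhs_infty_ger.
have k0 : 0 <= k%:R :> R by [].
have h1 := envelope_le k0 cx.
rewrite ger0_norm ?subr_ge0// lerBlDr -lerBlDl.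
apply: lb_le_inf; first by case: (cost_inf x k0).
move=> z [y [r [cy r0 h ->]]].
have [rd|rd] := ltP r d'.
  have /andP[rd1 r1] : (r < d) && (r < 1) by rewrite -lt_min.
  have xy : sup_close r x y by case: h => // /(lt_le_trans r1); rewrite ltxx.
  have := hd y cy (le_lt_trans (skorohod_dist_le r0 xy) rd1).
  rewrite ltr_norml => /andP[h2 _].
  have : 0 <= k%:R * r by rewrite mulr_ge0.
  by lra.
have kr : 2 * M <= k%:R * r.
  by rewrite (le_trans _ (ler_wpM2l k0 rd))// -ler_pdivrMr.
have := fM cx; have := fM cy; rewrite !ler_norml => /andP[h2 _] /andP[_ h3]; lra.
Unshelve. all: by end_near. Qed.

End LipschitzEnvelope.

(** * Integrals of bounded functions *)

Section BoundedIntegrals.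
Context {d : measure_display} {T : measurableType d} {R : realType} (P : probability T R).
Implicit Types (h : T -> R).

Lemma integrable_bounded h (M : R) : measurable_fun setT h -> (forall w, `|h w| <= M) ->
  P.-integrable setT (EFin \o h).
Proof.
move=> mh hM; apply: measurable_bounded_integrable => //.
  by rewrite (le_lt_trans (probability_le1 _ measurableT))// ltry.
by exists M; split; [rewrite num_real|move=> r Mr x _; exact: le_trans (hM x) (ltW Mr)].
Qed.

Lemma expectation_Rintegral h (M : R) : measurable_fun setT h -> (forall w, `|h w| <= M) ->
  ('E_P[h] = (\int[P]_w h w)%R%:E)%E.
Proof.
move=> mh hM; rewrite unlock /Rintegral fineK//.
exact: (integrable_fin_num measurableT (integrable_bounded mh hM)).
Qed.

Lemma cvg_Rintegral_bounded (h_ : nat -> T -> R) h (M : R) :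
  (forall n, measurable_fun setT (h_ n)) -> (forall n w, `|h_ n w| <= M) ->
  (forall w, h_ n w @[n --> \oo] --> h w) ->
  measurable_fun setT h /\ (\int[P]_w h_ n w @[n --> \oo] --> \int[P]_w h w).
Proof.
move=> mh_ hM hc.
have mh : measurable_fun setT h by apply: (measurable_fun_cvg mh_) => w _; exact: hc.
have hM' w : `|h w| <= M.
  have /cvg_lim <- // : `|h_ n w| @[n --> \oo] --> `|h w| by apply: cvg_norm; exact: hc.
  apply: limr_le; last by near=> n; exact: hM.
  by apply/cvg_ex; exists `|h w|; apply: cvg_norm; exact: hc.
split => //; rewrite /Rintegral; apply: fine_cvg; rewrite fineK; last first.
  exact: (integrable_fin_num measurableT (integrable_bounded mh hM')).
apply: (@dominated_cvg _ _ R P setT measurableT _ _ (fun=> M%:E)) => //.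
- by move=> n; apply/measurable_EFinP.
- by move=> w _; apply: cvg_EFin; [near=> n|exact: hc].
- apply: (@integrable_bounded (fun=> M) `|M|) => //.
- by move=> n w _; rewrite /= lee_fin.
Unshelve. all: by end_near. Qed.

End BoundedIntegrals.

(** * Marginals at grid times, time 0 included *)

Section FiniteDimensionalGrid.
Variables (R : realType) (alpha : R).
Hypothesis alpha_gt1 : 1 < alpha.

Lemma G_cov0 (s t : R) : 0 <= s -> 0 <= t -> (s == 0) || (t == 0) -> G_cov alpha s t = 0.
Proof.
move=> s0 t0 st; rewrite /G_cov; suff -> : Num.min s t = 0.
  by rewrite powR0 ?mulr0 ?mul0r// gt_eqF// (lt_trans ltr01).
by case/orP: st => /eqP ->; [exact: min_l|exact: min_r].
Qed.

Lemma scaled_path_bD n s (t : R) : (0 < n)%N -> size s = (n.*2 - 2)%N -> end11 R n s != 0 ->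
  t <= 1 -> scaled_path n s t = (Num.sqrt n%:R)^-1 * bD R n (drop (level n t - 2) s).
Proof.
move=> n0 sn e1 t1; rewrite /scaled_path; congr (_ * _).
rewrite (Delta_bD alpha_gt1 n0 sn e1); last exact: level_le.
rewrite -/(level n t); move: (level n t) => k; congr (bD R n (drop _ s)); clear; lia.
Qed.

Section Fdd.
Variables (m : nat) (ts cs : 'I_m -> R) (tau : R).
Hypothesis tau01 : 0 < tau <= 1.
Hypothesis tsP : forall i, ts i = 0 \/ tau <= ts i <= 1.

(** [cvg_fdd_char] needs times at least tau > 0. Time 0 is moved to 1 with coefficient 0, which
    changes nothing since the path and [G_cov] vanish at 0. *)
Let ts' i : R := if ts i == 0 then 1 else ts i.
Let cs' i : R := if ts i == 0 then 0 else cs i.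

Let ts'P i : tau <= ts' i <= 1.
Proof.
by rewrite /ts'; case: eqP => [_|ne]; [case/andP: tau01 => _ ->; rewrite lexx|case: (tsP i)].
Qed.

Let ts0 i : 0 <= ts i.
Proof.
case: (tsP i) => [->//|/andP[h _]]; apply: le_trans h; case/andP: tau01 => h _; exact: ltW.
Qed.

Let v : R := \sum_(i < m) \sum_(j < m) cs i * cs j * G_cov alpha (ts i) (ts j).

Let quadE : \sum_(i < m) \sum_(j < m) cs' i * cs' j * G_cov alpha (ts' i) (ts' j) = v.
Proof.
apply: eq_bigr => i _; apply: eq_bigr => j _; rewrite /cs' /ts'.
have [h|/norP[hi hj]] := boolP ((ts i == 0) || (ts j == 0)).
  rewrite (G_cov0 (ts0 i) (ts0 j) h) mulr0.
  by case/orP: h => ->; rewrite ?mul0r// mulr0 mul0r.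
by rewrite (negbTE hi) (negbTE hj).
Qed.

Lemma quad_form_ge0 : 0 <= v.
Proof. by rewrite -quadE; exact: (G_cov_quad_ge0 alpha_gt1 _ tau01 ts'P). Qed.

Let fddE n s : (0 < n)%N -> size s = (n.*2 - 2)%N -> end11 R n s != 0 ->
  \sum_(i < m) cs i * scaled_path n s (ts i) = fdd_sum ts' cs' n s.
Proof.
move=> n0 sn e1; apply: eq_bigr => i _; rewrite /cs' /ts'; case: eqP => [->|ne].
  by rewrite /scaled_path mulr0 truncn0 /Delta/= !mulr0 mul0r.
by rewrite scaled_path_bD//; case: (tsP i) => // /andP[].
Qed.

Lemma cvg_cE_cos (b : R) :
  cE alpha n (fun s => cos (b + \sum_(i < m) cs i * scaled_path n s (ts i))) @[n --> \oo] -->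
  expR (- (v / 2)) * cos b.
Proof.
rewrite -quadE; have H := @cvg_fdd_char R alpha alpha_gt1 m ts' cs' tau tau01 ts'P b.
apply: (cvgn_close (e := fun=> 0) _ _ H).
  near=> n; rewrite normr_le0 subr_eq0; apply/eqP; apply: cE_eq => //.
    by near: n; exact: nbhs_infty_gt.
  by move=> s sn e1; rewrite fddE//; near: n; exact: nbhs_infty_gt.
exact: cvg_cst.
Unshelve. all: by end_near. Qed.

End Fdd.

Lemma cE_sum n k (F : nat -> seq bool -> R) : (0 < n)%N ->
  cE alpha n (fun s => \sum_(i < k) F i s) = \sum_(i < k) cE alpha n (F i).
Proof.
move=> n0; elim: k => [|k IH].
  rewrite big_ord0 -[RHS](cE_cst alpha_gt1 n0); apply: cE_eq => // s _ _.
  by rewrite big_ord0.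
rewrite big_ord_recr/= -IH -cED//; apply: cE_eq => // s _ _.
by rewrite big_ord_recr.
Qed.

(** Chebyshev's inequality: the second moment of the difference is at most 2n at every level, so the
    bound depends neither on n nor on t. *)
Lemma cE_tail n (t B : R) : (0 < n)%N -> t <= 1 -> 0 < B ->
  cE alpha n (fun s => (B < `|scaled_path n s t|)%R%:R) <= 2 / hit_lower alpha / B ^+ 2.
Proof.
move=> n0 t1 B0.
have nR : 0 < n%:R :> R by rewrite ltr0n.
have n2 : (2 <= n.*2)%N by rewrite -leq_double in n0.
pose k := maxn 2 (level n t).
have kn : (k <= n.*2)%N by rewrite geq_max n2 level_le.
have k2 : (2 <= k)%N by exact: leq_maxl.
pose L := (n.*2 - k)%N.
have Ln : (L <= n.*2 - 2)%N by exact: leq_sub2l.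
have Lk : (n.*2 - 2 - L = k - 2)%N.
  by rewrite /L subnBA ?leq_sub2l // ; lia.
pose F (s : seq bool) : R := (n%:R * B ^+ 2)^-1 * bD R n s ^+ 2.
have c0 : 0 <= (n%:R * B ^+ 2)^-1 by rewrite invr_ge0 mulr_ge0// sqr_ge0.
apply: (@le_trans _ _ (cE alpha n (fun s => F (drop (n.*2 - 2 - L) s)))).
  apply: cE_le => // s sn e1; rewrite Lk /F /scaled_path.
  rewrite (Delta_bD alpha_gt1 n0 sn e1); last exact: level_le.
  rewrite -/k; set D := bD _ _ _.
  have [h|_] := ltP; last by rewrite mulr_ge0// sqr_ge0.
  rewrite ler_pdivlMl ?mulr_gt0 ?exprn_gt0// mulr1.
  have -> : D ^+ 2 = n%:R * `|(Num.sqrt n%:R)^-1 * D| ^+ 2.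
    rewrite real_normK ?num_real// exprMn exprVn sqr_sqrtr ?(ltW nR)//.
    by rewrite mulrA mulfV ?mul1r// gt_eqF.
  by rewrite ler_wpM2l// ler_sqr ?nnegrE ?(ltW B0)// ltW.
have LL : (L <= n.*2)%N by exact: leq_subr.
have hb := bE_bD_sqr alpha_gt1 LL.
have hl := hit_lower_gt0 alpha.
apply: (le_trans (cE_drop_le alpha_gt1 n0 Ln _)) => [s _|].
  by rewrite /F mulr_ge0// sqr_ge0.
have h2 : bE alpha n L F <= (n%:R * B ^+ 2)^-1 * n.*2%:R.
  rewrite /F bEZ// ler_wpM2l// (le_trans hb)// ler_nat.
  by rewrite leq_subr.
have -> : 2 / hit_lower alpha / B ^+ 2 = (n%:R * B ^+ 2)^-1 * n.*2%:R / hit_lower alpha.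
  rewrite -muln2 natrM; field.
  by rewrite !gt_eqF.
by rewrite ler_wpM2r// invr_ge0 ltW.
Qed.

End FiniteDimensionalGrid.

(** * Convergence of expectations of functionals *)

Section WeakConvergence.
Variables (R : realType) (alpha : R).
Hypothesis alpha_gt1 : 1 < alpha.
Context {d : measure_display} {T : measurableType d} (P : probability T R) (G : R -> T -> R).
Hypothesis hG : continuous_centered_gaussian_process P (G_cov alpha) G.

Let mG t : 0 <= t <= 1 -> measurable_fun setT (G t).
Proof. by move=> /andP[t0 t1]; case: hG => h _ _; exact: h. Qed.

Let cG w : {within `[0, 1], continuous (G ^~ w)}.
Proof. by case: hG => _ h _; exact: h. Qed.

Let cadlagG w : cadlag01 (G ^~ w).
Proof. exact: continuous_cadlag01. Qed.

(** Measurability is part of the conclusion: it is clear for trigonometric polynomials of grid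
    values and passes to pointwise limits. *)
Definition functional_cvg (g : (R -> R) -> R) : Prop :=
  measurable_fun setT (fun w => g (G ^~ w)) /\
  (cE alpha n (fun s => g (scaled_path n s)) @[n --> \oo] --> \int[P]_w g (G ^~ w)).

(* Approximations converging pointwise along the limit process and uniformly
   in mean along the urn process suffice. *)
Lemma functional_cvg_approx (g_ : nat -> (R -> R) -> R) (g : (R -> R) -> R) (M : R) (del : nat -> R) :
  (forall N, functional_cvg (g_ N)) -> (forall N w, `|g_ N (G ^~ w)| <= M) ->
  (forall w, g_ N (G ^~ w) @[N --> \oo] --> g (G ^~ w)) ->
  (forall N, \forall n \near \oo, cE alpha n
     (fun s => `|g (scaled_path n s) - g_ N (scaled_path n s)|) <= del N) ->
  del @ \oo --> (0 : R) -> functional_cvg g.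
Proof.
move=> gg gM gG gX del0.
have [mg cg] := cvg_Rintegral_bounded P (fun N => (gg N).1) gM gG.
split => //.
apply: (cvgn_approx _ (fun N => (gg N).2) del0 cg) => N.
have h := gX N.
near=> n; have n0 : (0 < n)%N by near: n; exact: nbhs_infty_gt.
rewrite -cEB//; apply: le_trans (ler_norm_cE alpha_gt1 n0 _) _.
by near: n.
Unshelve. all: by end_near. Qed.

Section Grid.
Variable m : nat.
Hypothesis m0 : (0 < m)%N.

Let mR : 0 < m%:R :> R. Proof. by rewrite ltr0n. Qed.

Let ti (i : nat) : R := i%:R / m%:R.

Let ti01 i : (i < m.+1)%N -> 0 <= ti i <= 1.
Proof. by move=> im; rewrite divr_ge0//= ler_pdivrMr// mul1r ler_nat -ltnS. Qed.

Let tiP (i : 'I_m.+1) : ti i = 0 \/ m%:R^-1 <= ti i <= 1.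
Proof.
have /andP[_ h] := ti01 (ltn_ord i); rewrite h andbT /ti.
case: (val i) => [|j]; first by left; rewrite mul0r.
by right; rewrite ler_peMl ?invr_ge0 ?(ltW mR)// ler1n.
Qed.

Let tau01 : 0 < (m%:R^-1 : R) <= 1.
Proof. by rewrite invr_gt0 mR invf_le1// ler1n. Qed.

Lemma functional_cvg_trigp p : trigp m.+1 p ->
  functional_cvg (fun x => p (fun i => x (ti i))) /\ (exists C : R, forall y, `|p y| <= C).
Proof.
elim => [b c|f g _ [[mf cf] [Cf fC]] _ [[mg cg] [Cg gC]]|a f _ [[mf cf] [Cf fC]]].
- have mY : measurable_fun setT (fun w => \sum_(i < m.+1) c i * G (ti i) w).
    apply: measurable_sum => i; apply: measurable_funM => //; apply: mG; exact: ti01.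
  have hY := let: And3 _ _ h := hG in h _ (fun i => ti i) c (fun i => ti01 (ltn_ord i)).
  have v0 := quad_form_ge0 alpha_gt1 c tau01 tiP.
  have mc : measurable_fun setT (fun w => cos (b + \sum_(i < m.+1) c i * G (ti i) w)).
    apply: (@measurableT_comp _ _ _ _ _ _ (@cos R)).
      by apply: continuous_measurable_fun; exact: continuous_cos.
    exact: measurable_funD.
  split; last by exists 1 => y; exact: cos_max.
  split => //.
  set v := \sum_(i < m.+1) \sum_(j < m.+1) _ in v0 hY.
  have E : \int[P]_w cos (b + \sum_(i < m.+1) c i * G (ti i) w) = expR (- (v / 2)) * cos b.
    apply: EFin_inj; rewrite -(expectation_Rintegral P mc (fun w => cos_max _)).
    exact: expectation_cos_normal.
  rewrite E; exact: (cvg_cE_cos alpha_gt1 tau01 tiP).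
- split; last by exists (Cf + Cg) => y; rewrite (le_trans (ler_normD _ _))// lerD.
  split; first exact: measurable_funD.
  rewrite RintegralD//; last 2 first.
  + exact: (integrable_bounded P mf (fun w => fC _)).
  + exact: (integrable_bounded P mg (fun w => gC _)).
  apply: (cvgn_close (e := fun=> 0) _ _ (cvgD cf cg)); last exact: cvg_cst.
  near=> n; have n0 : (0 < n)%N by near: n; exact: nbhs_infty_gt.
  by rewrite normr_le0 subr_eq0 cED//; exact/eqP.
- split; last by exists (`|a| * Cf) => y; rewrite normrM ler_wpM2l.
  split; first exact: measurable_funM.
  rewrite RintegralZl//; last exact: (integrable_bounded P mf (fun w => fC _)).
  apply: (cvgn_close (e := fun=> 0) _ _ (cvgM (cvg_cst a) cf)); last exact: cvg_cst.
  near=> n; have n0 : (0 < n)%N by near: n; exact: nbhs_infty_gt.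
  by rewrite normr_le0 subr_eq0 cEZ//; exact/eqP.
Unshelve. all: by end_near. Qed.

Lemma functional_cvg_lipschitz_coord h (M K : R) : 0 <= K -> (forall y, `|h y| <= M) ->
  lipschitz_coord m.+1 K h -> functional_cvg (fun x => h (fun i => x (ti i))).
Proof.
move=> K0 hM hK.
have M0 : 0 <= M by exact: le_trans (hM (fun=> 0)).
have ex N : exists p, [/\ trigp m.+1 p, forall x, `|p x| <= M &
    forall x, (forall i, (i < m.+1)%N -> `|x i| <= N.+1%:R) -> `|p x - h x| <= N.+1%:R^-1].
  by apply: (trig_approx (K := K)).
have [p Hp] := choice ex.
have hl := hit_lower_gt0 alpha.
pose C : R := 2 * M * (m.+1%:R * (2 / hit_lower alpha)).
have C0 : 0 <= C by rewrite /C !mulr_ge0// invr_ge0 ltW.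
apply: (functional_cvg_approx (g_ := fun N x => p N (fun i => x (ti i))) (M := M)
   (del := fun N => (1 + C) * N.+1%:R^-1)).
- by move=> N; have [tp _ _] := Hp N; case: (functional_cvg_trigp tp).
- by move=> N w; have [_ h1 _] := Hp N.
- move=> w; pose y i := G (ti i) w.
  apply: (cvgn_close (v := fun=> h y) (e := fun N => N.+1%:R^-1)).
  + near=> N; have [_ _ h1] := Hp N; apply: h1 => i im.
    have hS : \sum_(j < m.+1) `|y j| <= N%:R by near: N; exact: nbhs_infty_ger.
    apply: (@le_trans _ _ N%:R); last by rewrite ler_nat.
    apply: le_trans hS.
    by rewrite (bigD1 (Ordinal im))//= lerDl sumr_ge0.
  + exact: cvg_harmonic.
  + exact: cvg_cst.
- move=> N; have [_ h2 h1] := Hp N.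
  near=> n; have n0 : (0 < n)%N by near: n; exact: nbhs_infty_gt.
  set B : R := N.+1%:R.
  have B0 : 0 < B by rewrite ltr0n.
  have B1 : 1 <= B by rewrite ler1n.
  (* Inside the box the error is at most 1/B. Outside, both functions are bounded by M, and each
     coordinate leaves the box with probability of order B^-2, at most that of 1/B. *)
  apply: (@le_trans _ _ (cE alpha n (fun s => B^-1 +
     2 * M * \sum_(i < m.+1) (B < `|scaled_path n s (ti i)|)%R%:R))).
    apply: cE_le => // s _ _; rewrite distrC.
    have sum0 : 0 <= \sum_(i < m.+1) (B < `|scaled_path n s (ti i)|)%R%:R :> R by apply: sumr_ge0.
    have [/forallP hb|/forallPn[i]] := boolP [forall i : 'I_m.+1, `|scaled_path n s (ti i)| <= B].
      apply: (@le_trans _ _ B^-1); last by rewrite lerDl !mulr_ge0.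
      by apply: h1 => i im; exact: (hb (Ordinal im)).
    rewrite -ltNge => hi.
    apply: (@le_trans _ _ (2 * M)).
      by rewrite (le_trans (ler_normB _ _))// mulr_natl mulr2n lerD.
    apply: (@le_trans _ _ (2 * M * \sum_(i < m.+1) (B < `|scaled_path n s (ti i)|)%R%:R)).
      rewrite ler_peMr ?mulr_ge0// (bigD1 i)//= hi lerDl.
      by apply: sumr_ge0.
    by rewrite lerDr invr_ge0 ltW.
  rewrite cED// cE_cst// [leRHS]mulrDl mul1r lerD2l cEZ// (@cE_sum _ _ alpha_gt1 n m.+1 (fun i s => (B < `|scaled_path n s (ti i)|)%R%:R))// /C -!mulrA.
  rewrite ler_wpM2l// ler_wpM2l//.
  apply: (@le_trans _ _ (\sum_(i < m.+1) 2 / hit_lower alpha / B)).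
    apply: ler_sum => i _; have /andP[_ t1] := ti01 (ltn_ord i).
    apply: (le_trans (cE_tail alpha_gt1 n0 t1 B0)).
    rewrite ler_wpM2l ?divr_ge0 ?(ltW hl)// lef_pV2 ?posrE ?exprn_gt0// expr2.
    by rewrite ler_peMr// ltW.
  by rewrite sumr_const card_ord -[X in X <= _]mulr_natl -!mulrA.
- rewrite -[X in _ --> X](mulr0 (1 + C)); apply: cvgM; [exact: cvg_cst|exact: cvg_harmonic].
Unshelve. all: by end_near. Qed.

Lemma functional_cvg_grid_path g (M K : R) : 0 <= K -> (forall x, `|g x| <= M) ->
  sup_lipschitz K g -> functional_cvg (fun x => g (grid_path m x)).
Proof.
move=> K0 gM gK.
(* g at the step function with grid values y. On [0, 1] only the values with index at most m
   occur. *)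
pose h (y : nat -> R) : R := g (fun t => y (Num.truncn (m%:R * t))).
apply: (@functional_cvg_lipschitz_coord h M K) => // [y|x y r r0 xy]; first exact: gM.
apply: gK => // t /andP[t0 t1]; apply: xy.
rewrite ltnS -(ler_nat R); have /andP[h1 _] := truncn_itv (mulr_ge0 (ltW mR) t0).
by rewrite (le_trans h1)// ler_piMr// ltW.
Qed.

End Grid.

Lemma functional_cvg_sup_lipschitz g (M K : R) : 0 <= K -> (forall x, `|g x| <= M) ->
  sup_lipschitz K g -> functional_cvg g.
Proof.
move=> K0 gM gK.
have M0 : 0 <= M by exact: le_trans (gM (fun=> 0)).
have hl := hit_lower_gt0 alpha.
(* For the oscillation eta = 1/(j + 1), a grid so fine that a bad path has conditional probability
   at most eta as well; [j < m] makes the grids refine, as the limit process requires. *)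
have ex j : exists m : nat, (j < m)%N /\ osc_bound alpha m (j.+1%:R^-1) / hit_lower alpha <= j.+1%:R^-1.
  have e0 : 0 < j.+1%:R^-1 * hit_lower alpha by rewrite mulr_gt0// invr_gt0 ltr0n.
  have [m1 _ H1] := cvgr_dist_le _ _ (@cvg_osc_bound R alpha j.+1%:R^-1) _ e0.
  exists (maxn j.+1 m1); split; first exact: leq_maxl.
  rewrite ler_pdivrMr//; have := H1 (maxn j.+1 m1) (leq_maxr _ _).
  by rewrite /= sub0r normrN; apply: le_trans; exact: ler_norm.
have [m Hm] := choice ex.
have m0 j : (0 < m j)%N by case: (Hm j) => h _; exact: leq_ltn_trans h.
apply: (functional_cvg_approx (g_ := fun j x => g (grid_path (m j) x)) (M := M)
   (del := fun j => (K + 2 * M) * j.+1%:R^-1)).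
- by move=> j; exact: (functional_cvg_grid_path (m0 j) K0 gM gK).
- by move=> j w; exact: gM.
- move=> w; apply/cvgrPdist_le => e e0.
  have e1 : 0 < e / (K + 1) by rewrite divr_gt0// ltr_wpDl.
  have [N _ HN] := sup_close_grid_path (@cG w) e1.
  near=> j; have jN : (N <= m j)%N.
    apply: (@leq_trans j); first by near: j; exact: nbhs_infty_ge.
    by apply: ltnW; case: (Hm j).
  rewrite distrC (le_trans (gK _ _ _ (ltW e1) (HN _ jN)))//.
  by rewrite mulrCA ger_pMr// ler_pdivrMr ?ltr_wpDl// mul1r lerDl.
- move=> j; have [jm hm] := Hm j.
  near=> n; have mn : (m j < n)%N by near: n; exact: nbhs_infty_gt.
  have n0 : (0 < n)%N by exact: leq_ltn_trans mn.
  set eta : R := j.+1%:R^-1; rewrite -/eta in hm.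
  have eta0 : 0 < eta by rewrite invr_gt0 ltr0n.
  apply: (@le_trans _ _ (cE alpha n (fun s => K * eta + 2 * M * (bad_path alpha n (m j) eta s)%:R))).
    apply: cE_le => // s sn e1.
    case: (boolP (bad_path _ _ _ _ _)) => [_|nb].
      rewrite mulr1 (@le_trans _ _ (2 * M))//; last by rewrite lerDr mulr_ge0// ltW.
      by rewrite (le_trans (ler_normB _ _))// mulr_natl mulr2n lerD.
    rewrite mulr0 addr0; apply: gK; first exact: ltW.
    by move=> t t01; exact: (bad_path_osc alpha_gt1 (m0 j) mn eta0 sn e1 nb).
  rewrite cED// cE_cst// cEZ// [leRHS]mulrDl lerD2l ler_wpM2l ?mulr_ge0//.
  exact: le_trans (cE_bad_path alpha_gt1 (m0 j) mn eta0) hm.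
- rewrite -[X in _ --> X](mulr0 (K + 2 * M)); apply: cvgM; [exact: cvg_cst|exact: cvg_harmonic].
Unshelve. all: by end_near. Qed.

(** The envelope of f from below and minus the envelope of -f from above bracket f on every cadlag
    path, so on the urn for each k. They need to approach f only along the limit paths. *)
Lemma cvg_cE_skorohod f : skorohod_bounded_continuous f ->
  cE alpha n (fun s => f (scaled_path n s)) @[n --> \oo] --> \int[P]_w f (G ^~ w) /\
  measurable_fun setT (fun w => f (G ^~ w)).
Proof.
move=> [[M fM] fc].
have fM' x : cadlag01 x -> `|- f x| <= M by rewrite normrN; exact: fM.
have k0 k : 0 <= k%:R :> R by [].
pose lo (k : nat) := envelope f k%:R.
pose up (k : nat) x := - envelope (fun y => - f y) k%:R x.
have glo k : functional_cvg (lo k).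
  apply: (functional_cvg_sup_lipschitz (M := M + k%:R) (k0 k)) => [x|].
    exact: (norm_envelope_le fM).
  exact: (envelope_lipschitz fM).
have gup k : functional_cvg (up k).
  apply: (functional_cvg_sup_lipschitz (M := M + k%:R) (k0 k)) => [x|x y r r0 xy].
    by rewrite normrN; exact: (norm_envelope_le fM').
  by rewrite /up -opprD normrN; apply: (envelope_lipschitz fM').
have clo w : lo k (G ^~ w) @[k --> \oo] --> f (G ^~ w).
  by apply: (cvg_envelope fM) => // e e0; exact: fc.
have cup w : up k (G ^~ w) @[k --> \oo] --> f (G ^~ w).
  rewrite -[X in _ --> X]opprK; apply: cvgN.
  apply: (cvg_envelope fM') => // e e0; have [dl dl0 hd] := fc _ (cadlagG w) _ e0.
  by exists dl => // y cy xy; rewrite -opprD normrN; exact: hd.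
(* On arbitrary functions the envelope is bounded only by M + k, but on cadlag paths by M for all k;
   this permits dominated convergence. *)
have [mf cl] := cvg_Rintegral_bounded P (fun k => (glo k).1)
  (fun k w => norm_envelope_le_cadlag fM (k0 k) (cadlagG w)) clo.
have upM k w : `|up k (G ^~ w)| <= M by rewrite normrN; exact: norm_envelope_le_cadlag.
have [_ cu] := cvg_Rintegral_bounded P (fun k => (gup k).1) upM cup.
split => //.
apply: (cvgn_sandwich _ (fun k => (glo k).2) (fun k => (gup k).2) cl cu) => k.
near=> n; have n0 : (0 < n)%N by near: n; exact: nbhs_infty_gt.
apply/andP; split; apply: cE_le => // s _ _.
  by apply: (envelope_le fM) => //; exact: cadlag01_scaled_path.
rewrite /up lerNr; apply: (envelope_le fM') => //; exact: cadlag01_scaled_path.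
Unshelve. all: by end_near. Qed.

End WeakConvergence.

Theorem theorem1p2 (R : realType) (alpha : R) (halpha : 1 < alpha)
  (d : measure_display) (T : measurableType d) (P : probability T R)
  (G : R -> T -> R)
  (hG : continuous_centered_gaussian_process P (G_cov alpha) G) :
  forall f : (R -> R) -> R, skorohod_bounded_continuous f ->
    ((fun n : nat => (cond_expect_bingo alpha n f)%:E) @ \oo
       --> 'E_P[fun w => f (fun t => G t w)])%E.
Proof.
move=> f fc; have [cf mf] := cvg_cE_skorohod halpha hG fc.
have [[M fM] _] := fc.
have [_ cG _] := hG.
rewrite (@expectation_Rintegral _ _ _ P _ M mf); last first.
  by move=> w; apply: fM; exact: continuous_cadlag01.
apply: cvg_EFin; first by near=> n.
apply: (cvgn_close (e := fun=> 0) _ _ cf); last exact: cvg_cst.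
near=> n; have n0 : (0 < n)%N by near: n; exact: nbhs_infty_gt.
by rewrite /= cond_expect_bingoE// subrr normr0.
Unshelve. all: by end_near. Qed.
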